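(* Let $\alpha=\eta+i\zeta$ with $\eta>0$ and $\zeta\neq0$ real, and let $p_n(z)={}_2F_1(-n,\alpha n+1;\alpha n+2;z)$ for $n\in\mathbb{N}$. Let $E$ be the set of $z\in\mathbb{C}\setminus\{0\}$ such that $1\in D_{1/z}$. If $z\in\mathbb{C}$ and $z\notin E$, then $z$ is not the limit of zeros of $p_n$; that is, there is no sequence $(z_n)$ with $p_n(z_n)=0$ and $z_n\to z$ as $n\to\infty$.
   Context: For $z\neq0$ put $\phi(t)=\alpha\log t+\log(1-zt)$, a multivalued function of $t$ with branch points $0$ and $1/z$, whose derivative $\phi'(t)=\frac{\alpha-(\alpha+1)zt}{t(1-zt)}$ is a single-valued rational function. A path of steepest ascent (respectively descent) is a curve in the $t$-plane whose tangent vector is at each point a positive (respectively negative) multiple of $\overline{\phi'(t)}$, the gradient of $\operatorname{Re}\phi$; along it $\operatorname{Im}\phi$, continued analytically along the curve, is constant. This is independent of the choice of branches of the logarithms. The only zero of $\phi'$ is the simple saddle point $t_0=\frac{\alpha}{(\alpha+1)z}$. There are exactly two paths of steepest ascent starting at $t_0$; both go to infinity, and together they split the plane into two closed simply connected regions $D_0$ and $D_{1/z}$, containing $0$ and $1/z$ respectively, such that from each point of $D_0$ there is a path of steepest descent to $0$, and from each point of $D_{1/z}$ there is a path of steepest descent to $1/z$ (for a point on the common boundary of the regions, the path descends to $t_0$ and continues from there along a path of steepest descent). *)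

(* Defs.v *)
From HB Require Import structures.
From mathcomp Require Import all_boot all_order all_algebra.
From mathcomp Require Import complex.
From mathcomp Require Import all_classical all_reals all_analysis.

Set Implicit Arguments.
Unset Strict Implicit.
Unset Printing Implicit Defensive.

Import Order.TTheory GRing.Theory Num.Theory.
Import numFieldNormedType.Exports.
Local Open Scope classical_set_scope.
Local Open Scope complex_scope.
Local Open Scope ring_scope.

(* The usual topology of the complex plane, i.e. that of the norm of R[i]. *)
HB.instance Definition _ (R : realType) := GRing.ComAlgebra.copy R[i] R[i]^o.
HB.instance Definition _ (R : realType) := Vector.copy R[i] R[i]^o.
HB.instance Definition _ (R : realType) := NormedModule.copy R[i] R[i]^o.

(* (a)_k = a (a + 1) ... (a + k - 1) *)
Definition rising (K : nzRingType) (a : K) (k : nat) : K :=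
  \prod_(i < k) (a + i%:R).

(* 2F1(-n, b; c; X): since (-n)_k = 0 for k > n, the hypergeometric series
   stops at k = n. *)
Definition hyp2F1_poly (K : fieldType) (n : nat) (b c : K) : {poly K} :=
  \poly_(k < n.+1)
    (rising (- n%:R) k * rising b k / (rising c k * k`!%:R)).

Definition pn (R : realType) (alpha : R[i]) (n : nat) : {poly R[i]} :=
  hyp2F1_poly n (alpha * n%:R + 1) (alpha * n%:R + 2).

(* The derivative of phi t = alpha log t + log (1 - z t), for t != 0 and
   t != 1/z. *)
Definition dphi (R : realType) (alpha z t : R[i]) : R[i] :=
  (alpha - (alpha + 1) * z * t) / (t * (1 - z * t)).

Definition saddle (R : realType) (alpha z : R[i]) : R[i] :=
  alpha / ((alpha + 1) * z).

(* A path of steepest ascent, parametrized by [0, 1]. The endpoints are exempt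
   from the tangency condition, because the gradient of Re phi vanishes at the
   saddle point; no condition but positivity is put on the speed c. *)
Definition steepest_ascent (R : realType) (alpha z : R[i]) (g : R -> R[i]) :=
  {within `[0, 1], continuous g} /\
  forall s : R, 0 < s < 1 ->
    [/\ g s != 0, 1 - z * g s != 0, dphi alpha z (g s) != 0 &
      exists2 c : R, 0 < c &
        let v := c%:C * (dphi alpha z (g s))^* in
        is_derive s 1 (fun u => complex.Re (g u)) (complex.Re v) /\
        is_derive s 1 (fun u => complex.Im (g u)) (complex.Im v)].

(* The points lying on the paths of steepest ascent that start at the saddle
   point, the saddle point included. Any initial piece of such a path is again
   one, so it is enough to record the endpoints and the points on the way. *)
Definition ascent_curves (R : realType) (alpha z : R[i]) : set R[i] :=
  [set t | exists2 g : R -> R[i], steepest_ascent alpha z g &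
     g 0 = saddle alpha z /\ exists2 s : R, 0 <= s <= 1 & g s = t].

(* The closed region containing p among those into which the curves of steepest
   ascent from the saddle point split the plane: the component of p in their
   complement, together with the bounding curves. Thus D_0 is region alpha z 0
   and D_{1/z} is region alpha z z^-1. *)
Definition region (R : realType) (alpha z p : R[i]) : set R[i] :=
  ascent_curves alpha z `|` connected_component (~` ascent_curves alpha z) p.

Definition exceptional_set (R : realType) (alpha : R[i]) : set R[i] :=
  [set z | z != 0 /\ region alpha z z^-1 1].

(* Main.v *)
Require Import Defs.
From mathcomp Require Import all_boot all_order all_algebra.
From mathcomp Require Import complex.
From mathcomp Require Import all_classical all_reals all_analysis.
From mathcomp Require Import ring lra.

Set Implicit Arguments.
Unset Strict Implicit.
Unset Printing Implicit Defensive.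

Import Order.TTheory GRing.Theory Num.Theory.
Import numFieldNormedType.Exports.
Local Open Scope classical_set_scope.
Local Open Scope complex_scope.
Local Open Scope ring_scope.

(** In the variable x = z t, with N(x) = alpha - (alpha + 1) x, the steepest descent
    curves of phi are the trajectories of the polynomial field - conj (N x) x (1 - x),
    whatever z is; they stay in a disc and t = 1 corresponds to x = z. Along a
    trajectory Im phi is constant, and the argument of 1 - x is bounded on one side
    because the negative half-line of 1 - x can only be crossed in the direction given
    by the sign of zeta. Eliminating the argument of x turns Re phi into a Lyapunov
    function, so the trajectory of z comes arbitrarily close to 0, or to 1, or tends
    to the saddle. In the last case, run backwards, it is an ascent curve through z;
    in the second one it joins z to 1 off the ascent curves, since an ascent curve that
    meets a trajectory continues along its earlier part. Both mean that z is in the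
    exceptional set.
    In the first case, the differential equation of p_n shows that
    N p_n / (1 - x)^n - alpha (1 - x) satisfies a linear equation along the trajectory,
    with growth rate n |N|^2. If p_n vanished close to z for a large n, this
    quantity would be of order 1 at the start and grow without bound, although p_n is
    bounded near 0. *)

(** * Derivative rules, monotonicity and Gronwall inequalities on the line *)

Section Calculus.
Context {R : realType}.
Implicit Types (f g df : R -> R) (s a b : R).

(** Multiplying the gradient by |x (1 - x)|^2 only changes the speed along the curves and removes
    the poles, so trajectories exist for all time and 0, 1 and the saddle become equilibria, which
    are never reached in finite time. The obstacle is that Re phi contains - zeta arg x: a
    trajectory winding around 0 might lower it for ever without approaching any equilibrium. On a
    curve of constant Im phi = zeta ln|x| + eta arg x + arg (1 - x) one has eta arg x = const - zeta
    ln|x| - arg (1 - x), which trades arg x for arg (1 - x), where a one-sided bound is enough. The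
    growth rate n |N|^2 arises because the homogeneous solutions of the equation for p_n / (1 - x)^n
    are multiples of e^(- n phi) / x, and e^(- n phi) grows along descent. The bound on p_n near 0
    may depend on n, since time tends to infinity with n fixed; only the threshold for n has to be
    uniform near z. *)

Lemma derD f g s a b : is_derive s 1 f a -> is_derive s 1 g b ->
  is_derive s 1 (fun u => f u + g u) (a + b).
Proof. by move=> ? ?; exact: is_deriveD. Qed.

Lemma derB f g s a b : is_derive s 1 f a -> is_derive s 1 g b ->
  is_derive s 1 (fun u => f u - g u) (a - b).
Proof. by move=> ? ?; exact: is_deriveB. Qed.

Lemma derN f s a : is_derive s 1 f a -> is_derive s 1 (fun u => - f u) (- a).
Proof. by move=> ?; exact: is_deriveN. Qed.

Lemma derM f g s a b : is_derive s 1 f a -> is_derive s 1 g b ->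
  is_derive s 1 (fun u => f u * g u) (a * g s + f s * b).
Proof.
move=> fa gb; apply: (is_derive_eq (is_deriveM fa gb)).
by rewrite /GRing.scale /= addrC [g s * a]mulrC.
Qed.

Lemma der_comp f g s a b : is_derive s 1 f a -> is_derive (f s) 1 g b ->
  is_derive s 1 (fun u => g (f u)) (b * a).
Proof. by move=> fa gb; exact: (@is_derive1_comp R g f s b a). Qed.

Lemma derV f s a : f s != 0 -> is_derive s 1 f a ->
  is_derive s 1 (fun u => (f u)^-1) (- a / f s ^+ 2).
Proof.
move=> fs0 fa; have := fa => -[dfa Ea].
have dV : derivable (fun u => (f u)^-1) s 1 by exact: derivableV.
apply: DeriveDef => //.
have -> : 'D_1 (fun u => (f u)^-1) s = - f s ^- 2 *: 'D_1 f s by exact: deriveV.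
by rewrite Ea /GRing.scale /= !mulNr mulrC.
Qed.

Lemma der_ln f s a : 0 < f s -> is_derive s 1 f a ->
  is_derive s 1 (fun u => ln (f u)) (a / f s).
Proof. by move=> f0 fa; rewrite mulrC; apply: der_comp => //; exact: is_derive1_ln. Qed.

Lemma der_exp f s a : is_derive s 1 f a ->
  is_derive s 1 (fun u => expR (f u)) (expR (f s) * a).
Proof. by move=> fa; apply: der_comp => //; exact: is_derive_expR. Qed.

Lemma der_sin f s a : is_derive s 1 f a ->
  is_derive s 1 (fun u => sin (f u)) (cos (f s) * a).
Proof. by move=> fa; apply: der_comp => //; exact: is_derive_sin. Qed.

Lemma der_cos f s a : is_derive s 1 f a ->
  is_derive s 1 (fun u => cos (f u)) (- sin (f s) * a).
Proof. by move=> fa; apply: der_comp => //; exact: is_derive_cos. Qed.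

Lemma der_atan f s a : is_derive s 1 f a ->
  is_derive s 1 (fun u => atan (f u)) ((1 + f s ^+ 2)^-1 * a).
Proof. by move=> fa; apply: der_comp => //; exact: is_derive1_atan. Qed.

Lemma der_cst (c : R) s : is_derive s 1 (fun=> c) 0.
Proof. exact: is_derive_cst. Qed.

Lemma der_id s : is_derive s 1 (fun u : R => u) 1.
Proof. exact: is_derive_id. Qed.

Lemma der_cont f s a : is_derive s 1 f a -> {for s, continuous f}.
Proof. by move=> [fa _]; apply: differentiable_continuous; exact/derivable1_diffP. Qed.

Lemma der_within f df a b : (forall s, a <= s <= b -> is_derive s 1 f (df s)) ->
  {within `[a, b], continuous f}.
Proof.
move=> fd; apply: derivable_within_continuous => s; rewrite in_itv /= => /fd [] //.
Qed.

Lemma within_sub f a b c d : a <= c -> d <= b ->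
  {within `[a, b], continuous f} -> {within `[c, d], continuous f}.
Proof.
move=> ac db; apply: continuous_subspaceW => x /=; rewrite !in_itv /= => /andP[cx xd].
by rewrite (le_trans ac cx) (le_trans xd db).
Qed.

Lemma nondecr_within f df a b : a <= b -> {within `[a, b], continuous f} ->
  (forall s, a < s < b -> is_derive s 1 f (df s)) ->
  (forall s, a < s < b -> 0 <= df s) -> f a <= f b.
Proof.
rewrite le_eqVlt => /predU1P[-> //|ab] fc fd f0.
have fd' x : x \in `]a, b[%R -> is_derive x 1 f (df x) by rewrite in_itv => /fd.
have [c cab E] := MVT ab fd' fc.
rewrite -subr_ge0 E mulr_ge0 ?subr_ge0 ?(ltW ab) //; apply: f0.
by rewrite in_itv /= in cab.
Qed.

Lemma incr_within f df a b : a < b -> {within `[a, b], continuous f} ->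
  (forall s, a < s < b -> is_derive s 1 f (df s)) ->
  (forall s, a < s < b -> 0 < df s) -> f a < f b.
Proof.
move=> ab fc fd f0.
have fd' x : x \in `]a, b[%R -> is_derive x 1 f (df x) by rewrite in_itv => /fd.
have [c cab E] := MVT ab fd' fc.
rewrite -subr_gt0 E mulr_gt0 ?subr_gt0 //; apply: f0.
by rewrite in_itv /= in cab.
Qed.

Lemma nondecr f df a b : a <= b -> (forall s, a <= s <= b -> is_derive s 1 f (df s)) ->
  (forall s, a <= s <= b -> 0 <= df s) -> f a <= f b.
Proof.
move=> ab fd f0; apply: (nondecr_within ab (der_within fd)) => s /andP[/ltW ? /ltW ?].
  by apply: fd; apply/andP.
by apply: f0; apply/andP.
Qed.

Lemma const_der f a b : a <= b -> (forall s, a <= s <= b -> is_derive s 1 f 0) ->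
  f a = f b.
Proof.
move=> ab fd; apply/eqP; rewrite eq_le (nondecr ab fd) //=.
rewrite -lerN2; apply: (@nondecr (fun u => - f u) (fun=> 0) _ _ ab) => [s /fd fs|//].
by rewrite -oppr0; exact: derN.
Qed.

(** The integrating factor [expR (- k * s)] makes f - B monotone. B is the equilibrium of the
    comparison equation, so a constant forcing term is absorbed into it. *)
Lemma gronwall_lower f df k B :
  (forall s, 0 <= s -> is_derive s 1 f (df s)) ->
  (forall s, 0 <= s -> k * f s - k * B <= df s) ->
  forall s, 0 <= s -> (f 0 - B) * expR (k * s) + B <= f s.
Proof.
move=> fd fk s s0.
pose F (u : R) := (f u - B) * expR (- k * u).
have Fd (u : R) : 0 <= u -> is_derive u 1 F (df u * expR (- k * u) - (f u - B) * expR (- k * u) * k).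
  move=> u0; have H := derB (fd u u0) (der_cst B u).
  have K := der_exp (derM (der_cst (- k) u) (der_id u)).
  by apply: (is_derive_eq (derM H K)); ring.
have : F 0 <= F s.
  apply: (nondecr s0) => [u /andP[u0 _]|u /andP[u0 _]]; first exact: Fd.
  rewrite subr_ge0 mulrAC ler_wpM2r ?expR_ge0 //.
  by rewrite mulrC mulrBr; exact: fk.
rewrite /F mulr0 expR0 mulr1 => H; rewrite -lerBrDr.
have := ler_wpM2r (expR_ge0 (k * s)) H.
by rewrite -mulrA -expRD mulNr addNr expR0 mulr1.
Qed.

Lemma gronwall_upper f df k :
  (forall s, 0 <= s -> is_derive s 1 f (df s)) ->
  (forall s, 0 <= s -> df s <= k * f s) ->
  forall s, 0 <= s -> f s <= f 0 * expR (k * s).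
Proof.
move=> fd fk s s0; rewrite -lerN2.
have := @gronwall_lower (fun u => - f u) (fun u => - df u) k 0.
move=> /(_ (fun u u0 => derN (fd u u0)) _ s s0); rewrite subr0 addr0 mulNr; apply.
by move=> u u0; rewrite mulr0 subr0 mulrN lerN2; exact: fk.
Qed.

End Calculus.

Ltac der := first
  [ eassumption | notypeclasses refine (der_id _) | notypeclasses refine (der_cst _ _)
  | notypeclasses refine (derB _ _); der | notypeclasses refine (derD _ _); der
  | notypeclasses refine (derN _); der | notypeclasses refine (derM _ _); der ].
Ltac der_eq := notypeclasses refine (is_derive_eq _ _); [der | cbv beta].

(** * Levels that a function cannot cross *)

Section Barriers.
Context {R : realType}.
Implicit Types (f g h dh : R -> R) (s a b r e d t u c : R).

Lemma within_eps h a b : {within `[a, b], continuous h} <->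
  forall s : R, a <= s <= b -> forall e : R, 0 < e -> exists2 d : R, 0 < d &
    forall t : R, a <= t <= b -> `|s - t| < d -> `|h s - h t| < e.
Proof.
split=> [/subspace_continuousP hc s sab e e0|hc].
  have /hc /cvgrPdist_lt /(_ _ e0) : `[a, b]%classic s by rewrite /= in_itv.
  rewrite near_withinE /= => -[d /= d0 D]; exists d => // t tab st.
  by apply: D => //=; rewrite in_itv.
apply/subspace_continuousP => s /=; rewrite in_itv /= => sab.
apply/cvgrPdist_lt => e e0; rewrite near_withinE.
have [d d0 D] := hc s sab e e0; exists d => // t /= st; rewrite in_itv /= => tab.
exact: D.
Qed.

(** c is the last time at which h is at least r, so the whole stretch after c lies below r and a
    monotonicity argument can run on it. *)
Lemma last_exit h a b r : a <= b -> {within `[a, b], continuous h} ->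
  r <= h a -> h b < r ->
  exists c, [/\ a <= c < b, h c = r & forall s, c < s <= b -> h s < r].
Proof.
move=> ab /within_eps hc ra rb.
pose A := [set s | a <= s <= b /\ r <= h s].
have Aa : A a by split; rewrite ?lexx ?ab.
have Ab : ubound A b by move=> s [/andP[_ ?]].
have sA : has_sup A by split; [exists a | exists b].
pose c := sup A.
have ac : a <= c by apply: ub_le_sup => //; exists b.
have cb : c <= b by apply: ge_sup => //; exists a.
have cab : a <= c <= b by rewrite ac cb.
have above s : c < s <= b -> h s < r.
  move=> /andP[cs sb]; rewrite ltNge; apply/negP => rs.
  have : s <= c by apply: ub_le_sup; [exists b|split; rewrite // sb (le_trans ac (ltW cs))].
  by rewrite leNgt cs.
have rc : r <= h c.
  rewrite leNgt; apply/negP => hcr.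
  have [|d d0 D] := hc c cab (r - h c); first by rewrite subr_gt0.
  have [s [sab rs] sc] := sup_adherent d0 sA.
  have scl : s <= c by apply: ub_le_sup => //; exists b.
  have := D s sab; rewrite ger0_norm ?subr_ge0 // -/c in sc *.
  have -> : c - s < d by rewrite -/c in sc; lra.
  move=> /(_ isT); rewrite ltr_norml => /andP[]; lra.
have cltb : c < b.
  by rewrite lt_neqAle cb andbT; apply: contraTneq rc => ->; rewrite -ltNge.
exists c; split => //; first by rewrite ac cltb.
apply/eqP; rewrite eq_le rc andbT leNgt; apply/negP => rhc.
have [|d d0 D] := hc c cab (h c - r); first by rewrite subr_gt0.
pose t := Num.min b (c + d / 2).
have ct : c < t by rewrite lt_min cltb /=; lra.
have tb : t <= b by rewrite ge_min lexx.
have tcd : t <= c + d / 2 by rewrite ge_min lexx orbT.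
have := D t; rewrite (le_trans ac (ltW ct)) tb => /(_ isT).
rewrite ltr0_norm ?subr_lt0 // opprB => /(_ ltac:(lra)).
have := above t; rewrite ct tb => /(_ isT) ?.
by rewrite ltr_norml => /andP[]; lra.
Qed.

(** Just after the last time at which h is at most r, continuity keeps h in the collar between r and
    r', where it cannot increase. Restricting the sign condition to the collar permits a field that
    is the right one only on a bounded set. *)
Lemma barrier_down h dh r r' : r < r' ->
  (forall s, 0 <= s -> is_derive s 1 h (dh s)) -> h 0 <= r ->
  (forall s, 0 <= s -> r < h s < r' -> dh s <= 0) ->
  forall s, 0 <= s -> h s <= r.
Proof.
move=> rr' hd h0 hr s s0; rewrite leNgt; apply/negP => rs.
have hc a b : 0 <= a -> {within `[a, b], continuous h}.
  by move=> a0; apply: (der_within (df := dh)) => u /andP[au _]; apply: hd; exact: le_trans au.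
have hNc a b : 0 <= a -> {within `[a, b], continuous (fun u => - h u)}.
  move=> a0; apply: (der_within (df := fun u => - dh u)) => u /andP[au _].
  by apply: derN; apply: hd; exact: le_trans au.
have h0' : - r <= - h 0 by rewrite lerN2.
have rs' : - h s < - r by rewrite ltrN2.
have [c [/andP[c0 cs] hcr above]] := last_exit s0 (hNc 0 s (lexx _)) h0' rs'.
have {}hcr : h c = r by apply: oppr_inj.
have {}above u : c < u <= s -> r < h u by move=> /above; rewrite ltrN2.
have /within_eps hcs := hc c s c0.
have rr0 : 0 < r' - r by rewrite subr_gt0.
have ccs : c <= c <= s by rewrite lexx ltW.
have [d d0 D] := hcs c ccs _ rr0.
pose t := Num.min s (c + d / 2).
have ct : c < t by rewrite lt_min cs /=; lra.
have ts : t <= s by rewrite ge_min lexx.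
have tcd : t <= c + d / 2 by rewrite ge_min lexx orbT.
have : - h c <= - h t.
  apply: (@nondecr_within _ (fun u => - h u) (fun u => - dh u)) => //.
  - exact: ltW.
  - exact: hNc.
  - by move=> u /andP[cu _]; apply: derN; apply: hd; lra.
  move=> u /andP[cu ut]; rewrite oppr_ge0; apply: hr; first lra.
  rewrite above ?cu /=; last lra.
  have := D u; rewrite (ltW cu) (le_trans (ltW ut) ts) hcr => /(_ isT).
  by rewrite ltr0_norm ?subr_lt0 // opprB => /(_ ltac:(lra)); rewrite ltr_norml => /andP[]; lra.
by rewrite hcr lerN2 leNgt above // ct ts.
Qed.

(* A level that is only ever crossed upwards is never left downwards. *)
Lemma barrier_cross h dh r :
  (forall s, 0 <= s -> is_derive s 1 h (dh s)) -> r <= h 0 ->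
  (forall s, 0 <= s -> h s = r -> 0 < dh s) ->
  forall s, 0 <= s -> r <= h s.
Proof.
move=> hd h0 hr s s0; rewrite leNgt; apply/negP => rs.
have hc a b : 0 <= a -> {within `[a, b], continuous h}.
  by move=> a0; apply: (der_within (df := dh)) => u /andP[au _]; apply: hd; exact: le_trans au.
have [c [/andP[c0 cs] hcr above]] := last_exit s0 (hc 0 s (lexx _)) h0 rs.
have dc := hr c c0 hcr; have [dvc Ec] := hd c c0.
have /cvgrPdist_lt /(_ _ dc) : (fun x => x^-1 *: (h (x *: 1 + c) - h c)) @ 0^' --> dh c.
  by rewrite -Ec.
rewrite near_withinE /= => -[d /= d0 D].
pose t := Num.min (s - c) (d / 2).
have t0 : 0 < t by rewrite lt_min subr_gt0 cs /=; lra.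
have ts : t <= s - c by rewrite ge_min lexx.
have td : t <= d / 2 by rewrite ge_min lexx orbT.
have := D t; rewrite /= sub0r normrN gtr0_norm // => /(_ ltac:(lra) (lt0r_neq0 t0)).
rewrite /GRing.scale /= mulr1 => H.
have : h (t + c) < r by apply: above; apply/andP; split; lra.
rewrite -hcr => ht.
have : t^-1 * (h (t + c) - h c) < 0 by rewrite nmulr_llt0 ?invr_gt0 // subr_lt0.
by move: H; rewrite ltr_norml => /andP[]; lra.
Qed.

End Barriers.

(** * Primitives, geometric limits and Barbalat's lemma *)

Section Primitive.
Context {R : realType}.
Implicit Types (f g h : R -> R) (s a b r e d t u c T : R).

Lemma primitive_exists g : continuous g ->
  exists G, [/\ G 0 = 0, continuous G & forall s, 0 <= s -> is_derive s 1 G (g s)].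
Proof.
move=> gc.
have gi (u : R) : (@lebesgue_measure R).-integrable `[-1, u] (EFin \o g).
  by apply: continuous_compact_integrable; [exact: segment_compact | exact: continuous_subspaceT].
(* Integrating from -1 makes 0 an interior point, so the derivative at 0 is two-sided; freezing the
   argument below -1/2 (the function [m]) then gives continuity on the whole line. *)
pose F (u : R) := (\int[@lebesgue_measure R]_(t in [set` `[(-1 : R), u]]) g t)%R.
have Fd (u : R) : -1 < u -> is_derive u 1 F (g u).
  move=> u1; have u2 : u < u + 1 by rewrite ltrDl.
  have [dF EF] : derivable F u 1 /\ F^`()%classic u = g u.
    exact: (continuous_FTC1_closed u2 (gi _) u1 (gc u)).
  exact: (DeriveDef dF (etrans (esym (derive1E F u)) EF)).
pose m (u : R) := Num.max u (- 2^-1) : R.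
have m1 (u : R) : -1 < m u by rewrite lt_max; apply/orP; right; lra.
have mc : continuous m.
  move=> u; apply: (@continuous_max _ _ (fun x : R => x) (fun=> - 2^-1)); first exact: cvg_id.
  exact: cvg_cst.
exists (fun u => F (m u) - F 0); split.
- by rewrite /m max_l ?subrr //; lra.
- move=> u; apply: cvgB; last exact: cvg_cst.
  by apply: (@continuous_comp _ _ _ m F); [exact: mc | apply: (der_cont (Fd _ (m1 u)))].
move=> s s0; rewrite -[g s]subr0.
have H : is_derive s 1 (fun u => F u - F 0) (g s - 0).
  have Fs : is_derive s 1 F (g s) by apply: Fd; lra.
  by der.
apply: near_eq_is_derive H; apply/nbhs_ballP; exists 2^-1 => /=; first by rewrite invr_gt0.
move=> u; rewrite /ball /= ltr_norml => /andP[_ us].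
by rewrite /m max_l //; lra.
Qed.

(** The intervals of radius 2 C / 2^n around u n are nested; the supremum of their left ends is the
    limit, with an explicit error. *)
Lemma geometric_limit (u : nat -> R) (C : R) :
  (forall n, `|u n.+1 - u n| <= C * 2^-1 ^+ n) ->
  exists l, forall n, `|u n - l| <= 2 * C * 2^-1 ^+ n.
Proof.
move=> uC.
have C0 : 0 <= C by have := uC 0%N; rewrite expr0 mulr1; exact: le_trans.
have p0 n : 0 <= (2^-1 : R) ^+ n by rewrite exprn_ge0 // invr_ge0.
pose L n := u n - 2 * C * 2^-1 ^+ n; pose U n := u n + 2 * C * 2^-1 ^+ n.
have LL n : L n <= L n.+1.
  have := uC n; rewrite ler_norml /L exprS => /andP[]; set p := 2^-1 ^+ n; nra.
have UU n : U n.+1 <= U n.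
  have := uC n; rewrite ler_norml /U exprS => /andP[]; set p := 2^-1 ^+ n; nra.
have LU n : L n <= U n by rewrite /L /U; have := mulr_ge0 C0 (p0 n); lra.
have Lm n m : L n <= L (n + m)%N.
  by elim: m => [|m IH]; [rewrite addn0 | rewrite addnS (le_trans IH)].
have Um n m : U (n + m)%N <= U n.
  by elim: m => [|m IH]; [rewrite addn0 | rewrite addnS (le_trans _ IH)].
have LUmn n m : L n <= U m.
  by apply: le_trans (Lm n m) _; apply: le_trans (LU _) _; rewrite addnC.
exists (sup (range L)) => n; rewrite ler_distl; apply/andP; split.
  rewrite lerBlDr -/(U n); apply: ge_sup; first by exists (L 0%N); exists 0%N.
  by move=> _ [m _ <-].
rewrite -lerBlDr -/(L n).
by apply: ub_le_sup; [exists (U 0%N) => _ [m _ <-] | exists n].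
Qed.

(** Whenever h reaches e it stays above e/2 for a time tau = e / (2 C), which costs V at least e tau
    / 2; V is bounded below, so this happens only finitely often on disjoint stretches. *)
Lemma barbalat (V h : R -> R) (B C : R) : 0 < C ->
  (forall s, 0 <= s -> is_derive s 1 V (- h s)) ->
  (forall s, 0 <= s -> B <= V s) -> (forall s, 0 <= s -> 0 <= h s) ->
  (forall s t : R, 0 <= s <= t -> h s - C * (t - s) <= h t) ->
  forall e, 0 < e -> exists2 T, 0 <= T & forall s, T <= s -> h s < e.
Proof.
move=> C0 Vd VB h0 hC e e0.
have [//|noT] := pselect (exists2 T, 0 <= T & forall s, T <= s -> h s < e).
have late (T : R) : 0 <= T -> exists2 s, T <= s & e <= h s.
  move=> T0; apply: contrapT => no; apply: noT; exists T => // s Ts.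
  by rewrite ltNge; apply/negP => es; apply: no; exists s.
have Vmono (s t : R) : 0 <= s -> s <= t -> V t <= V s.
  move=> s0 st; rewrite -lerN2; apply: (@nondecr _ (fun u => - V u) (fun u => - - h u)) => // u /andP[su _].
    by apply: derN; apply: Vd; lra.
  by rewrite opprK h0 //; lra.
pose tau := e / (2 * C).
have tau0 : 0 < tau by rewrite divr_gt0 // mulr_gt0.
have drop (s : R) : 0 <= s -> e <= h s -> V (s + tau) <= V s - e / 2 * tau.
  move=> s0 es.
  pose W u := - (V u - V s) - e / 2 * (u - s).
  pose dW u := - (- h u - 0) - (0 * (u - s) + e / 2 * (1 - 0)).
  have : W s <= W (s + tau).
    apply: (@nondecr _ W dW); first lra.
      move=> u /andP[su _].
      have u0 : 0 <= u by lra.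
      have Vu := Vd u u0.
      rewrite /W.
      der_eq.
      rewrite /dW; ring.
    move=> u /andP[su ut].
    have := hC s u; rewrite s0 su => /(_ isT) Hu.
    have : C * (u - s) <= C * tau by rewrite ler_pM2l //; lra.
    have -> : C * tau = e / 2 by rewrite /tau; field; rewrite lt0r_neq0.
    rewrite /dW; lra.
  rewrite /W; lra.
have steps k : exists2 s : R, 0 <= s & V s <= V 0 - k%:R * (e / 2 * tau).
  elim: k => [|k [s s0 IH]]; first by exists 0 => //; rewrite mul0r subr0.
  have [t st et] := late s s0; have t0 : 0 <= t by exact: le_trans st.
  exists (t + tau); first lra.
  have := drop t t0 et; have := Vmono s t s0 st; rewrite -[k.+1%:R]natr1; lra.
have D0 : 0 < e / 2 * tau by rewrite mulr_gt0 // divr_gt0.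
have [k Hk] : exists k : nat, (V 0 - B) / (e / 2 * tau) < k%:R.
  by exists (Num.bound ((V 0 - B) / (e / 2 * tau))); apply: archi_boundP; rewrite divr_ge0 ?subr_ge0 ?VB // ltW.
have [s s0 Vs] := steps k; have := VB s s0.
by move: Hk; rewrite ltr_pdivrMr //; lra.
Qed.

End Primitive.

(** Boundedness is included so that the class is closed under products: every polynomial in clipped
    coordinates then belongs to it. *)
Definition bounded_lipschitz {R : realType} (F : R -> R -> R) := exists M L : R,
  (forall a b, `|F a b| <= M) /\
  (forall a b a' b', `|F a b - F a' b'| <= L * (`|a - a'| + `|b - b'|)).

(** * Global solutions of planar systems by Picard iteration *)

Section Picard.
Context {R : realType}.
Implicit Types (f g h a b : R -> R) (s t u e M L C k : R) (F G : R -> R -> R).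

Lemma geometric_small (x K : R) : (forall n, x <= K * 2^-1 ^+ n) -> x <= 0.
Proof.
move=> xK; rewrite leNgt; apply/negP => x0.
have K0 : 0 < K by apply: lt_le_trans x0 _; have := xK 0%N; rewrite expr0 mulr1.
pose n := Num.bound (K / x).
have Kn : K / x < n%:R by apply: archi_boundP; rewrite divr_ge0 ?ltW.
have := xK n; rewrite exprVn ler_pdivlMr ?exprn_gt0 // => H.
have : (n%:R : R) <= 2 ^+ n by rewrite -natrX ler_nat ltnW // ltn_expl.
move=> nn.
have : x * n%:R <= K by apply: le_trans H; rewrite ler_pM2l.
by rewrite leNgt => /negP; apply; rewrite mulrC -ltr_pdivrMr.
Qed.

Lemma bounded_lipschitz_continuous F a b : bounded_lipschitz F ->
  continuous a -> continuous b -> continuous (fun s => F (a s) (b s)).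
Proof.
move=> [M [L [_ FL]]] ac bc s; apply/cvgrPdist_lt => e e0.
pose d := e / (2 * (`|L| + 1)).
have L1 : 0 < `|L| + 1 by rewrite ltr_wpDl.
have d0 : 0 < d by rewrite divr_gt0 // mulr_gt0.
have /cvgrPdist_lt /(_ _ d0) Ha := ac s; have /cvgrPdist_lt /(_ _ d0) Hb := bc s.
near=> t.
have Hat : `|a s - a t| < d by near: t.
have Hbt : `|b s - b t| < d by near: t.
apply: le_lt_trans (FL _ _ _ _) _.
apply: (@le_lt_trans _ _ (`|L| * (d + d))).
  apply: le_trans (ler_norm _) _; rewrite normrM ler_wpM2l // ger0_norm ?addr_ge0 //.
  by rewrite lerD // ltW.
have -> : e = (`|L| + 1) * (d + d) by rewrite /d; field; rewrite lt0r_neq0.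
by rewrite ltr_pM2r ?addr_gt0 // ltrDl.
Unshelve. all: by end_near. Qed.

Lemma abs_le_of_der f h df dh : `|f 0| <= h 0 ->
  (forall s, 0 <= s -> is_derive s 1 f (df s)) ->
  (forall s, 0 <= s -> is_derive s 1 h (dh s)) ->
  (forall s, 0 <= s -> `|df s| <= dh s) ->
  forall s, 0 <= s -> `|f s| <= h s.
Proof.
move=> f0 fd hd dfh s s0; move: f0; rewrite !ler_norml => /andP[f1 f2].
have H1 : h 0 - f 0 <= h s - f s.
  apply: (@nondecr _ (fun u => h u - f u) (fun u => dh u - df u)) => // u /andP[u0 _].
    by apply: derB; [exact: hd | exact: fd].
  by rewrite subr_ge0 (le_trans (ler_norm _)) // dfh.
have H2 : h 0 + f 0 <= h s + f s.
  apply: (@nondecr _ (fun u => h u + f u) (fun u => dh u + df u)) => // u /andP[u0 _].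
    by apply: derD; [exact: hd | exact: fd].
  have := dfh u u0; rewrite ler_norml => /andP[]; lra.
by apply/andP; split; lra.
Qed.

(** The default [cst 0] makes the primitive total, so that the Picard iterates can be written down
    before their continuity is proved. *)
Definition prim g : R -> R :=
  if pselect (continuous g) is left gc then projT1 (cid (primitive_exists gc)) else cst 0.

Lemma primP g : continuous g -> [/\ prim g 0 = 0, continuous (prim g) &
  forall s, 0 <= s -> is_derive s 1 (prim g) (g s)].
Proof. by move=> gc; rewrite /prim; case: pselect => // ?; case: cid. Qed.

Lemma picard F G (p q : R) : bounded_lipschitz F -> bounded_lipschitz G ->
  exists a b, [/\ a 0 = p, b 0 = q, continuous a, continuous b &
    forall s, 0 <= s -> is_derive s 1 a (F (a s) (b s)) /\
                        is_derive s 1 b (G (a s) (b s))].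
Proof.
move=> lF lG; have [MF [LF [FM FL]]] := lF; have [MG [LG [GM GL]]] := lG.
(* The Lipschitz estimate for two coordinates costs a factor 2 L, so k = 4 L halves the weighted
   distance at each iteration; C = M / k makes the first difference, of slope at most M, fit under
   the weight. *)
pose L : R := 1 + `|LF| + `|LG|; pose M : R := `|MF| + `|MG|; pose k : R := 4 * L; pose C : R := M / k.
have L0 : 0 < L by rewrite /L; have := normr_ge0 LF; have := normr_ge0 LG; lra.
have M0 : 0 <= M by rewrite addr_ge0.
have k0 : 0 < k by rewrite mulr_gt0.
have C0 : 0 <= C by rewrite divr_ge0 // ltW.
have kC : k * C = M by rewrite /C; field; rewrite lt0r_neq0.
pose good (H : R -> R -> R) := [/\ bounded_lipschitz H, forall a b : R, `|H a b| <= M &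
  forall a b a' b' : R, `|H a b - H a' b'| <= L * (`|a - a'| + `|b - b'|)].
have gF : good F.
  split=> // [a b|a b a' b']; first by rewrite (le_trans (FM a b)) // (le_trans (ler_norm _)) // lerDl.
  apply: le_trans (FL _ _ _ _) _; rewrite ler_wpM2r ?addr_ge0 //.
  by have := normr_ge0 LG; have := ler_norm LF; rewrite /L; lra.
have gG : good G.
  split=> // [a b|a b a' b']; first by rewrite (le_trans (GM a b)) // (le_trans (ler_norm _)) // lerDr.
  apply: le_trans (GL _ _ _ _) _; rewrite ler_wpM2r ?addr_ge0 //.
  by have := normr_ge0 LF; have := ler_norm LG; rewrite /L; lra.
pose T H (r : R) (ab : (R -> R) * (R -> R)) (s : R) := r + prim (fun u => H (ab.1 u) (ab.2 u)) s.
have TP H r ab : good H -> continuous ab.1 -> continuous ab.2 ->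
    [/\ T H r ab 0 = r, continuous (T H r ab) &
       forall s, 0 <= s -> is_derive s 1 (T H r ab) (H (ab.1 s) (ab.2 s))].
  move=> [lH _ _] c1 c2; have [P0 Pc Pd] := primP (bounded_lipschitz_continuous lH c1 c2).
  split; first by rewrite /T P0 addr0.
    by move=> s; apply: cvgD; [exact: cvg_cst | exact: Pc].
  by move=> s s0; have Ps := Pd s s0; rewrite /T -[H _ _]add0r; der.
pose step ab := (T F p ab, T G q ab).
pose Y n := iter n step (fun=> p, fun=> q).
have Yc n : continuous (Y n).1 /\ continuous (Y n).2.
  elim: n => [|n [c1 c2]]; first by split=> s; exact: cvg_cst.
  by split; [have [] := TP F p _ gF c1 c2 | have [] := TP G q _ gG c1 c2].
(* The weight exp (k s) makes the Picard map a contraction on the whole half-line. *)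
pose E n (s : R) := C * 2^-1 ^+ n * expR (k * s).
have p2 n : 0 <= (2^-1 : R) ^+ n by rewrite exprn_ge0 // invr_ge0.
have E0 n s : 0 <= E n s by rewrite mulr_ge0 ?expR_ge0 // mulr_ge0.
have Ed n s : is_derive s 1 (E n) (k * E n s).
  have H := der_exp (derM (der_cst k s) (der_id s)).
  apply: (is_derive_eq (derM (der_cst (C * 2^-1 ^+ n) s) H)).
  by rewrite !mul0r !add0r mulr1 /E mulrA mulrC.
have Edist n s H (ab cd : (R -> R) * (R -> R)) K : good H ->
    `|ab.1 s - cd.1 s| <= K * E n s -> `|ab.2 s - cd.2 s| <= K * E n s ->
    `|H (ab.1 s) (ab.2 s) - H (cd.1 s) (cd.2 s)| <= K * 2^-1 * (k * E n s).
  move=> [_ _ HL] h1 h2; apply: le_trans (HL _ _ _ _) _.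
  have -> : K * 2^-1 * (k * E n s) = L * (K * E n s + K * E n s) by rewrite /k; field.
  by rewrite ler_wpM2l ?(ltW L0) // lerD.
have half n s : E n.+1 s = 2^-1 * E n s by rewrite /E exprS; set w := 2^-1 ^+ n; field.
have close n : forall s, 0 <= s ->
    `|(Y n.+1).1 s - (Y n).1 s| <= E n s /\ `|(Y n.+1).2 s - (Y n).2 s| <= E n s.
  elim: n => [|n IH] s s0.
    suff one H r : good H -> `|T H r (Y 0%N) s - r| <= E 0%N s by split; apply: one.
    move=> gH; have [T0 _ Td] := TP H r (Y 0%N) gH (Yc 0%N).1 (Yc 0%N).2.
    apply: (@abs_le_of_der (fun u => T H r (Y 0%N) u - r) _ (fun u => H p q - 0) (fun u => k * E 0%N u)) => //.
    - by rewrite T0 subrr normr0.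
    - by move=> u /Td Tu; der.
    move=> u u0; rewrite subr0; have [_ HM _] := gH; apply: le_trans (HM _ _) _.
    by rewrite /E expr0 mulr1 mulrA kC ler_peMr // -expR0 ler_expR mulr_ge0 // ltW.
  have [c1 c2] := Yc n; have [d1 d2] := Yc n.+1.
  suff one H r : good H -> `|T H r (Y n.+1) s - T H r (Y n) s| <= E n.+1 s by split; apply: one.
  move=> gH; have [T0 _ Td] := TP H r _ gH c1 c2; have [S0 _ Sd] := TP H r _ gH d1 d2.
  apply: (@abs_le_of_der (fun u => T H r (Y n.+1) u - T H r (Y n) u) _ (fun u => H ((Y n.+1).1 u) ((Y n.+1).2 u) - H ((Y n).1 u) ((Y n).2 u)) (fun u => k * E n.+1 u)) => //.
  - by rewrite T0 S0 subrr normr0.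
  - by move=> u u0; have Tu := Td u u0; have Su := Sd u u0; der.
  move=> u u0; rewrite half; have [h1 h2] := IH u u0.
  have := @Edist n u H (Y n.+1) (Y n) 1 gH; rewrite !mul1r mulrCA; exact.
have lim i : exists y : R -> R, forall s n, 0 <= s ->
    `|(if i then (Y n).1 else (Y n).2) s - y s| <= 2 * E n s.
  have /choice[y yP] : forall s : R, exists l : R, 0 <= s -> forall n,
      `|(if i then (Y n).1 else (Y n).2) s - l| <= 2 * E n s.
    move=> s; have [s0|s0] := leP 0 s; last by exists 0.
    have [n|l lP] := @geometric_limit R (fun n => (if i then (Y n).1 else (Y n).2) s) (C * expR (k * s)).
      by have [h1 h2] := close n s s0; rewrite mulrAC; case: i.
    by exists l => _ n; have := lP n; rewrite /E -mulrA [C * expR _ * _]mulrAC.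
  by exists y => s n s0; exact: yP.
have [y1 Hy1] := lim true; have [y2 Hy2] := lim false; rewrite /= in Hy1 Hy2.
have lipY n H r : good H -> forall s t, 0 <= s -> s <= t -> `|T H r (Y n) t - T H r (Y n) s| <= M * (t - s).
  move=> gH s t s0 st; have [T0 _ Td] := TP H r _ gH (Yc n).1 (Yc n).2.
  have [_ HM _] := gH.
  have st0 : 0 <= t - s by rewrite subr_ge0.
  pose ft (u : R) := T H r (Y n) (s + u) - T H r (Y n) s.
  have ftd (u : R) : 0 <= u -> is_derive u 1 ft (H ((Y n).1 (s + u)) ((Y n).2 (s + u)) * (0 + 1) - 0).
    move=> u0; have Tu := Td (s + u) (addr_ge0 s0 u0).
    have Q : is_derive u 1 (fun v => s + v) (0 + 1) by der.
    by have := der_comp Q Tu => Q'; rewrite /ft; der.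
  have := @abs_le_of_der ft (fun u => M * u) _ (fun u => 0 * u + M * 1) _ ftd _ _ (t - s) st0.
  rewrite /ft [s + (t - s)]addrC subrK; apply.
  - by rewrite addr0 subrr normr0 mulr0.
  - by move=> u _; der.
  by move=> u u0; rewrite subr0 add0r mulr1 mul0r add0r mulr1 HM.
(* The limits are controlled for s >= 0 only; the absolute value extends them evenly to functions
   continuous on the whole line, as [primP] requires. *)
have cont (i : bool) (y : R -> R) : (forall s n, 0 <= s ->
    `|(if i then (Y n).1 else (Y n).2) s - y s| <= 2 * E n s) -> continuous (fun s => y `|s|).
  move=> Hy.
  have Hlip s t : 0 <= s -> s <= t -> `|y t - y s| <= M * (t - s).
    move=> s0 st; rewrite -subr_le0; apply: (@geometric_small _ (2 * C * expR (k * t) + 2 * C * expR (k * s))) => n.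
    have t0 : 0 <= t by exact: le_trans st.
    have h1 := Hy t n.+1 t0; have h2 := Hy s n.+1 s0.
    have h3 : `|(if i then (Y n.+1).1 else (Y n.+1).2) t - (if i then (Y n.+1).1 else (Y n.+1).2) s| <= M * (t - s).
      by case: (i); apply: lipY.
    have := ler_normD ((if i then (Y n.+1).1 else (Y n.+1).2) t - (if i then (Y n.+1).1 else (Y n.+1).2) s) (- ((if i then (Y n.+1).1 else (Y n.+1).2) t - y t) + ((if i then (Y n.+1).1 else (Y n.+1).2) s - y s)).
    have := ler_normD (- ((if i then (Y n.+1).1 else (Y n.+1).2) t - y t)) ((if i then (Y n.+1).1 else (Y n.+1).2) s - y s).
    rewrite normrN; set A := _ - _ + _ => h4; have -> : A = y t - y s by rewrite /A; ring.
    rewrite !half in h1 h2; have := E0 n t; have := E0 n s; move: h1 h2 h3 h4.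
    have -> : (2 * C * expR (k * t) + 2 * C * expR (k * s)) * 2^-1 ^+ n = 2 * E n t + 2 * E n s by rewrite /E; set w := 2^-1 ^+ n; ring.
    lra.
  move=> s; apply/cvgrPdist_lt => e e0.
  have M1 : 0 < M + 1 by lra.
  apply/nbhs_ballP; exists (e / (M + 1)) => /=; first by rewrite divr_gt0.
  move=> t; rewrite /ball /= ltr_pdivlMr // => st.
  apply: (@le_lt_trans _ _ (M * `|(`|s| - `|t|)|)).
    have [ab|/ltW ab] := leP `|s| `|t|.
      by rewrite distrC [in leRHS]distrC [`|_ - `|s| |]ger0_norm ?subr_ge0 // Hlip.
    by rewrite [`|_ - `|t| |]ger0_norm ?subr_ge0 // Hlip.
  apply: (@le_lt_trans _ _ (M * `|s - t|)); first by rewrite ler_wpM2l // ler_dist_dist.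
  have := normr_ge0 (s - t); nra.
have c1 := cont true y1 Hy1; have c2 := cont false y2 Hy2.
(* The solution is taken to be the Picard image of the limit, which is differentiable by
   construction; [lim_eq] then identifies it with the limit itself. *)
pose yy := ((fun s : R => y1 `|s|), (fun s : R => y2 `|s|)).
have [A0 Ac Ad] := TP F p yy gF c1 c2; have [B0 Bc Bd] := TP G q yy gG c1 c2.
have lim_eq (i : bool) (y : R -> R) H r : good H -> (forall s n, 0 <= s ->
    `|(if i then (Y n).1 else (Y n).2) s - y s| <= 2 * E n s) ->
    (forall n, (if i then (Y n.+1).1 else (Y n.+1).2) = T H r (Y n)) ->
    forall s, 0 <= s -> T H r yy s = y s.
  move=> gH Hy HT s s0; apply/eqP; rewrite -subr_eq0 -normr_le0.
  apply: (@geometric_small _ (3 * C * expR (k * s))) => n.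
  have h1 := Hy s n.+1 s0; rewrite HT half in h1.
  have [T0 _ Td] := TP H r _ gH (Yc n).1 (Yc n).2; have [S0 _ Sd] := TP H r yy gH c1 c2.
  have h2 : `|T H r yy s - T H r (Y n) s| <= E n s.
    apply: (@abs_le_of_der (fun u => T H r yy u - T H r (Y n) u) _ (fun u => H (yy.1 u) (yy.2 u) - H ((Y n).1 u) ((Y n).2 u)) (fun u => k * E n u)) => //.
    - by rewrite T0 S0 subrr normr0.
    - by move=> u u0; have Tu := Td u u0; have Su := Sd u u0; der.
    move=> u u0; have := @Edist n u H yy (Y n) 2 gH; rewrite divff // mul1r; apply.
      by rewrite /yy /= [`|u|]ger0_norm // distrC Hy1.
    by rewrite /yy /= [`|u|]ger0_norm // distrC Hy2.
  have := ler_normD (T H r yy s - T H r (Y n) s) (T H r (Y n) s - y s).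
  have -> : T H r yy s - T H r (Y n) s + (T H r (Y n) s - y s) = T H r yy s - y s by ring.
  have -> : 3 * C * expR (k * s) * 2^-1 ^+ n = 3 * E n s by rewrite /E; set w := 2^-1 ^+ n; ring.
  have := E0 n s; lra.
have EA := lim_eq true y1 F p gF Hy1 (fun=> erefl).
have EB := lim_eq false y2 G q gG Hy2 (fun=> erefl).
exists (T F p yy), (T G q yy); split => // s s0; rewrite (EA s s0) (EB s s0).
by have := Ad s s0; have := Bd s s0; rewrite /yy /= ger0_norm.
Qed.

End Picard.

(** * Closure properties and truncation of polynomial fields *)

Section LipschitzClosure.
Context {R : realType}.
Implicit Types (F G : R -> R -> R).

Lemma bounded_lipschitz_cst (c : R) : bounded_lipschitz (fun _ _ : R => c).
Proof. by exists `|c|, 0; split=> *; rewrite ?subrr ?normr0 ?mul0r. Qed.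

Lemma bounded_lipschitzN F : bounded_lipschitz F -> bounded_lipschitz (fun a b => - F a b).
Proof.
move=> [M [L [FM FL]]]; exists M, L; split=> [a b|a b a' b']; first by rewrite normrN.
by rewrite -opprD normrN.
Qed.

Lemma bounded_lipschitzD F G : bounded_lipschitz F -> bounded_lipschitz G ->
  bounded_lipschitz (fun a b => F a b + G a b).
Proof.
move=> [M [L [FM FL]]] [M' [L' [GM GL]]]; exists (M + M'), (L + L'); split=> [a b|a b a' b'].
  by apply: le_trans (ler_normD _ _) _; rewrite lerD.
rewrite opprD addrACA mulrDl; apply: le_trans (ler_normD _ _) _.
by rewrite lerD.
Qed.

Lemma bounded_lipschitzB F G : bounded_lipschitz F -> bounded_lipschitz G ->
  bounded_lipschitz (fun a b => F a b - G a b).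
Proof. by move=> lF lG; exact: bounded_lipschitzD lF (bounded_lipschitzN lG). Qed.

Lemma bounded_lipschitzM F G : bounded_lipschitz F -> bounded_lipschitz G ->
  bounded_lipschitz (fun a b => F a b * G a b).
Proof.
move=> [M [L [FM FL]]] [M' [L' [GM GL]]]; exists (M * M'), (M * L' + L * M'); split=> [a b|a b a' b'].
  by rewrite normrM ler_pM.
have -> : F a b * G a b - F a' b' * G a' b' =
  F a b * (G a b - G a' b') + (F a b - F a' b') * G a' b' by ring.
apply: le_trans (ler_normD _ _) _; rewrite !normrM.
apply: (@le_trans _ _ (M * (L' * (`|a - a'| + `|b - b'|)) + L * (`|a - a'| + `|b - b'|) * M')).
  by rewrite lerD // ler_pM.
lra.
Qed.

(** Clipping both coordinates turns a polynomial field into a bounded Lipschitz one that is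
    unchanged on a square. *)
Definition clip (r x : R) := Num.max (- r) (Num.min r x).

Lemma clip_id (r x : R) : - r <= x <= r -> clip r x = x.
Proof. by move=> /andP[h1 h2]; rewrite /clip min_r // max_r. Qed.

Lemma clip_le (r x : R) : 0 <= r -> - r <= clip r x <= r.
Proof.
move=> r0; rewrite /clip le_max lexx /= ge_max ge_min lexx andbT /=.
lra.
Qed.

Lemma clip_lip (r x y : R) : 0 <= r -> `|clip r x - clip r y| <= `|x - y|.
Proof.
move=> r0; have := normr_ge0 (x - y); have := ler_norm (x - y); have := ler_norm (y - x).
rewrite (distrC y x); set n := `|x - y| => h1 h2 h3; rewrite /clip.
set u := Num.min r x; set v := Num.min r y.
have [u1 u2] : u - v <= n /\ v - u <= n.
  by rewrite /u /v; case: (leP r x) => ?; case: (leP r y) => ?; split; lra.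
by rewrite ler_norml; case: (leP (- r) u) => ?; case: (leP (- r) v) => ?; apply/andP; split; lra.
Qed.

Lemma bounded_lipschitz_clip1 r : 0 <= r -> bounded_lipschitz (fun a _ : R => clip r a).
Proof.
move=> r0; exists r, 1; split=> [a b|a b a' b']; first by rewrite ler_norml clip_le.
by rewrite mul1r (le_trans (clip_lip _ _ r0)) // lerDl.
Qed.

Lemma bounded_lipschitz_clip2 r : 0 <= r -> bounded_lipschitz (fun _ b : R => clip r b).
Proof.
move=> r0; exists r, 1; split=> [a b|a b a' b']; first by rewrite ler_norml clip_le.
by rewrite mul1r (le_trans (clip_lip _ _ r0)) // lerDr.
Qed.

End LipschitzClosure.

Ltac lipschitz := first
  [ assumption | notypeclasses refine (bounded_lipschitz_clip1 _); assumption
  | notypeclasses refine (bounded_lipschitz_clip2 _); assumption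
  | notypeclasses refine (bounded_lipschitz_cst _)
  | notypeclasses refine (bounded_lipschitzM _ _); lipschitz
  | notypeclasses refine (bounded_lipschitzB _ _); lipschitz
  | notypeclasses refine (bounded_lipschitzN _); lipschitz
  | notypeclasses refine (bounded_lipschitzD _ _); lipschitz ].

(** * The descent field and its trajectories *)

Section Field.
Context {R : realType} (eta zeta : R).
Implicit Types (a b s : R) (x y : R -> R).

(** Real part of N(a + i b); [numIm] is the imaginary part and [nsq] the squared modulus. *)
Definition numRe a b := eta - (eta + 1) * a + zeta * b.
Definition numIm a b := zeta - (eta + 1) * b - zeta * a.
Definition nsq a b := numRe a b * numRe a b + numIm a b * numIm a b.
(* Components of - conj (alpha - (alpha + 1) x) x (1 - x) at x = a + i b. *)
Definition fieldRe a b := - (numRe a b * (a - a * a + b * b) + numIm a b * (b - 2 * a * b)).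
Definition fieldIm a b := numIm a b * (a - a * a + b * b) - numRe a b * (b - 2 * a * b).

Definition trajectory x y := forall s, 0 <= s ->
  is_derive s 1 x (fieldRe (x s) (y s)) /\ is_derive s 1 y (fieldIm (x s) (y s)).

(* - 2 |x|^2 radial is the derivative of |x|^2 along the trajectories. *)
Definition radial a b := eta - (2 * eta + 1) * a + (eta + 1) * (a * a + b * b).

Lemma lipschitz_fieldRe r : 0 <= r -> bounded_lipschitz (fun a b => fieldRe (clip r a) (clip r b)).
Proof. by move=> r0; rewrite /fieldRe /numRe /numIm; lipschitz. Qed.

Lemma lipschitz_fieldIm r : 0 <= r -> bounded_lipschitz (fun a b => fieldIm (clip r a) (clip r b)).
Proof. by move=> r0; rewrite /fieldIm /numRe /numIm; lipschitz. Qed.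

Lemma ball_box (r a b : R) : 0 <= r -> a * a + b * b <= r * r -> - r <= a <= r /\ - r <= b <= r.
Proof. by move=> r0 ab; split; apply/andP; split; nra. Qed.

Lemma radial_derivative a b :
  fieldRe a b * a + a * fieldRe a b + (fieldIm a b * b + b * fieldIm a b) =
  - 2 * (a * a + b * b) * radial a b.
Proof. rewrite /fieldRe /fieldIm /radial /numRe /numIm; ring. Qed.

(** The difference of the two sides is (eta + 1/2) |1 - x|^2. Hence |x| decreases outside the unit
    disc, whatever zeta is. *)
Lemma radial_ge a b : 0 < eta -> (a * a + b * b - 1) / 2 <= radial a b.
Proof. move=> e0; rewrite /radial.
have : 0 <= (eta + 1 / 2) * ((1 - a) * (1 - a) + b * b).
  by apply: mulr_ge0; [lra | rewrite addr_ge0 // -expr2 sqr_ge0].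
lra. Qed.

(** The field is clipped at r + 1 and solved globally. In the ring between the radii r and r + 1
    clipping is inactive and the field points inwards, so the solution stays in the ball of radius r
    and solves the true equation. *)
Lemma trajectory_exists (r p q : R) : 0 < eta -> 1 <= r -> p * p + q * q <= r * r ->
  exists x y, [/\ x 0 = p, y 0 = q, continuous x /\ continuous y, trajectory x y &
    forall s, 0 <= s -> x s * x s + y s * y s <= r * r].
Proof.
move=> e0 r1 pq.
have r0 : 0 <= r + 1 by lra.
have [x [y [x0 y0 xc yc xyd]]] := picard p q (lipschitz_fieldRe r0) (lipschitz_fieldIm r0).
have inball s : 0 <= s -> x s * x s + y s * y s <= r * r.
  pose dh s := fieldRe (clip (r+1) (x s)) (clip (r+1) (y s)) * x s + x s * fieldRe (clip (r+1) (x s)) (clip (r+1) (y s)) + (fieldIm (clip (r+1) (x s)) (clip (r+1) (y s)) * y s + y s * fieldIm (clip (r+1) (x s)) (clip (r+1) (y s))).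
  apply: (@barrier_down _ (fun s => x s * x s + y s * y s) dh _ ((r + 1) * (r + 1))); first nra.
  - by move=> u /xyd[dx dy]; rewrite /dh; der.
  - by rewrite x0 y0.
  move=> u u0 /andP[h1 /ltW h2]; rewrite /dh.
  have [bx bY] := ball_box r0 h2; rewrite !clip_id // radial_derivative.
  have T1 := radial_ge (x u) (y u) e0.
  have h3 : 1 <= x u * x u + y u * y u by nra.
  have T0 : 0 <= radial (x u) (y u) by lra.
  have : 0 <= (x u * x u + y u * y u) * radial (x u) (y u) by rewrite mulr_ge0 //; lra.
  lra.
exists x, y; split => // s s0; have [dx dy] := xyd s s0; have [bx bY] := @ball_box r (x s) (y s) ltac:(lra) (inball s s0).
move: bx bY => /andP[bx1 bx2] /andP[bY1 bY2].
have cx : clip (r + 1) (x s) = x s by rewrite clip_id //; apply/andP; split; lra.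
have cy : clip (r + 1) (y s) = y s by rewrite clip_id //; apply/andP; split; lra.
by rewrite cx cy in dx dy.
Qed.

Lemma trajectory_gronwall (r : R) : 0 <= r -> exists L : R, forall x y x' y',
  trajectory x y -> trajectory x' y' ->
  (forall s, 0 <= s -> x s * x s + y s * y s <= r * r) ->
  (forall s, 0 <= s -> x' s * x' s + y' s * y' s <= r * r) ->
  let D s := (x s - x' s) * (x s - x' s) + (y s - y' s) * (y s - y' s) in
  forall s, 0 <= s -> D 0 * expR (- L * s) <= D s /\ D s <= D 0 * expR (L * s).
Proof.
move=> r0.
have [M1 [L1 [_ H1]]] := lipschitz_fieldRe r0; have [M2 [L2 [_ H2]]] := lipschitz_fieldIm r0.
exists (4 * (`|L1| + `|L2|)) => x y x' y' T T' B B' D.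
pose dD s := (fieldRe (x s) (y s) - fieldRe (x' s) (y' s)) * (x s - x' s) + (x s - x' s) * (fieldRe (x s) (y s) - fieldRe (x' s) (y' s)) + ((fieldIm (x s) (y s) - fieldIm (x' s) (y' s)) * (y s - y' s) + (y s - y' s) * (fieldIm (x s) (y s) - fieldIm (x' s) (y' s))).
have Dd s : 0 <= s -> is_derive s 1 D (dD s).
  by move=> s0; have [d1 d2] := T s s0; have [d3 d4] := T' s s0; rewrite /D /dD; der.
have bound s : 0 <= s -> `|dD s| <= 4 * (`|L1| + `|L2|) * D s.
  move=> s0; have [b1 b2] := ball_box r0 (B s s0); have [b3 b4] := ball_box r0 (B' s s0).
  have := H1 (x s) (y s) (x' s) (y' s); have := H2 (x s) (y s) (x' s) (y' s).
  rewrite !clip_id // /dD /D.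
  set F := fieldRe _ _ - _; set G := fieldIm _ _ - _; set A := x s - x' s; set C := y s - y' s => G1 F1.
  have -> : F * A + A * F + (G * C + C * G) = 2 * (F * A + G * C) by ring.
  rewrite normrM ger0_norm //.
  apply: (@le_trans _ _ (2 * (`|F| * `|A| + `|G| * `|C|))).
    by rewrite ler_wpM2l // -!normrM ler_normD.
  have AA : A * A = `|A| * `|A| by rewrite -normrM ger0_norm // -expr2 sqr_ge0.
  have CC : C * C = `|C| * `|C| by rewrite -normrM ger0_norm // -expr2 sqr_ge0.
  rewrite AA CC; have F2 : `|F| <= `|L1| * (`|A| + `|C|).
    by apply: le_trans F1 _; rewrite ler_wpM2r ?addr_ge0 // ler_norm.
  have G2 : `|G| <= `|L2| * (`|A| + `|C|).
    by apply: le_trans G1 _; rewrite ler_wpM2r ?addr_ge0 // ler_norm.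
  move: (normr_ge0 A) (normr_ge0 C) (normr_ge0 L1) (normr_ge0 L2) F2 G2.
  move: `|A| `|C| `|L1| `|L2| `|F| `|G| => A1 C1 l1 l2 F3 G3 A0 C0 l10 l20 F2 G2.
  have E1 : F3 * A1 <= l1 * (A1 + C1) * A1 by rewrite ler_wpM2r.
  have E2 : G3 * C1 <= l2 * (A1 + C1) * C1 by rewrite ler_wpM2r.
  have E3 : 0 <= l1 * ((A1 - C1) * (A1 - C1) + A1 * A1 + 3 * (C1 * C1)) by apply: mulr_ge0 => //; nra.
  have E4 : 0 <= l2 * ((A1 - C1) * (A1 - C1) + 3 * (A1 * A1) + C1 * C1) by apply: mulr_ge0 => //; nra.
  lra.
move=> s s0; split.
  have low u : 0 <= u -> - (4 * (`|L1| + `|L2|)) * D u - - (4 * (`|L1| + `|L2|)) * 0 <= dD u.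
    by move=> u0; have := bound u u0; rewrite ler_norml mulr0 subr0 mulNr => /andP[].
  by have := gronwall_lower Dd low s0; rewrite subr0 addr0.
apply: (gronwall_upper Dd) => // u u0.
by have := bound u u0; rewrite ler_norml => /andP[].
Qed.

Lemma trajectory_cst (p q : R) : fieldRe p q = 0 -> fieldIm p q = 0 -> trajectory (fun=> p) (fun=> q).
Proof. by move=> h1 h2 s _; rewrite h1 h2; split; exact: der_cst. Qed.

Lemma trajectory_avoid (r p q : R) x y : 0 <= r -> trajectory x y ->
  (forall s, 0 <= s -> x s * x s + y s * y s <= r * r) ->
  fieldRe p q = 0 -> fieldIm p q = 0 -> p * p + q * q <= r * r ->
  0 < (x 0 - p) * (x 0 - p) + (y 0 - q) * (y 0 - q) ->
  forall s, 0 <= s -> 0 < (x s - p) * (x s - p) + (y s - q) * (y s - q).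
Proof.
move=> r0 T B h1 h2 pq D0 s s0; have [L HL] := trajectory_gronwall r0.
have [H _] := HL _ _ _ _ T (trajectory_cst h1 h2) B (fun _ _ => pq) s s0.
by apply: lt_le_trans H; rewrite mulr_gt0 // expR_gt0.
Qed.

End Field.

(** * Bounded argument of 1 - x and convergence to the saddle *)

Section Limit.
Context {R : realType}.
Implicit Types (eta zeta a b s : R) (x y : R -> R).

Lemma unit_angle (c d : R) : c * c + d * d = 1 ->
  exists t : R, [/\ cos t = c, sin t = d & - pi <= t <= pi].
Proof.
move=> cd1; have dd : 0 <= d * d by rewrite -expr2 sqr_ge0.
have c1 : -1 <= c <= 1 by apply/andP; split; nra.
have sE : sin (acos c) = `|d|.
  rewrite sin_acos // -sqrtr_sqr; congr (Num.sqrt _); rewrite !expr2; lra.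
have [a0 api] := (acos_ge0 c1, acos_lepi c1).
have cE : cos (acos c) = c by rewrite acosK // in_itv.
have pi0 := pi_ge0 R.
have [d0|d0] := leP 0 d.
  exists (acos c); split => //; first by rewrite sE ger0_norm.
  by apply/andP; split; lra.
exists (- acos c); split; rewrite ?cosN ?sinN ?sE ?ltr0_norm ?opprK //.
by apply/andP; split; lra.
Qed.

Lemma cos3pi : cos (3 * pi) = -1 :> R.
Proof.
have -> : 3 * pi = pi + pi *+ 2 :> R by rewrite mulr2n; ring.
by rewrite cosD2pi cospi.
Qed.

Lemma sin3pi : sin (3 * pi) = 0 :> R.
Proof.
have -> : 3 * pi = pi + pi *+ 2 :> R by rewrite mulr2n; ring.
by rewrite sinD2pi sinpi.
Qed.

(* Real and imaginary part of conj N x, the logarithmic derivative of 1 - x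
   along the trajectories. *)
Definition logRe eta zeta a b := numRe eta zeta a b * a + numIm eta zeta a b * b.
Definition logIm eta zeta a b := numRe eta zeta a b * b - numIm eta zeta a b * a.

(* The argument theta of 1 - x can only cross an odd multiple of pi, where
   1 - x < 0, in the direction given by the sign of zeta. *)
Lemma argument_bounded eta zeta (r : R) x y : 0 < eta -> zeta != 0 -> 0 <= r ->
  trajectory eta zeta x y -> continuous x -> continuous y ->
  (forall s, 0 <= s -> x s * x s + y s * y s <= r * r) ->
  (forall s, 0 <= s -> 0 < (1 - x s) * (1 - x s) + y s * y s) ->
  exists theta : R -> R, (forall s, 0 <= s -> is_derive s 1 theta (logIm eta zeta (x s) (y s))) /\
    forall s, 0 <= s -> - (3 * pi * `|zeta|) <= zeta * theta s.
Proof.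
move=> e0 z0 r0 T xc yc B P.
pose g s := (1 - x s) * (1 - x s) + y s * y s.
have lq : bounded_lipschitz (fun a b => logIm eta zeta (clip r a) (clip r b)).
  by rewrite /logIm /numRe /numIm; lipschitz.
have [Q [Q0 _ Qd0]] := primitive_exists (bounded_lipschitz_continuous lq xc yc).
have Qd s : 0 <= s -> is_derive s 1 Q (logIm eta zeta (x s) (y s)).
  move=> s0; have := Qd0 s s0; have [b1 b2] := ball_box r0 (B s s0).
  by rewrite !clip_id.
have g0 : 0 < g 0 := P 0 (lexx _).
have sg0 : 0 < Num.sqrt (g 0) by rewrite sqrtr_gt0.
have sgg : Num.sqrt (g 0) * Num.sqrt (g 0) = g 0 by rewrite -expr2 sqr_sqrtr // ltW.
have [|t0 [ct0 st0 /andP[t1 t2]]] := @unit_angle ((1 - x 0) / Num.sqrt (g 0)) (- y 0 / Num.sqrt (g 0)).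
  have -> : (1 - x 0) / Num.sqrt (g 0) * ((1 - x 0) / Num.sqrt (g 0)) + - y 0 / Num.sqrt (g 0) * (- y 0 / Num.sqrt (g 0)) = g 0 / (Num.sqrt (g 0) * Num.sqrt (g 0)).
    by rewrite /g; field; rewrite lt0r_neq0.
  by rewrite sgg divff // lt0r_neq0.
pose theta s := t0 + Q s.
have thd s : 0 <= s -> is_derive s 1 theta (logIm eta zeta (x s) (y s)).
  by move=> s0; have Qs := Qd s s0; rewrite /theta -[logIm _ _ _ _]add0r; der.
pose E s := expR (- (1 / 2) * ln (g s)).
have gd s : 0 <= s -> is_derive s 1 g (2 * logRe eta zeta (x s) (y s) * g s).
  move=> s0; have [dx dy] := T s s0; rewrite /g; der_eq.
  by rewrite /logRe /fieldRe /fieldIm; ring.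
have Ed s : 0 <= s -> is_derive s 1 E (- logRe eta zeta (x s) (y s) * E s).
  move=> s0; have gs0 : 0 < g s := P s s0.
  have lg := der_ln gs0 (gd s s0).
  have := der_exp (derM (der_cst (- (1 / 2)) s) lg) => H.
  apply: (is_derive_eq H); rewrite /E mulfK ?lt0r_neq0 // mul0r add0r mulrC; congr (_ * _).
  by field.
(* E is 1 / |1 - x| and C + i D is (1 - x) e^(- i theta) / |1 - x|. It is constant with positive
   real value at 0, so theta is a continuous argument of 1 - x. *)
pose C s := ((1 - x s) * cos (theta s) - y s * sin (theta s)) * E s.
pose D s := (- y s * cos (theta s) - (1 - x s) * sin (theta s)) * E s.
have CDd s : 0 <= s -> is_derive s 1 C 0 /\ is_derive s 1 D 0.
  move=> s0; have [dx dy] := T s s0; have Es := Ed s s0; have ts := thd s s0.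
  have cs := der_cos ts; have ss := der_sin ts.
  by split; rewrite /C /D; der_eq; rewrite /logRe /logIm /fieldRe /fieldIm; ring.
have Cc s : 0 <= s -> C s = C 0.
  by move=> s0; apply/esym/(const_der s0) => u /andP[u0 _]; have [] := CDd u u0.
have Dc s : 0 <= s -> D s = D 0.
  by move=> s0; apply/esym/(const_der s0) => u /andP[u0 _]; have [] := CDd u u0.
have th0 : theta 0 = t0 by rewrite /theta Q0 addr0.
have D00 : D 0 = 0.
  by rewrite /D th0 ct0 st0; field; rewrite lt0r_neq0.
have C00 : 0 < C 0.
  rewrite /C th0 ct0 st0 mulr_gt0 ?expR_gt0 //.
  have -> : (1 - x 0) * ((1 - x 0) / Num.sqrt (g 0)) - y 0 * (- y 0 / Num.sqrt (g 0)) = g 0 / Num.sqrt (g 0).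
    by rewrite /g; field; rewrite lt0r_neq0.
  by rewrite divr_gt0.
exists theta; split => // s s0.
apply: (@barrier_cross _ (fun s => zeta * theta s) (fun s => zeta * logIm eta zeta (x s) (y s))) => //.
- by move=> u u0; have tu := thd u u0; der_eq; rewrite mul0r add0r.
- rewrite th0; have pi0 := pi_ge0 R.
  apply: (@le_trans _ _ (- (`|zeta| * `|t0|))).
    rewrite lerN2 [leRHS]mulrC ler_wpM2l // ler_norml; apply/andP; split; lra.
  by rewrite -normrM lerNl -normrN ler_norm.
move=> u u0 Hu.
have [cu su] : cos (theta u) = -1 /\ sin (theta u) = 0.
  have [zp|zn] := ltrP 0 zeta.
    have -> : theta u = - (3 * pi).
      apply: (mulfI (lt0r_neq0 zp)); rewrite Hu gtr0_norm //; ring.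
    by rewrite cosN sinN cos3pi sin3pi oppr0.
  have zn' : zeta < 0 by rewrite lt_neqAle z0.
  have -> : theta u = 3 * pi.
    apply: (mulfI z0); rewrite Hu ltr0_norm //; ring.
  by rewrite cos3pi sin3pi.
have := Dc u u0; have := Cc u u0; rewrite D00 {1}/C /D cu su !mulr0 !subr0 => HC HD.
have Eu : 0 < E u by rewrite expR_gt0.
have yu : y u = 0.
  by move/eqP: HD; rewrite mulf_eq0 (gt_eqF Eu) orbF mulrN1 opprK => /eqP.
have xu : 1 < x u.
  move: C00; rewrite -HC pmulr_lgt0 // mulrN1; lra.
have -> : zeta * logIm eta zeta (x u) (y u) = zeta * zeta * (x u * (x u - 1)).
  by rewrite /logIm /numRe /numIm yu; ring.
have zz : 0 < zeta * zeta by rewrite -expr2 exprn_even_gt0.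
have xx : 0 < x u * (x u - 1) by rewrite mulr_gt0 //; lra.
by rewrite mulr_gt0.
Qed.

(* V = eta ln|x| + ln|1-x| + (zeta/eta) (zeta ln|x| + theta) is Re phi with arg x
   eliminated by means of the constant Im phi; V' = - |N|^2. *)
Lemma trajectory_to_saddle eta zeta (r d : R) x y : 0 < eta -> zeta != 0 -> 0 <= r -> 0 < d ->
  trajectory eta zeta x y -> continuous x -> continuous y ->
  (forall s, 0 <= s -> x s * x s + y s * y s <= r * r) ->
  (forall s, 0 <= s -> d <= x s * x s + y s * y s) ->
  (forall s, 0 <= s -> d <= (1 - x s) * (1 - x s) + y s * y s) ->
  forall e : R, 0 < e -> exists2 T : R, 0 <= T & forall s, T <= s -> nsq eta zeta (x s) (y s) < e.
Proof.
move=> e0 z0 r0 d0 T xc yc B P0 P1.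
have [|th [thd thB]] := argument_bounded e0 z0 r0 T xc yc B.
  by move=> s /P1; exact: lt_le_trans.
pose h s := x s * x s + y s * y s; pose g s := (1 - x s) * (1 - x s) + y s * y s.
have h0 s : 0 <= s -> 0 < h s by move=> /P0; exact: lt_le_trans.
have g0 s : 0 <= s -> 0 < g s by move=> /P1; exact: lt_le_trans.
have gd s : 0 <= s -> is_derive s 1 g (2 * logRe eta zeta (x s) (y s) * g s).
  move=> s0; have [dx dy] := T s s0; rewrite /g; der_eq.
  by rewrite /logRe /fieldRe /fieldIm; ring.
have hd s : 0 <= s -> is_derive s 1 h (- 2 * h s * radial eta (x s) (y s)).
  move=> s0; have [dx dy] := T s s0; rewrite /h; der_eq.
  exact: radial_derivative.
pose V s := eta / 2 * ln (h s) + 1 / 2 * ln (g s) + zeta / eta * (zeta / 2 * ln (h s) + th s).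
have Vd s : 0 <= s -> is_derive s 1 V (- nsq eta zeta (x s) (y s)).
  move=> s0; have lh := der_ln (h0 s s0) (hd s s0); have lg := der_ln (g0 s s0) (gd s s0).
  have ts := thd s s0; rewrite /V; der_eq.
  have -> : -2 * h s * radial eta (x s) (y s) / h s = -2 * radial eta (x s) (y s).
    by field; rewrite lt0r_neq0 // h0.
  rewrite mulfK ?lt0r_neq0 ?g0 //.
  by rewrite /nsq /radial /logRe /logIm /numRe /numIm; field; rewrite lt0r_neq0.
(* The expression is the derivative of [nsq] along the field; its bound on the ball supplies the
   one-sided Lipschitz condition of [barbalat]. *)
have lK : bounded_lipschitz (fun a b => 2 * (numRe eta zeta (clip r a) (clip r b) * (- (eta + 1) * fieldRe eta zeta (clip r a) (clip r b) + zeta * fieldIm eta zeta (clip r a) (clip r b)) + numIm eta zeta (clip r a) (clip r b) * (- (eta + 1) * fieldIm eta zeta (clip r a) (clip r b) - zeta * fieldRe eta zeta (clip r a) (clip r b)))).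
  by rewrite /fieldRe /fieldIm /numRe /numIm; lipschitz.
have [M [L [KM _]]] := lK.
pose K a b := 2 * (numRe eta zeta a b * (- (eta + 1) * fieldRe eta zeta a b + zeta * fieldIm eta zeta a b) + numIm eta zeta a b * (- (eta + 1) * fieldIm eta zeta a b - zeta * fieldRe eta zeta a b)).
have Kb s : 0 <= s -> `|K (x s) (y s)| <= M.
  move=> s0; have [b1 b2] := ball_box r0 (B s s0).
  by have := KM (x s) (y s); rewrite !clip_id.
have M0 : 0 <= M by apply: le_trans (Kb 0 (lexx _)).
(* Lower bound of V: both logarithms are at least ln d, and zeta theta is at least - 3 pi |zeta| by
   [argument_bounded]. *)
pose Bd := eta / 2 * ln d + 1 / 2 * ln d + (zeta * zeta / 2 * ln d - 3 * pi * `|zeta|) / eta.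
apply: (@barbalat _ V _ Bd (M + 1)) => //; first lra.
- move=> s s0; have lnh : ln d <= ln (h s) by rewrite ler_ln ?posrE ?h0 // P0.
  have lng : ln d <= ln (g s) by rewrite ler_ln ?posrE ?g0 // P1.
  have zz : 0 <= zeta * zeta by rewrite -expr2 sqr_ge0.
  have -> : V s = eta / 2 * ln (h s) + 1 / 2 * ln (g s) + (zeta * zeta / 2 * ln (h s) + zeta * th s) / eta.
    by rewrite /V; field; rewrite lt0r_neq0.
  have H1 : eta / 2 * ln d <= eta / 2 * ln (h s) by rewrite ler_wpM2l // divr_ge0 // ltW.
  have H2 : zeta * zeta / 2 * ln d <= zeta * zeta / 2 * ln (h s) by rewrite ler_wpM2l // divr_ge0.
  have H3 : (zeta * zeta / 2 * ln d - 3 * pi * `|zeta|) / eta <= (zeta * zeta / 2 * ln (h s) + zeta * th s) / eta.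
    by rewrite ler_wpM2r ?invr_ge0 ?(ltW e0) // lerD // thB.
  by rewrite /Bd; lra.
- by move=> s _; rewrite /nsq addr_ge0 // -expr2 sqr_ge0.
move=> s t /andP[s0 st].
pose W u := nsq eta zeta (x u) (y u) + (M + 1) * u.
have : W s <= W t.
  apply: (@nondecr _ W (fun u => K (x u) (y u) + (M + 1)) s t st) => u /andP[u0 _].
    have [dx dy] := T u (le_trans s0 u0); rewrite /W /nsq /numRe /numIm; der_eq.
    by rewrite /K /numRe /numIm; ring.
  have := Kb u (le_trans s0 u0); rewrite ler_norml => /andP[]; lra.
by rewrite /W; lra.
Qed.

End Limit.

(** * Ascent curves in the variable x and the first integral Im phi *)

Section Ascent.
Context {R : realType}.
Implicit Types (eta zeta a b c d e s t u p q r : R) (x y X Y : R -> R).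

Lemma der_atan_div (n w : R -> R) s a b : w s != 0 -> is_derive s 1 n a -> is_derive s 1 w b ->
  is_derive s 1 (fun u => atan (n u / w u)) ((a * w s - n s * b) / (n s * n s + w s * w s)).
Proof.
move=> w0 dn dw; have := der_atan (derM dn (derV w0 dw)) => H.
apply: (is_derive_eq H).
have P : 0 < n s * n s + w s * w s.
  by rewrite ltr_wpDl -?expr2 ?sqr_ge0 // exprn_even_gt0.
have -> : 1 + (n s / w s) ^+ 2 = (n s * n s + w s * w s) / (w s * w s) by field.
by field; rewrite (lt0r_neq0 P) w0.
Qed.

Lemma continuous_eps (f : R -> R) s : {for s, continuous f} ->
  forall e, 0 < e -> exists2 d, 0 < d & forall t, `|s - t| < d -> `|f s - f t| < e.
Proof.
move=> /cvgrPdist_lt fc e e0; have /nbhs_ballP[d /= d0 D] := fc e e0.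
by exists d => // t st; apply: D.
Qed.

Lemma continuous_at_cvg (f : R -> R) (T : Type) (F : set_system T) {FF : Filter F} (g : T -> R) u :
  {for u, continuous f} -> g t @[t --> F] --> u -> f (g t) @[t --> F] --> f u.
Proof.
move=> fc gu; apply/cvgrPdist_lt => e e0; have [d d0 D] := continuous_eps fc e0.
by move/cvgrPdist_lt: gu => /(_ d d0); apply: filterS => t; exact: D.
Qed.

Lemma bounded_lipschitz_eps (F : R -> R -> R) p q e : 0 < e -> bounded_lipschitz F ->
  exists2 d, 0 < d & forall a b, `|a - p| < d -> `|b - q| < d -> `|F a b - F p q| < e.
Proof.
move=> e0 [M [L [_ FL]]]; have L1 : 0 < `|L| + 1 by rewrite ltr_wpDl.
exists (e / (2 * (`|L| + 1))) => [|a b ha hb]; first by rewrite divr_gt0 // mulr_gt0.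
set d := e / _ in ha hb.
apply: le_lt_trans (FL _ _ _ _) _; have := ler_norm L.
have -> : e = (`|L| + 1) * (2 * d) by rewrite /d; field; rewrite lt0r_neq0.
move: (normr_ge0 L) (normr_ge0 (a - p)) (normr_ge0 (b - q)) ha hb.
move: `|a - p| `|b - q| `|L| => A B l l0 A0 B0 hA hB Ll.
apply: (@le_lt_trans _ _ (l * (A + B))); first by rewrite ler_wpM2r // addr_ge0.
apply: (@le_lt_trans _ _ ((l + 1) * (A + B))); first by rewrite ler_wpM2r ?addr_ge0 // lerDl.
by rewrite ltr_pM2l; lra.
Qed.

Lemma polynomial_positive_near (F : R -> R -> R) p q :
  (forall r, 0 <= r -> bounded_lipschitz (fun a b => F (clip r a) (clip r b))) -> 0 < F p q ->
  exists2 d, 0 < d & forall a b, `|a - p| < d -> `|b - q| < d -> 0 < F a b.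
Proof.
move=> lF F0; pose r := `|p| + `|q| + 1.
have r0 : 0 <= r by rewrite !addr_ge0.
have [d d0 D] := bounded_lipschitz_eps p q F0 (lF r r0).
exists (Num.min d 1) => [|a b]; first by rewrite lt_min d0 ltr01.
rewrite !lt_min => /andP[a1 a2] /andP[b1 b2].
have := D a b a1 b1.
move: a2 b2; rewrite !ltr_norml => /andP[a2 a3] /andP[b2 b3].
have := ler_norm p; have := ler_norm (- p); have := ler_norm q; have := ler_norm (- q).
have := normr_ge0 p; have := normr_ge0 q.
rewrite !normrN => q0 p0 q1 q2 p1 p2.
have ca : clip r a = a by rewrite clip_id // /r; apply/andP; split; lra.
have cb : clip r b = b by rewrite clip_id // /r; apply/andP; split; lra.
have cp : clip r p = p by rewrite clip_id // /r; apply/andP; split; lra.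
have cq : clip r q = q by rewrite clip_id // /r; apply/andP; split; lra.
by rewrite ca cb cp cq => /andP[]; lra.
Qed.

Lemma der_glue (f g : R -> R) s v : is_derive s 1 f v -> is_derive s 1 g v -> f s = g s ->
  is_derive s 1 (fun u => if u <= s then f u else g u) v.
Proof.
move=> [df Ef] [dg Eg] fg.
have H : (fun h => h^-1 *: ((if h *: 1 + s <= s then f (h *: 1 + s) else g (h *: 1 + s)) - f s)) @ 0^' --> v.
  apply/cvgrPdist_lt => e e0.
  have : (fun h => h^-1 *: (f (h *: 1 + s) - f s)) @ 0^' --> v by rewrite -Ef.
  move=> /cvgrPdist_lt /(_ _ e0) Hf.
  have : (fun h => h^-1 *: (g (h *: 1 + s) - g s)) @ 0^' --> v by rewrite -Eg.
  move=> /cvgrPdist_lt /(_ _ e0) Hg.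
  near=> h; case: ifP => _; first by near: h.
  by rewrite fg; near: h.
have H' : (fun h => h^-1 *: ((fun u => if u <= s then f u else g u) (h *: 1 + s) - (fun u => if u <= s then f u else g u) s)) @ 0^' --> v.
  by rewrite /= lexx.
apply: DeriveDef; first by apply/cvg_ex; exists v.
exact: (cvg_lim _ H').
Unshelve. all: by end_near. Qed.

(** Counterpart of [steepest_ascent] for x = z t. The free speed c absorbs the positive factor
    between the gradient of Re phi and the reversed polynomial field. *)
Definition ascent eta zeta X Y :=
  [/\ {within `[0, 1], continuous X}, {within `[0, 1], continuous Y} &
   forall s, 0 < s < 1 -> [/\ 0 < nsq eta zeta (X s) (Y s), 0 < X s * X s + Y s * Y s,
     0 < (1 - X s) * (1 - X s) + Y s * Y s &
     exists2 c, 0 < c & is_derive s 1 X (- c * fieldRe eta zeta (X s) (Y s)) /\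
                        is_derive s 1 Y (- c * fieldIm eta zeta (X s) (Y s))]].

(** Real part of alpha / (alpha + 1), the zero of N; [saddleIm] is the imaginary part. *)
Definition saddleRe eta zeta := (eta * (eta + 1) + zeta * zeta) / ((eta + 1) * (eta + 1) + zeta * zeta).
Definition saddleIm eta zeta := zeta / ((eta + 1) * (eta + 1) + zeta * zeta).

Definition ascent_from_saddle eta zeta p q := exists X Y, [/\ ascent eta zeta X Y,
  X 0 = saddleRe eta zeta, Y 0 = saddleIm eta zeta &
  exists2 s, 0 <= s <= 1 & X s = p /\ Y s = q].

Lemma den_gt0 eta zeta : 0 < eta -> 0 < (eta + 1) * (eta + 1) + zeta * zeta.
Proof. by move=> e0; rewrite ltr_pwDl ?mulr_gt0 // -?expr2 ?sqr_ge0 ?addr_gt0 // addr_gt0. Qed.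

Lemma numRe_saddle eta zeta : 0 < eta -> numRe eta zeta (saddleRe eta zeta) (saddleIm eta zeta) = 0.
Proof. by move=> e0; rewrite /numRe /saddleRe /saddleIm; field; rewrite lt0r_neq0 ?den_gt0. Qed.

Lemma numIm_saddle eta zeta : 0 < eta -> numIm eta zeta (saddleRe eta zeta) (saddleIm eta zeta) = 0.
Proof. by move=> e0; rewrite /numIm /saddleRe /saddleIm; field; rewrite lt0r_neq0 ?den_gt0. Qed.

(** N is affine with slope - (alpha + 1), so |N| measures the distance to the saddle. *)
Lemma nsqE eta zeta a b : 0 < eta -> nsq eta zeta a b = ((eta + 1) * (eta + 1) + zeta * zeta) *
  ((a - saddleRe eta zeta) * (a - saddleRe eta zeta) + (b - saddleIm eta zeta) * (b - saddleIm eta zeta)).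
Proof.
by move=> e0; rewrite /nsq /numRe /numIm /saddleRe /saddleIm; field; rewrite lt0r_neq0 ?den_gt0.
Qed.

(* The first integral Im phi near (p, q), with the arguments measured from there. *)
Definition imPhi eta zeta p q a b :=
  zeta / 2 * ln (a * a + b * b) + eta * atan ((p * b - q * a) / (p * a + q * b)) +
  atan ((q * (1 - a) - (1 - p) * b) / ((1 - p) * (1 - a) + q * b)).
(** Real part of alpha / x - 1 / (1 - x), the derivative of phi in the variable x; [dphiIm] is the
    imaginary part. The gradient of Re phi is ([dphiRe], - [dphiIm]), that of Im phi is ([dphiIm],
    [dphiRe]). *)
Definition dphiRe eta zeta a b := (eta * a + zeta * b) / (a * a + b * b) -
  (1 - a) / ((1 - a) * (1 - a) + b * b).
Definition dphiIm eta zeta a b := (zeta * a - eta * b) / (a * a + b * b) -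
  b / ((1 - a) * (1 - a) + b * b).

Lemma imPhi_derive eta zeta p q X Y s a b : 0 < p * p + q * q -> 0 < (1 - p) * (1 - p) + q * q ->
  0 < p * X s + q * Y s -> 0 < (1 - p) * (1 - X s) + q * Y s ->
  0 < X s * X s + Y s * Y s -> 0 < (1 - X s) * (1 - X s) + Y s * Y s ->
  is_derive s 1 X a -> is_derive s 1 Y b ->
  is_derive s 1 (fun u => imPhi eta zeta p q (X u) (Y u))
    (dphiIm eta zeta (X s) (Y s) * a + dphiRe eta zeta (X s) (Y s) * b).
Proof.
move=> p0 p1 w1 w2 h0 g0 dX dY.
have hd : is_derive s 1 (fun u => X u * X u + Y u * Y u) (2 * (X s * a + Y s * b)).
  by der_eq; ring.
have n1 : is_derive s 1 (fun u => p * Y u - q * X u) (p * b - q * a) by der_eq; ring.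
have n2 : is_derive s 1 (fun u => q * (1 - X u) - (1 - p) * Y u) (- q * a - (1 - p) * b) by der_eq; ring.
have m1 : is_derive s 1 (fun u => p * X u + q * Y u) (p * a + q * b) by der_eq; ring.
have m2 : is_derive s 1 (fun u => (1 - p) * (1 - X u) + q * Y u) (- (1 - p) * a + q * b) by der_eq; ring.
have A1 := @der_atan_div _ (fun u => p * X u + q * Y u) s _ _ (lt0r_neq0 w1) n1 m1.
have A2 := @der_atan_div _ (fun u => (1 - p) * (1 - X u) + q * Y u) s _ _ (lt0r_neq0 w2) n2 m2.
have L := @der_ln _ (fun u => X u * X u + Y u * Y u) s _ h0 hd.
rewrite /imPhi; der_eq; rewrite /dphiRe /dphiIm.
have -> : (p * Y s - q * X s) * (p * Y s - q * X s) + (p * X s + q * Y s) * (p * X s + q * Y s) =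
  (p * p + q * q) * (X s * X s + Y s * Y s) by ring.
have -> : (q * (1 - X s) - (1 - p) * Y s) * (q * (1 - X s) - (1 - p) * Y s) +
   ((1 - p) * (1 - X s) + q * Y s) * ((1 - p) * (1 - X s) + q * Y s) =
  ((1 - p) * (1 - p) + q * q) * ((1 - X s) * (1 - X s) + Y s * Y s) by ring.
by field; rewrite !lt0r_neq0.
Qed.

(** An ascent curve is only continuous at its endpoints, so the value of Im phi there has to be
    reached as a limit. *)
Lemma imPhi_cvg eta zeta p q (T : Type) (F : set_system T) {FF : Filter F} (X Y : T -> R) a b :
  0 < p * a + q * b -> 0 < (1 - p) * (1 - a) + q * b -> 0 < a * a + b * b ->
  X t @[t --> F] --> a -> Y t @[t --> F] --> b ->
  imPhi eta zeta p q (X t) (Y t) @[t --> F] --> imPhi eta zeta p q a b.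
Proof.
move=> w1 w2 h0 Xa Yb.
have cM (f g : T -> R) u v : f t @[t --> F] --> u -> g t @[t --> F] --> v -> f t * g t @[t --> F] --> u * v by exact: cvgM.
have cD (f g : T -> R) u v : f t @[t --> F] --> u -> g t @[t --> F] --> v -> f t + g t @[t --> F] --> u + v by exact: cvgD.
have cB (f g : T -> R) u v : f t @[t --> F] --> u -> g t @[t --> F] --> v -> f t - g t @[t --> F] --> u - v by exact: cvgB.
have cC u : (fun=> u) t @[t --> F] --> u by exact: cvg_cst.
have cV (f : T -> R) u : u != 0 -> f t @[t --> F] --> u -> (f t)^-1 @[t --> F] --> u^-1 by exact: cvgV.
rewrite /imPhi; apply: (cD); first apply: (cD).
- apply: (cM); first exact: cC.
  apply: continuous_at_cvg; first exact: continuous_ln.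
  by apply: (cD); apply: (cM).
- apply: (cM); first exact: cC.
  apply: continuous_at_cvg; first exact: continuous_atan.
  apply: (cM); first by apply: (cB); apply: (cM) => //; exact: cC.
  by apply: (cV); [exact: lt0r_neq0 | apply: (cD); apply: (cM) => //; exact: cC].
apply: continuous_at_cvg; first exact: continuous_atan.
apply: (cM).
  by apply: (cB); apply: (cM) => //; try apply: (cB) => //; exact: cC.
by apply: (cV); [exact: lt0r_neq0 | apply: (cD); apply: (cM) => //; try apply: (cB) => //; exact: cC].
Qed.

(** The derivative of phi is N / (x (1 - x)) and the field is - conj N x (1 - x); their product is
    the real number - |N|^2. *)
Lemma dphi_field eta zeta a b : 0 < a * a + b * b -> 0 < (1 - a) * (1 - a) + b * b ->
  dphiIm eta zeta a b * fieldRe eta zeta a b + dphiRe eta zeta a b * fieldIm eta zeta a b = 0 /\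
  dphiRe eta zeta a b * fieldRe eta zeta a b - dphiIm eta zeta a b * fieldIm eta zeta a b = - nsq eta zeta a b.
Proof.
move=> h0 g0; rewrite /dphiRe /dphiIm /fieldRe /fieldIm /nsq /numRe /numIm.
by split; field; rewrite !lt0r_neq0.
Qed.

End Ascent.

(** * Ascent curves near the saddle, near 1 and near a regular point *)

Section AscentCurves.
Context {R : realType}.
Implicit Types (eta zeta a b c d e s t u v p q r : R) (x y X Y : R -> R).

Lemma der_if_neq (f : R -> R) c s v : s != 0 -> is_derive s 1 f v ->
  is_derive s 1 (fun u => if u == 0 then c else f u) v.
Proof.
move=> s0; apply: near_eq_is_derive; apply/nbhs_ballP.
exists `|s| => /=; first by rewrite normr_gt0.
move=> t; rewrite /ball /= => st; case: eqP => // t0.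
by move: st; rewrite t0 subr0 ltxx.
Qed.

(** The substitution s -> 1/s - 1 maps (0, 1] to [0, oo) and reverses the orientation. Convergence
    to the saddle becomes continuity at 0, and the speed 1/s^2 may blow up there because endpoints
    carry no derivative condition. *)
Lemma saddle_limit_ascent eta zeta x y : 0 < eta -> trajectory eta zeta x y ->
  (forall s, 0 <= s -> [/\ 0 < nsq eta zeta (x s) (y s), 0 < x s * x s + y s * y s &
     0 < (1 - x s) * (1 - x s) + y s * y s]) ->
  (forall e, 0 < e -> exists2 T, 0 <= T & forall s, T <= s -> nsq eta zeta (x s) (y s) < e) ->
  ascent_from_saddle eta zeta (x 0) (y 0).
Proof.
move=> e0 T P lim.
pose g (z : R -> R) (z0 : R) s := if s == 0 then z0 else z (s^-1 - 1).
have inv1 s : 0 < s <= 1 -> 0 <= s^-1 - 1.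
  by move=> /andP[s0 s1]; rewrite subr_ge0 invf_ge1.
have gd z z0 dz s : 0 < s <= 1 -> is_derive (s^-1 - 1) 1 z dz ->
    is_derive s 1 (g z z0) (- (1 / (s * s)) * dz).
  move=> /andP[s0 s1] zd; apply: der_if_neq; first exact: lt0r_neq0.
  have H : is_derive s 1 (fun u => u^-1 - 1) (- (1 / (s * s))).
    have V := derV (lt0r_neq0 s0) (der_id s).
    have W := derB V (der_cst 1 s); apply: (is_derive_eq W).
    by field; exact: lt0r_neq0.
  by rewrite mulrC; exact: der_comp H zd.
have near0 z z0 (k : R) : 0 < k -> (forall s, 0 <= s -> k * ((z s - z0) * (z s - z0)) <= nsq eta zeta (x s) (y s)) ->
    (forall s, 0 <= s -> exists dz, is_derive s 1 z dz) -> {within `[0, 1], continuous (g z z0)}.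
  move=> k0 zk zd; apply/within_eps => s /andP[s0 s1] e ep.
  have [s0'|s0'] := eqVneq s 0.
    have [U U0 HU] := lim (k * (e * e)) (mulr_gt0 k0 (mulr_gt0 ep ep)).
    exists (U + 1)^-1 => [|t /andP[t0 t1]]; first by rewrite invr_gt0; lra.
    rewrite s0' sub0r normrN /g eqxx ger0_norm // => tU.
    case: eqP => [_|/eqP tn0]; first by rewrite subrr normr0.
    have tp : 0 < t by rewrite lt0r tn0.
    have Ut : U <= t^-1 - 1.
      by rewrite lerBrDr -[_ + 1]invrK lef_pV2 ?posrE ?invr_gt0 //; [exact: ltW | lra].
    have it : 0 <= t^-1 - 1 by exact: le_trans Ut.
    have := le_lt_trans (zk _ it) (HU _ Ut); rewrite ltr_pM2l // => H.
    by rewrite distrC -(ltr_pXn2r (n := 2)) ?nnegrE ?(ltW ep) // !expr2 -normrM ger0_norm // -expr2 sqr_ge0.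
  have sp : 0 < s by rewrite lt0r s0'.
  have s01 : 0 < s <= 1 by rewrite sp.
  have [dz zs] := zd _ (inv1 s s01).
  have [d dp D] := continuous_eps (der_cont (gd z z0 dz s s01 zs)) ep.
  by exists d => // t _; exact: D.
have k0 := den_gt0 zeta e0.
exists (g x (saddleRe eta zeta)), (g y (saddleIm eta zeta)); split.
- split.
  + apply: (near0 _ _ _ k0) => [s s0|s s0]; last by have [] := T s s0; exists (fieldRe eta zeta (x s) (y s)).
    by rewrite nsqE // ler_pM2l // lerDl -expr2 sqr_ge0.
  + apply: (near0 _ _ _ k0) => [s s0|s s0]; last by have [] := T s s0; exists (fieldIm eta zeta (x s) (y s)).
    by rewrite nsqE // ler_pM2l // lerDr -expr2 sqr_ge0.
  move=> s /andP[s0 s1]; have s01 : 0 < s <= 1 by rewrite s0 ltW.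
  have i0 := inv1 s s01; have [n0 h0 g0] := P _ i0; have [dx dy] := T _ i0.
  have gE z z0 : g z z0 s = z (s^-1 - 1) by rewrite /g gt_eqF.
  rewrite !gE; split => //; exists (1 / (s * s)); first by rewrite divr_gt0 // mulr_gt0.
  by split; exact: gd.
- by rewrite /g eqxx.
- by rewrite /g eqxx.
exists 1; rewrite ?ler01 ?lexx // /g oner_eq0 invr1 subrr //.
Qed.

(** The speed of an ascent curve is known only through an existential at each point; ['D_1 f]
    provides the derivative as a function. *)
Lemma nondecr_pointwise (f : R -> R) a b : a <= b -> {within `[a, b], continuous f} ->
  (forall s, a < s < b -> exists2 v, is_derive s 1 f v & 0 <= v) -> f a <= f b.
Proof.
move=> ab fc fd; apply: (@nondecr_within _ f (fun u => 'D_1 f u) a b ab fc) => s /fd[v sv v0].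
  by have [dv _] := sv; exact: derivableP.
by have [_ ->] := sv.
Qed.

Lemma incr_pointwise (f : R -> R) a b : a < b -> {within `[a, b], continuous f} ->
  (forall s, a < s < b -> exists2 v, is_derive s 1 f v & 0 < v) -> f a < f b.
Proof.
move=> ab fc fd; apply: (@incr_within _ f (fun u => 'D_1 f u) a b ab fc) => s /fd[v sv v0].
  by have [dv _] := sv; exact: derivableP.
by have [_ ->] := sv.
Qed.

Lemma cst_pointwise (f : R -> R) a b : a <= b -> {within `[a, b], continuous f} ->
  (forall s, a < s < b -> is_derive s 1 f 0) -> f a = f b.
Proof.
move=> ab fc fd; apply/eqP; rewrite eq_le; apply/andP; split.
  by apply: (nondecr_pointwise ab fc) => s /fd ?; exists 0.
rewrite -lerN2; apply: (@nondecr_pointwise (fun u => - f u) a b ab) => [u|s /fd fs].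
  by apply: cvgN; exact: fc.
by exists (- 0); [exact: derN | rewrite oppr0].
Qed.

(** Expansion of Re (conj N x) at x = 1, where N = -1; the radius d is chosen so that the linear
    terms contribute at most 1/2. *)
Lemma disc_at_one eta zeta a b d : 0 < eta -> d * (2 * (eta + 2 + `|zeta|)) = 1 ->
  (1 - a) * (1 - a) + b * b < d * d -> logRe eta zeta a b < 0.
Proof.
move=> e0 d1 ab.
have k0 : 0 < 2 * (eta + 2 + `|zeta|) by have := normr_ge0 zeta; lra.
have d0 : 0 < d by rewrite -(pmulr_lgt0 _ k0) d1.
have -> : logRe eta zeta a b = - 1 + (eta + 2) * (1 - a) + zeta * b - (eta + 1) * ((1 - a) * (1 - a) + b * b).
  by rewrite /logRe /numRe /numIm; ring.
have A : 1 - a < d by nra.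
have B : `|b| < d.
  have aa : 0 <= (1 - a) * (1 - a) by rewrite -expr2 sqr_ge0.
  by rewrite ltr_norml; apply/andP; split; nra.
have : zeta * b <= `|zeta| * d.
  by apply: le_trans (ler_norm _) _; rewrite normrM ler_wpM2l // ltW.
have : (eta + 2) * (1 - a) < (eta + 2) * d by rewrite ltr_pM2l //; lra.
have : 0 <= (eta + 1) * ((1 - a) * (1 - a) + b * b) by rewrite mulr_ge0 //; [lra | rewrite addr_ge0 // -expr2 sqr_ge0].
lra.
Qed.

(** Inside this disc |1 - x| does not decrease along ascent, so an ascent curve cannot enter it; and
    the saddle, where [logRe] vanishes, lies outside. *)
Lemma ascent_avoids_disc eta zeta p q d : 0 < eta -> d * (2 * (eta + 2 + `|zeta|)) = 1 ->
  (1 - p) * (1 - p) + q * q < d * d -> ~ ascent_from_saddle eta zeta p q.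
Proof.
move=> e0 d1 pq [X [Y [[Xc Yc A] X0 Y0 [s /andP[s0 s1] [Xs Ys]]]]].
pose g u := (1 - X u) * (1 - X u) + Y u * Y u.
have gc c e : 0 <= c -> e <= 1 -> {within `[c, e], continuous g}.
  move=> c0 e1; have Xce := within_sub c0 e1 Xc; have Yce := within_sub c0 e1 Yc.
  move=> u; apply: cvgD; apply: cvgM; try exact: Yce.
    by apply: cvgB; [exact: cvg_cst | exact: Xce].
  by apply: cvgB; [exact: cvg_cst | exact: Xce].
have g0 : d * d <= g 0.
  rewrite leNgt; apply/negP; rewrite /g X0 Y0 => /(disc_at_one e0 d1).
  by rewrite /logRe numRe_saddle // numIm_saddle // !mul0r addr0 ltxx.
have gs : g s < d * d by rewrite /g Xs Ys.
have [c [/andP[c0 cs] gcd above]] := last_exit s0 (gc 0 s (lexx _) s1) g0 gs.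
have : g c <= g s.
  have D u : c < u < s -> exists2 k, 0 < k & is_derive u 1 g (- k * (2 * logRe eta zeta (X u) (Y u) * g u)) /\ 0 < g u.
    move=> /andP[cu us]; have u01 : 0 < u < 1 by apply/andP; split; lra.
    have [_ _ g1 [k k0 [dX dY]]] := A u u01; exists k => //; split => //.
    rewrite /g; der_eq; rewrite /logRe /fieldRe /fieldIm; ring.
  apply: (nondecr_pointwise (ltW cs) (gc c s c0 s1)) => u us; have [k k0 [dgu gu]] := D u us.
  exists (- k * (2 * logRe eta zeta (X u) (Y u) * g u)) => //.
  have L : logRe eta zeta (X u) (Y u) < 0.
    apply: (disc_at_one e0 d1); apply: above; move: us => /andP[-> us]; exact: ltW.
  have -> : - k * (2 * logRe eta zeta (X u) (Y u) * g u) = 2 * (k * g u) * - logRe eta zeta (X u) (Y u) by ring.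
  by rewrite mulr_ge0 ?oppr_ge0 ?(ltW L) // mulr_ge0 // mulr_ge0 // ltW.
by rewrite leNgt gcd gs.
Qed.


Lemma norm2_gt0 a b : (a != 0) || (b != 0) -> 0 < a * a + b * b.
Proof.
by rewrite -!expr2 lt0r paddr_eq0 ?sqr_ge0 // !sqrf_eq0 negb_and addr_ge0 ?sqr_ge0 // => ->.
Qed.

(* On such a neighbourhood imPhi eta zeta p q is smooth, since the denominators
   inside its arctangents are positive, and the gradients of Re phi and Im phi stay
   within a right angle of those at (p, q). *)
Definition regular_near eta zeta p q d := forall a b, `|a - p| < d -> `|b - q| < d ->
  [/\ 0 < p * a + q * b, 0 < (1 - p) * (1 - a) + q * b,
      0 < dphiIm eta zeta a b * dphiIm eta zeta p q + dphiRe eta zeta a b * dphiRe eta zeta p q &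
      dphiRe eta zeta p q * fieldRe eta zeta a b - dphiIm eta zeta p q * fieldIm eta zeta a b < 0] /\
  (0 < a * a + b * b /\ 0 < (1 - a) * (1 - a) + b * b).

Lemma regular_near_exists eta zeta p q : 0 < nsq eta zeta p q -> 0 < p * p + q * q ->
  0 < (1 - p) * (1 - p) + q * q -> exists2 d, 0 < d & regular_near eta zeta p q d.
Proof.
move=> N0 h0 g0.
set P0 := dphiRe eta zeta p q; set Q0 := dphiIm eta zeta p q.
pose h a b := a * a + b * b; pose g a b := (1 - a) * (1 - a) + b * b.
(* M is the third quantity of [regular_near] multiplied by |x|^2 |1 - x|^2, which makes it a
   polynomial accessible to [polynomial_positive_near]. *)
pose M a b := ((zeta * a - eta * b) * g a b - b * h a b) * Q0 +
              ((eta * a + zeta * b) * g a b - (1 - a) * h a b) * P0.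
pose J a b := - (P0 * fieldRe eta zeta a b - Q0 * fieldIm eta zeta a b).
have J0 : 0 < J p q by rewrite /J /P0 /Q0 (dphi_field eta zeta h0 g0).2 opprK.
have PQ0 : 0 < P0 * P0 + Q0 * Q0.
  apply: norm2_gt0; rewrite -negb_and; apply/negP => /andP[/eqP P00 /eqP Q00].
  by move: J0; rewrite /J P00 Q00 !mul0r subrr oppr0 ltxx.
have ME a b : 0 < h a b -> 0 < g a b -> M a b = h a b * g a b * (dphiIm eta zeta a b * Q0 + dphiRe eta zeta a b * P0).
  move=> ha ga; rewrite /M /dphiRe /dphiIm -/(h a b) -/(g a b).
  by field; rewrite !lt0r_neq0.
have M0 : 0 < M p q.
  by rewrite ME // mulr_gt0 // ?mulr_gt0 // addrC.
have [d1 d10 D1] : exists2 d, 0 < d & forall a b, `|a - p| < d -> `|b - q| < d -> 0 < p * a + q * b.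
  by apply: (@polynomial_positive_near _ (fun a b => p * a + q * b)) => // r Hr; cbv beta; lipschitz.
have [d2 d20 D2] : exists2 d, 0 < d & forall a b, `|a - p| < d -> `|b - q| < d -> 0 < (1 - p) * (1 - a) + q * b.
  by apply: (@polynomial_positive_near _ (fun a b => (1 - p) * (1 - a) + q * b)) => // r Hr; cbv beta; lipschitz.
have [d3 d30 D3] : exists2 d, 0 < d & forall a b, `|a - p| < d -> `|b - q| < d -> 0 < M a b.
  by apply: (@polynomial_positive_near _ (fun a b => M a b)) => // r Hr; rewrite /= /M /h /g; lipschitz.
have [d4 d40 D4] : exists2 d, 0 < d & forall a b, `|a - p| < d -> `|b - q| < d -> 0 < J a b.
  by apply: (@polynomial_positive_near _ (fun a b => J a b)) => // r Hr; rewrite /= /J /fieldRe /fieldIm /numRe /numIm; lipschitz.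
exists (Num.min (Num.min d1 d2) (Num.min d3 d4)) => [|a b].
  by rewrite !lt_min d10 d20 d30.
rewrite !lt_min => /andP[/andP[a1 a2] /andP[a3 a4]] /andP[/andP[b1 b2] /andP[b3 b4]].
have w1 := D1 a b a1 b1; have w2 := D2 a b a2 b2; have m3 := D3 a b a3 b3; have j4 := D4 a b a4 b4.
have ha : 0 < h a b.
  apply: norm2_gt0; rewrite -negb_and; apply/negP => /andP[/eqP a0 /eqP b0].
  by move: w1; rewrite a0 b0 !mulr0 addr0 ltxx.
have ga : 0 < g a b.
  apply: norm2_gt0; rewrite -negb_and; apply/negP => /andP[/eqP a0 /eqP b0].
  by move: w2; rewrite a0 b0 !mulr0 addr0 ltxx.
split; last by [].
split => //; last by rewrite -oppr_gt0.
by move: m3; rewrite ME // pmulr_rgt0 // mulr_gt0.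
Qed.

(** The linear condition puts the two points on a line parallel to the gradient of Im phi at (p, q).
    By regularity Im phi is strictly monotone on the segment between them unless it is a single
    point. *)
Lemma imPhi_injective eta zeta p q d a b a' b' : 0 < nsq eta zeta p q -> 0 < p * p + q * q ->
  0 < (1 - p) * (1 - p) + q * q -> regular_near eta zeta p q d ->
  `|a - p| < d -> `|b - q| < d -> `|a' - p| < d -> `|b' - q| < d ->
  dphiRe eta zeta p q * (a - a') = dphiIm eta zeta p q * (b - b') ->
  imPhi eta zeta p q a b = imPhi eta zeta p q a' b' -> a = a' /\ b = b'.
Proof.
move=> N0 h0 g0 reg Ba Bb Ba' Bb' E EI.
set P0 := dphiRe eta zeta p q in E; set Q0 := dphiIm eta zeta p q in E.
have PQ0 : 0 < P0 * P0 + Q0 * Q0.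
  apply: norm2_gt0; rewrite -negb_and; apply/negP => /andP[/eqP P00 /eqP Q00].
  have := (dphi_field eta zeta h0 g0).2; rewrite -/P0 -/Q0 P00 Q00 !mul0r subrr => /eqP.
  by rewrite eq_sym oppr_eq0 gt_eqF.
pose l := (Q0 * (a - a') + P0 * (b - b')) / (P0 * P0 + Q0 * Q0).
have [Ela Elb] : a - a' = l * Q0 /\ b - b' = l * P0.
  have n := lt0r_neq0 PQ0.
  split; apply: (mulIf n); rewrite /l.
    rewrite mulrAC mulfVK //.
    have : P0 * (P0 * (a - a')) = P0 * (Q0 * (b - b')) by rewrite E.
    clear; lra.
  rewrite mulrAC mulfVK //.
  have : Q0 * (P0 * (a - a')) = Q0 * (Q0 * (b - b')) by rewrite E.
  clear; lra.
clearbody l.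
pose La u := a' + u * (a - a'); pose Lb u := b' + u * (b - b').
have Lbox u : 0 <= u <= 1 -> `|La u - p| < d /\ `|Lb u - q| < d.
  have conv v w : `|v| < d -> `|w| < d -> 0 <= u <= 1 -> `|w + u * (v - w)| < d.
    clear => vr wr /andP[u0 u1].
    have [m [mr /ler_normlP[v1 v2] /ler_normlP[w1 w2]]] : exists m, [/\ m < d, `|v| <= m & `|w| <= m].
      by exists (Num.max `|v| `|w|); rewrite gt_max vr wr !le_max !lexx orbT.
    apply: le_lt_trans mr; rewrite ler_norml.
    have u1' : 0 <= 1 - u by rewrite subr_ge0.
    have k1 : 0 <= u * (m - v) by rewrite mulr_ge0 // subr_ge0.
    have k2 : 0 <= (1 - u) * (m - w) by rewrite mulr_ge0 // subr_ge0.
    have k3 : 0 <= u * (m - - v) by rewrite mulr_ge0 // subr_ge0.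
    have k4 : 0 <= (1 - u) * (m - - w) by rewrite mulr_ge0 // subr_ge0.
    by apply/andP; split; lra.
  move=> u01; split.
    by have := conv (a - p) (a' - p) Ba Ba' u01; rewrite /La; congr (`|_| < _); ring.
  by have := conv (b - q) (b' - q) Bb Bb' u01; rewrite /Lb; congr (`|_| < _); ring.
pose G u := dphiIm eta zeta (La u) (Lb u) * Q0 + dphiRe eta zeta (La u) (Lb u) * P0.
have LId u : 0 <= u <= 1 -> is_derive u 1 (fun u => imPhi eta zeta p q (La u) (Lb u)) (l * G u).
  move=> u01; have [la lb] := Lbox u u01; have [[w1 w2 _ _] [hu gu]] := reg _ _ la lb.
  have da : is_derive u 1 La (l * Q0) by rewrite /La -Ela; der_eq; ring.
  have db : is_derive u 1 Lb (l * P0) by rewrite /Lb -Elb; der_eq; ring.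
  have H := @imPhi_derive _ eta zeta p q La Lb u _ _ h0 g0 w1 w2 hu gu da db.
  by apply: (is_derive_eq H); rewrite /G; ring.
have pos u : 0 <= u <= 1 -> 0 < G u.
  by move=> u01; have [la lb] := Lbox u u01; have [[_ _ ? _] _] := reg _ _ la lb.
have I01 : imPhi eta zeta p q (La 0) (Lb 0) = imPhi eta zeta p q (La 1) (Lb 1).
  by rewrite /La /Lb !mul0r !addr0 !mul1r ![a' + _]addrC ![b' + _]addrC !subrK.
have lcont := der_within LId.
have wk u : 0 < u < 1 -> 0 <= u <= 1 by move=> /andP[/ltW -> /ltW ->].
have l0 : l = 0.
  have [l0|l0|//] := ltrgtP l 0.
    have : - imPhi eta zeta p q (La 0) (Lb 0) < - imPhi eta zeta p q (La 1) (Lb 1).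
      apply: (@incr_pointwise (fun u => - imPhi eta zeta p q (La u) (Lb u)) 0 1 ltr01) => [u|u /wk u01].
        by apply: cvgN; exact: lcont.
      exists (- (l * G u)); first by apply: derN; exact: LId.
      by rewrite oppr_gt0 nmulr_rlt0 // pos.
    by rewrite I01 ltxx.
  have : imPhi eta zeta p q (La 0) (Lb 0) < imPhi eta zeta p q (La 1) (Lb 1).
    apply: (@incr_pointwise (fun u => imPhi eta zeta p q (La u) (Lb u)) 0 1 ltr01 lcont) => u /wk u01.
    exists (l * G u); first exact: LId.
    by rewrite mulr_gt0 // pos.
  by rewrite I01 ltxx.
by move: Ela Elb; rewrite l0 !mul0r => /eqP; rewrite subr_eq0 => /eqP -> /eqP; rewrite subr_eq0 => /eqP ->.
Qed.

(* Near a regular point the level sets of Im phi are graphs over the direction of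
   the gradient, so an ascending curve that ends on a trajectory already runs on it. *)
Lemma ascent_meets_before eta zeta x y X Y s1 : 0 < s1 ->
  trajectory eta zeta x y -> 0 < nsq eta zeta (x s1) (y s1) ->
  0 < x s1 * x s1 + y s1 * y s1 -> 0 < (1 - x s1) * (1 - x s1) + y s1 * y s1 ->
  ascent eta zeta X Y -> X 1 = x s1 -> Y 1 = y s1 ->
  exists s t, [/\ 0 < s < 1, 0 < t, X s = x t & Y s = y t].
Proof.
move=> s10 T N0 h0 g0 [Xc Yc A] X1 Y1.
set p := x s1 in N0 h0 g0 X1; set q := y s1 in N0 h0 g0 Y1.
have [d d0 reg] := regular_near_exists N0 h0 g0.
(* Linear coordinate along the gradient of Re phi at (p, q), and its rate of change J along the
   field: near (p, q), xi falls along the trajectory and does not fall along the ascent curve. *)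
pose xi a b := dphiRe eta zeta p q * (a - p) - dphiIm eta zeta p q * (b - q).
pose J a b := dphiRe eta zeta p q * fieldRe eta zeta a b - dphiIm eta zeta p q * fieldIm eta zeta a b.
have xi0 : xi p q = 0 by rewrite /xi !subrr !mulr0 subrr.
have [dx1 dy1] := T s1 (ltW s10).
have [e1 e10 E1] := continuous_eps (der_cont dx1) d0.
have [e2 e20 E2] := continuous_eps (der_cont dy1) d0.
have [e [ee0 ea eb]] : exists e, [/\ 0 < e, e < e1 & e < e2].
  exists (Num.min e1 e2 / 2).
  have : 0 < Num.min e1 e2 by rewrite lt_min e10.
  have : Num.min e1 e2 <= e1 by rewrite ge_min lexx.
  have : Num.min e1 e2 <= e2 by rewrite ge_min lexx orbT.
  by move: (Num.min e1 e2) => k; clear => k0 k1 k2; split; lra.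
have tbox t : s1 <= t <= s1 + e -> `|x t - p| < d /\ `|y t - q| < d.
  move=> /andP[t1 t2].
  have st : `|s1 - t| <= e by rewrite ler_norml; apply/andP; split; move: t1 t2; clear; lra.
  by split; rewrite distrC; [apply: E1 | apply: E2]; apply: le_lt_trans st _.
have xid t : 0 <= t -> is_derive t 1 (fun u => xi (x u) (y u)) (J (x t) (y t)).
  by move=> t0; have [dx dy] := T t t0; rewrite /xi; der_eq; rewrite /J; ring.
have s1e : s1 < s1 + e by rewrite ltrDl.
have pos u : s1 <= u -> 0 <= u by exact: (le_trans (ltW s10)).
have xixc : {within `[s1, s1 + e], continuous (fun u => xi (x u) (y u))}.
  by apply: (der_within (df := fun u => J (x u) (y u))) => u /andP[u1 _]; apply: xid; exact: pos.
have m0 : xi (x (s1 + e)) (y (s1 + e)) < 0.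
  rewrite -xi0 -/p -/q -ltrN2.
  apply: (@incr_pointwise (fun u => - xi (x u) (y u)) s1 (s1 + e) s1e) => [u|u /andP[/ltW u1 /ltW u2]].
    by apply: cvgN; exact: xixc.
  exists (- J (x u) (y u)); first by apply: derN; apply: xid; exact: pos.
  have [|xu yu] := tbox u; first by rewrite u1.
  by have [[_ _ _ ?] _] := reg _ _ xu yu; rewrite oppr_gt0.
set m := xi _ _ in m0.
have one01 : 0 <= (1 : R) <= 1 by rewrite ler01 lexx.
have /within_eps/(_ 1 one01 _ d0)[f1 f10 F1] := Xc.
have /within_eps/(_ 1 one01 _ d0)[f2 f20 F2] := Yc.
have xic : {within `[0, 1], continuous (fun u => xi (X u) (Y u))}.
  move=> u; rewrite /xi; apply: cvgB; apply: cvgM; try exact: cvg_cst.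
    by apply: cvgB; [exact: Xc | exact: cvg_cst].
  by apply: cvgB; [exact: Yc | exact: cvg_cst].
have mm : 0 < - m by rewrite oppr_gt0.
have /within_eps/(_ 1 one01 _ mm)[f3 f30 F3] := xic.
have [f [f0 fa fb fc fd]] : exists f, [/\ 0 < f, f < f1, f < f2, f < f3 & f < 1].
  exists (Num.min (Num.min f1 f2) (Num.min f3 1) / 2).
  have : 0 < Num.min (Num.min f1 f2) (Num.min f3 1) by rewrite !lt_min f10 f20 f30 ltr01.
  have : Num.min (Num.min f1 f2) (Num.min f3 1) <= f1 by rewrite !ge_min lexx.
  have : Num.min (Num.min f1 f2) (Num.min f3 1) <= f2 by rewrite !ge_min lexx ?orbT.
  have : Num.min (Num.min f1 f2) (Num.min f3 1) <= f3 by rewrite !ge_min lexx ?orbT.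
  have : Num.min (Num.min f1 f2) (Num.min f3 1) <= 1 by rewrite !ge_min lexx ?orbT.
  by move: (Num.min _ _) => k; clear => k0 k1 k2 k3 k4; split; lra.
have [s3 [s30 s31 s3f]] : exists s3, [/\ 0 < s3, s3 < 1 & 1 - s3 = f].
  by exists (1 - f); split; move: f0 fd; clear; lra.
have Xbox u : s3 <= u <= 1 -> `|X u - p| < d /\ `|Y u - q| < d.
  move=> /andP[u1 u2]; have u01 : 0 <= u <= 1 by rewrite u2 (le_trans (ltW s30)).
  have uf : `|1 - u| <= f.
    by rewrite ger0_norm ?subr_ge0 // -s3f lerD2l lerN2.
  by split; rewrite distrC -?X1 -?Y1; [apply: F1 | apply: F2] => //; apply: le_lt_trans uf _.
have inner u : s3 < u < 1 -> 0 < u < 1 /\ s3 <= u <= 1.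
  by move=> /andP[u1 u2]; rewrite u2 (lt_trans s30 u1) !ltW.
have Ider u : s3 < u < 1 -> is_derive u 1 (fun u => imPhi eta zeta p q (X u) (Y u)) 0.
  move=> /inner[u01 us]; have [xu yu] := Xbox u us.
  have [_ hu gu [c c0 [dX dY]]] := A u u01; have [[w1 w2 _ _] _] := reg _ _ xu yu.
  have H := @imPhi_derive _ eta zeta p q X Y u _ _ h0 g0 w1 w2 hu gu dX dY.
  apply: (is_derive_eq H); have := (dphi_field eta zeta hu gu).1.
  set A1 := dphiIm _ _ _ _; set A2 := dphiRe _ _ _ _; set A3 := fieldRe _ _ _ _; set A4 := fieldIm _ _ _ _.
  clearbody A1 A2 A3 A4; clear => E.
  by transitivity (- c * (A1 * A3 + A2 * A4)); [ring | rewrite E mulr0].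
have Ic : {within `[s3, 1], continuous (fun u => imPhi eta zeta p q (X u) (Y u))}.
  apply/subspace_continuousP => u; rewrite /= in_itv /= => us.
  have [xu yu] := Xbox u us; have [[w1 w2 _ _] [hu gu]] := reg _ _ xu yu.
  have /subspace_continuousP Xc' := within_sub (ltW s30) (lexx 1) Xc.
  have /subspace_continuousP Yc' := within_sub (ltW s30) (lexx 1) Yc.
  by apply: imPhi_cvg => //; [apply: Xc' | apply: Yc']; rewrite /= in_itv.
have IX : imPhi eta zeta p q (X s3) (Y s3) = imPhi eta zeta p q p q.
  by rewrite (cst_pointwise (ltW s31) Ic Ider) X1 Y1.
have It t : s1 <= t <= s1 + e -> imPhi eta zeta p q (x t) (y t) = imPhi eta zeta p q p q.
  move=> /andP[t1 t2]; rewrite /p /q; apply/esym.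
  apply: (@const_der _ (fun u => imPhi eta zeta p q (x u) (y u)) _ _ t1) => u /andP[u1 u2].
  have [|xu yu] := tbox u; first by rewrite u1 (le_trans u2).
  have [[w1 w2 _ _] [hu gu]] := reg _ _ xu yu.
  have [dx dy] := T u (pos u u1).
  have H := @imPhi_derive _ eta zeta p q x y u _ _ h0 g0 w1 w2 hu gu dx dy.
  by apply: (is_derive_eq H); exact: (dphi_field eta zeta hu gu).1.
have xi3 : xi (X s3) (Y s3) <= 0.
  rewrite -xi0 -X1 -Y1.
  apply: (@nondecr_pointwise (fun u => xi (X u) (Y u)) s3 1 (ltW s31)).
    exact: within_sub (ltW s30) (lexx 1) xic.
  move=> u /inner[u01 us]; have [xu yu] := Xbox u us.
  have [_ _ _ [c c0 [dX dY]]] := A u u01; have [[_ _ _ Ju] _] := reg _ _ xu yu.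
  exists (- c * J (X u) (Y u)); last by rewrite mulNr oppr_ge0 mulr_ge0_le0 // ltW.
  by rewrite /xi; der_eq; rewrite /J; ring.
have m3 : m < xi (X s3) (Y s3).
  have := F3 s3; rewrite (ltW s30) (ltW s31) X1 Y1 xi0 sub0r normrN => /(_ isT).
  have -> : `|1 - s3| < f3 by rewrite s3f gtr0_norm.
  by move=> /(_ isT); rewrite ltr_norml opprK => /andP[].
(* Shortly before its end the ascent curve has xi between m and 0, and the trajectory sweeps all
   these values after s1. Equal xi and equal Im phi then force equal points. *)
have [t t12 xit] : exists2 t, s1 <= t <= s1 + e & xi (x t) (y t) = xi (X s3) (Y s3).
  have [|t] := @IVT R (fun u => xi (x u) (y u)) s1 (s1 + e) (xi (X s3) (Y s3)) (ltW s1e) xixc.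
    by rewrite -/p -/q -/m xi0 (min_r (ltW m0)) (max_l (ltW m0)) xi3 ltW.
  by rewrite in_itv => /= t12 <-; exists t.
exists s3, t; have tp : 0 < t by move: t12 => /andP[t1 _]; exact: lt_le_trans t1.
have [Ba Bb] := Xbox s3 (introT andP (conj (lexx _) (ltW s31))); have [Ba' Bb'] := tbox t t12.
suff [Ea Eb] : X s3 = x t /\ Y s3 = y t by rewrite s30 s31.
apply: (imPhi_injective N0 h0 g0 reg) => //; last by rewrite IX It.
by move: xit; rewrite /xi; clear; lra.
Qed.

End AscentCurves.

(** * Prolongation of ascent curves and the possible limits of a trajectory *)

Section Alternative.
Context {R : realType}.
Implicit Types (eta zeta a b c d e s t u v w p q r : R) (x y X Y : R -> R).

Definition regular eta zeta a b :=
  [/\ 0 < nsq eta zeta a b, 0 < a * a + b * b & 0 < (1 - a) * (1 - a) + b * b].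

Lemma der_if_lt (f g : R -> R) c s v : s < c -> is_derive s 1 f v ->
  is_derive s 1 (fun u => if u <= c then f u else g u) v.
Proof.
move=> sc; apply: near_eq_is_derive; apply/nbhs_ballP.
exists (c - s) => /=; first by rewrite subr_gt0.
move=> t; rewrite /ball /= ltr_norml => /andP[h1 h2].
by rewrite ifT //; move: h1 h2; clear; lra.
Qed.

Lemma der_if_gt (f g : R -> R) c s v : c < s -> is_derive s 1 g v ->
  is_derive s 1 (fun u => if u <= c then f u else g u) v.
Proof.
move=> cs; apply: near_eq_is_derive; apply/nbhs_ballP.
exists (s - c) => /=; first by rewrite subr_gt0.
move=> t; rewrite /ball /= ltr_norml => /andP[h1 h2].
by rewrite ifF //; apply/negbTE; rewrite -ltNge; move: h1 h2; clear; lra.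
Qed.

(** The ascent curve is followed up to the meeting point, then the trajectory is run backwards to
    time 0, at the speed c that the curve has there, so that the derivatives agree at the
    junction. *)
Lemma ascent_extend eta zeta x y s1 : 0 < eta -> trajectory eta zeta x y ->
  (forall s, 0 <= s -> regular eta zeta (x s) (y s)) -> 0 <= s1 ->
  ascent_from_saddle eta zeta (x s1) (y s1) -> ascent_from_saddle eta zeta (x 0) (y 0).
Proof.
move=> e0 T reg; rewrite le_eqVlt => /predU1P[<- //|s10].
move=> [X [Y [As X0 Y0 [s2 /andP[s20 s21] [Xs Ys]]]]].
have [N1 h1 g1] := reg s1 (ltW s10); have [Xc Yc A] := As.
(* The junction must be an interior parameter, where the curve has a derivative. A meeting at the
   endpoint 1 is moved inside by [ascent_meets_before]; one at 0 would be at the saddle. *)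
have [s3 [t [/andP[s30 s31] t0 Xt Yt]]] : exists s t, [/\ 0 < s < 1, 0 < t, X s = x t & Y s = y t].
  have [s2e|s2n] := eqVneq s2 1.
    by apply: (ascent_meets_before s10 T N1 h1 g1 As); rewrite -s2e.
  exists s2, s1; split => //; rewrite !lt_neqAle s20 s21 s2n !andbT eq_sym.
  apply: contraTneq N1 => s2z; rewrite -Xs -Ys s2z X0 Y0.
  by rewrite /nsq numRe_saddle // numIm_saddle // !mul0r addr0 ltxx.
have [n3 h3 g3 [c c0 [dX3 dY3]]] := A s3 (introT andP (conj s30 s31)).
(* At speed c the way back from time t to time 0 lasts t / c, so K is the total duration, rescaled
   to 1 at the end; w is the trajectory time, from t at s3 down to 0 at K. *)
pose K := s3 + t / c.
have tc : 0 < t / c by rewrite divr_gt0.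
have K0 : 0 < K by rewrite addr_gt0.
pose w u := t - c * (u - s3).
have wE : w s3 = t by rewrite /w subrr mulr0 subr0.
have wK : w K = 0.
  by rewrite /w /K; field; rewrite lt0r_neq0.
have w_ge0 u : u <= K -> 0 <= w u.
  move=> uK; rewrite -wK /w lerD2l lerN2 ler_pM2l // lerD2r //.
have wd u : is_derive u 1 w (- c) by rewrite /w; der_eq; ring.
pose Z (F z : R -> R) u := if u <= s3 then F u else z (w u).
have zd (z : R -> R) (dz u : R) : is_derive (w u) 1 z dz -> is_derive u 1 (fun u => z (w u)) (- c * dz).
  by move=> zw; have H := der_comp (wd u) zw; rewrite mulrC.
have Kd u : is_derive u 1 (fun v => K * v) K by der_eq; ring.
have comp (f : R -> R) u v : is_derive (K * u) 1 f v -> is_derive u 1 (fun s => f (K * s)) (v * K).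
  by move=> fv; exact: der_comp (Kd u) fv.
have Zx u : s3 <= u <= K -> is_derive u 1 (Z X x) (- c * fieldRe eta zeta (x (w u)) (y (w u))) /\
                        is_derive u 1 (Z Y y) (- c * fieldIm eta zeta (x (w u)) (y (w u))).
  move=> /andP[su uK]; have [dx dy] := T _ (w_ge0 u uK).
  split; move: su; rewrite le_eqVlt => /predU1P[us|su].
  - rewrite -us wE in dx *; apply: der_glue; last by rewrite wE.
      by rewrite -Xt -Yt.
    by apply: zd; rewrite wE.
  - by apply: der_if_gt su _; exact: zd.
  - rewrite -us wE in dy *; apply: der_glue; last by rewrite wE.
      by rewrite -Xt -Yt.
    by apply: zd; rewrite wE.
  - by apply: der_if_gt su _; exact: zd.
have Zcont (F z : R -> R) : {within `[0, 1], continuous F} ->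
    (forall u, s3 <= u <= K -> exists dz : R, is_derive u 1 (Z F z) dz) ->
    {within `[0, 1], continuous (fun s => Z F z (K * s))}.
  move=> /within_eps Fc Zdz; apply/within_eps => s /andP[s0 s1'] e ee0.
  have Ks0 : 0 <= K * s by rewrite mulr_ge0 // ltW.
  have [us|us] := ltrP (K * s) s3; last first.
    have [|dz Hz] := Zdz (K * s); first by rewrite us ler_piMr // ltW.
    have [d d0 D] := continuous_eps (der_cont (comp _ _ _ Hz)) ee0.
    by exists d => // v _; exact: D.
  have [|d d0 D] := Fc (K * s) _ e ee0; first by rewrite Ks0 (le_trans (ltW us)) // ltW.
  have md : 0 < Num.min d (s3 - K * s) by rewrite lt_min d0 subr_gt0.
  exists (Num.min d (s3 - K * s) / K) => [|v /andP[v0 v1]]; first by rewrite divr_gt0.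
  rewrite ltr_pdivlMr // => sv.
  have : `|K * s - K * v| < Num.min d (s3 - K * s).
    by rewrite -mulrBr normrM gtr0_norm // mulrC.
  rewrite lt_min => /andP[kd ks].
  have vs : K * v < s3.
    by move: ks; rewrite ltr_norml => /andP[]; clear; lra.
  rewrite /Z (ltW us) (ltW vs); apply: D => //.
  by rewrite mulr_ge0 ?(ltW K0) // (le_trans (ltW vs)) // ltW.
exists (fun s => Z X x (K * s)), (fun s => Z Y y (K * s)); split; last 1 first.
- exists 1; rewrite ?ler01 ?lexx // mulr1 /Z.
  have -> : (K <= s3) = false by apply/negbTE; rewrite -ltNge /K ltrDl.
  by rewrite wK.
- split.
  + by apply: Zcont => // u /Zx[? _]; eexists; eassumption.
  + by apply: Zcont => // u /Zx[_ ?]; eexists; eassumption.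
  move=> s /andP[s0 s1']; have Ks0 : 0 < K * s by rewrite mulr_gt0.
  have [us|us] := ltrP (K * s) s3.
    have KS : 0 < K * s < 1 by rewrite Ks0 (lt_trans us).
    have [n4 h4 g4 [k k0 [dX dY]]] := A _ KS.
    have ZE F z : Z F z (K * s) = F (K * s) by rewrite /Z ltW.
    rewrite !ZE; split => //; exists (k * K); first by rewrite mulr_gt0.
    by split; rewrite -mulNr mulrAC; apply: comp; exact: der_if_lt us _.
  have uK : s3 <= K * s <= K by rewrite us ler_piMr ?(ltW K0) // ltW.
  have [dX dY] := Zx _ uK.
  have wp : 0 <= w (K * s) by apply: w_ge0; move/andP: uK => [].
  have [n4 h4 g4] := reg _ wp.
  have ZE F z : F s3 = z t -> Z F z (K * s) = z (w (K * s)).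
    move=> Fz; rewrite /Z; case: ifP => // le; have -> : K * s = s3 by apply/eqP; rewrite eq_le le us.
    by rewrite wE.
  rewrite !ZE //; split => //; exists (c * K); first by rewrite mulr_gt0.
  by split; rewrite -mulNr mulrAC; apply: comp.
- by rewrite mulr0 /Z (ltW s30).
- by rewrite mulr0 /Z (ltW s30).
Qed.

Lemma descent_alternative eta zeta r d0 d1 x y : 0 < eta -> zeta != 0 -> 0 <= r -> 0 < d0 -> 0 < d1 ->
  trajectory eta zeta x y -> continuous x -> continuous y ->
  (forall s, 0 <= s -> x s * x s + y s * y s <= r * r) ->
  (forall s, 0 <= s -> regular eta zeta (x s) (y s)) ->
  ~ ascent_from_saddle eta zeta (x 0) (y 0) ->
  (exists2 s, 0 <= s & x s * x s + y s * y s < d0) \/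
  (exists2 s, 0 <= s & (1 - x s) * (1 - x s) + y s * y s < d1 /\
     forall t, 0 <= t -> ~ ascent_from_saddle eta zeta (x t) (y t)).
Proof.
move=> e0 z0 r0 d00 d10 T xc yc B reg noasc.
have [|no0] := pselect (exists2 s, 0 <= s & x s * x s + y s * y s < d0); first by left.
have [[s s0 h1]|no1] := pselect (exists2 s, 0 <= s & (1 - x s) * (1 - x s) + y s * y s < d1).
  right; exists s => //; split => // t t0 asc; apply: noasc.
  exact: (ascent_extend e0 T reg t0 asc).
exfalso; apply: noasc; apply: (saddle_limit_ascent e0 T reg).
apply: (@trajectory_to_saddle _ _ _ r (Num.min d0 d1) _ _ e0 z0 r0 _ T xc yc B).
- by rewrite lt_min d00.
- move=> s s0; rewrite ge_min; apply/orP; left; rewrite leNgt; apply/negP => h.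
  by apply: no0; exists s.
move=> s s0; rewrite ge_min; apply/orP; right; rewrite leNgt; apply/negP => h.
by apply: no1; exists s.
Qed.

End Alternative.

(** * Differentiation of complex-valued curves *)

Section ComplexCurves.
Context {R : realType}.
Implicit Types (x : R -> R[i]) (s : R) (v w z : R[i]).

Definition cder x s v := is_derive s 1 (fun u => complex.Re (x u)) (complex.Re v) /\
  is_derive s 1 (fun u => complex.Im (x u)) (complex.Im v).

(** Squared modulus with values in R, whereas the norm on [R[i]] takes values in [R[i]]. *)
Definition sqn z : R := complex.Re z * complex.Re z + complex.Im z * complex.Im z.

Lemma sqn_ge0 z : 0 <= sqn z.
Proof. by rewrite addr_ge0 // -expr2 sqr_ge0. Qed.

Lemma sqnM z w : sqn (z * w) = sqn z * sqn w.
Proof. by case: z w => [a b] [c d]; rewrite /sqn /=; ring. Qed.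

Lemma sqnD z w : sqn (z + w) <= 2 * sqn z + 2 * sqn w.
Proof.
case: z w => [a b] [c d]; rewrite /sqn /=.
have := sqr_ge0 (a - c); have := sqr_ge0 (b - d); rewrite !expr2; lra.
Qed.

Lemma sqnB z w : sqn (z - w) <= 2 * sqn z + 2 * sqn w.
Proof.
case: z w => [a b] [c d]; rewrite /sqn /=.
have := sqr_ge0 (a + c); have := sqr_ge0 (b + d); rewrite !expr2; lra.
Qed.

Lemma sqnJ z : sqn z^* = sqn z.
Proof. by case: z => [a b]; rewrite /sqn /=; ring. Qed.

Lemma sqn_eq0 z : (sqn z == 0) = (z == 0).
Proof.
case: z => [a b]; rewrite /sqn /= paddr_eq0 -?expr2 ?sqr_ge0 // !sqrf_eq0.
by apply/andP/eqP => [[/eqP -> /eqP ->]|[-> ->]].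
Qed.

Lemma sqn_gt0 z : (0 < sqn z) = (z != 0).
Proof. by rewrite lt0r sqn_eq0 sqn_ge0 andbT. Qed.

Lemma cder_eq x s v w : cder x s v -> v = w -> cder x s w.
Proof. by move=> ? <-. Qed.

Lemma cderC z s : cder (fun=> z) s 0.
Proof. by split; exact: der_cst. Qed.

Lemma cderD x y s v w : cder x s v -> cder y s w -> cder (fun u => x u + y u) s (v + w).
Proof.
move=> [x1 x2] [y1 y2]; split.
- under eq_fun do rewrite raddfD; rewrite raddfD; exact: derD.
- under eq_fun do rewrite raddfD; rewrite raddfD; exact: derD.
Qed.

Lemma cderB x y s v w : cder x s v -> cder y s w -> cder (fun u => x u - y u) s (v - w).
Proof.
move=> [x1 x2] [y1 y2]; split.
- under eq_fun do rewrite raddfB; rewrite raddfB; exact: derB.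
- under eq_fun do rewrite raddfB; rewrite raddfB; exact: derB.
Qed.

Lemma ReM z w : complex.Re (z * w) = complex.Re z * complex.Re w - complex.Im z * complex.Im w.
Proof. by case: z w => [a b] [c d]. Qed.

Lemma ImM z w : complex.Im (z * w) = complex.Re z * complex.Im w + complex.Im z * complex.Re w.
Proof. by case: z w => [a b] [c d]. Qed.

Lemma cderM x y s v w : cder x s v -> cder y s w ->
  cder (fun u => x u * y u) s (v * y s + x s * w).
Proof.
move=> [x1 x2] [y1 y2]; split.
- under eq_fun do rewrite ReM; rewrite raddfD /= !ReM; der_eq; ring.
- under eq_fun do rewrite ImM; rewrite raddfD /= !ImM; der_eq; ring.
Qed.

Lemma invcE z : complex.Re z^-1 = complex.Re z / sqn z /\ complex.Im z^-1 = - complex.Im z / sqn z.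
Proof. by case: z => [a b]; rewrite /sqn /= -!expr2; split => //; rewrite mulNr. Qed.

Lemma cderV x s v : x s != 0 -> cder x s v -> cder (fun u => (x u)^-1) s (- v * (x s)^-1 * (x s)^-1).
Proof.
move=> xs0 [x1 x2]; have n0 : sqn (x s) != 0 by rewrite sqn_eq0.
have nd : is_derive s 1 (fun u => sqn (x u)) (2 * (complex.Re (x s) * complex.Re v + complex.Im (x s) * complex.Im v)).
  by rewrite /sqn; der_eq; ring.
have ni := @derV _ (fun u => sqn (x u)) s _ n0 nd.
have [iR iI] := invcE (x s).
split.
- under eq_fun do rewrite (proj1 (invcE _)).
  rewrite !ReM !ImM iR iI !raddfN /=; der_eq; rewrite /sqn in n0 *; field; exact: n0.
- under eq_fun do rewrite (proj2 (invcE _)).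
  rewrite !ImM !ReM iR iI !raddfN /=; der_eq; rewrite /sqn in n0 *; field; exact: n0.
Qed.

Lemma cder_exp x s w n : cder x s (w * x s) -> cder (fun u => x u ^+ n) s (n%:R * w * x s ^+ n).
Proof.
move=> xd; elim: n => [|n IH].
  under eq_fun do rewrite expr0; rewrite !mul0r; exact: cderC.
under eq_fun do rewrite exprS.
by apply: (cder_eq (cderM xd IH)); rewrite exprS -[n.+1%:R]natr1; ring.
Qed.

Lemma cder_horner (P : {poly R[i]}) x s v : cder x s v -> cder (fun u => P.[x u]) s (P^`().[x s] * v).
Proof.
move=> xd; elim/poly_ind: P => [|P c IH].
  under eq_fun do rewrite horner0; rewrite deriv0 horner0 mul0r; exact: cderC.
under eq_fun do rewrite hornerMXaddC.
apply: (cder_eq (cderD (cderM IH xd) (cderC c s))).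
by rewrite derivMXaddC hornerD hornerM hornerX; ring.
Qed.

Lemma horner_bounded (P : {poly R[i]}) : exists M : R, forall z, sqn z <= 1 -> sqn P.[z] <= M.
Proof.
elim/poly_ind: P => [|P c [M PM]].
  by exists 0 => z _; rewrite horner0 /sqn /= !mul0r addr0.
exists (2 * M + 2 * sqn c) => z z1; rewrite hornerMXaddC.
apply: le_trans (sqnD _ _) _; rewrite lerD2r ler_wpM2l // sqnM.
by apply: le_trans (PM z z1); rewrite ler_piMr // sqn_ge0.
Qed.

End ComplexCurves.

(** * The differential equation of p_n *)

Section Hypergeometric.
Context {R : realType}.
Implicit Types (alpha z : R[i]) (n k : nat).

Lemma rising_opp n k : (k <= n)%N ->
  rising (- n%:R : R[i]) k = (-1) ^+ k * ('C(n, k) * k`!)%:R.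
Proof.
elim: k => [|k IH] kn; first by rewrite /rising big_ord0 expr0 bin0 fact0 muln1 mul1r.
have E : rising (- n%:R : R[i]) k.+1 = rising (- n%:R) k * (- n%:R + k%:R) by rewrite /rising big_ord_recr.
rewrite E (IH (ltnW kn)).
have H : ('C(n, k.+1) * k.+1`!)%N = ('C(n, k) * k`! * (n - k))%N.
  by rewrite factS mulnA [('C(n, k.+1) * _)%N]mulnC mul_bin_left; ring.
rewrite H [in RHS]natrM natrB ?(ltnW kn) // exprS; ring.
Qed.

(** The product telescopes; this is where the third parameter exceeding the second by exactly 1
    enters. *)
Lemma rising_ratio (b : R[i]) k : (forall j, b + j%:R != 0) ->
  rising b k / rising (b + 1) k = b / (b + k%:R).
Proof.
move=> b0; elim: k => [|k IH].
  by rewrite /rising !big_ord0 divr1 addr0 divff // -[b]addr0 (b0 0%N).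
have r0 : rising (b + 1) k != 0.
  by rewrite /rising; apply/prodf_neq0 => i _; rewrite -addrA [1 + _]addrC natr1.
have E1 : rising b k.+1 = rising b k * (b + k%:R) by rewrite /rising big_ord_recr.
have E2 : rising (b + 1) k.+1 = rising (b + 1) k * (b + 1 + k%:R) by rewrite /rising big_ord_recr.
have b1 : b + 1 + k%:R != 0 by rewrite -addrA [1 + _]addrC natr1.
have -> : rising b k.+1 / rising (b + 1) k.+1 = rising b k / rising (b + 1) k * ((b + k%:R) / (b + 1 + k%:R)).
  by rewrite E1 E2; field; rewrite r0 b1.
rewrite IH -natr1; field.
by rewrite [b + (_ + 1)]addrC -[_ + 1 + b]addrA [1 + b]addrC [k%:R + _]addrC b1 b0.
Qed.

Lemma ode_coefficient (b w c : R[i]) : b + w != 0 ->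
  w * (c * (b / (b + w))) + b * (c * (b / (b + w))) = b * c.
Proof. by move=> K; field; exact: K. Qed.

(** With b = alpha n + 1, the k-th coefficient of p_n is that of (1 - X)^n times b / (b + k), and x
    d/dx + b multiplies it by b + k. Equivalently, x^b p_n is b times the integral of s^(b - 1) (1 -
    s)^n = e^(n phi(s)) from 0 to x, where phi is taken in the variable x. *)
Lemma pn_ode (eta zeta : R) n : 0 < eta ->
  'X * (pn (eta +i* zeta) n)^`() + ((eta +i* zeta) * n%:R + 1) *: pn (eta +i* zeta) n =
  ((eta +i* zeta) * n%:R + 1) *: (1 - 'X) ^+ n.
Proof.
move=> e0; set alpha := eta +i* zeta; set b := alpha * n%:R + 1.
have b0 j : b + j%:R != 0.
  rewrite -sqn_gt0 /sqn; apply: ltr_wpDr; first by rewrite -expr2 sqr_ge0.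
  have -> : complex.Re (b + j%:R) = eta * n%:R + 1 + j%:R.
    rewrite /b !raddfD /= ReM /alpha /=.
    have EE m : complex.Re (m%:R : R[i]) = m%:R /\ complex.Im (m%:R : R[i]) = 0.
      by split; [rewrite raddfMn | rewrite raddfMn /= mul0rn].
    by rewrite !(EE _).1 (EE _).2 mulr0 subr0.
  have p : 0 < eta * n%:R + 1 + j%:R by rewrite ltr_wpDr ?ler0n // ltr_wpDl // mulr_ge0 ?ler0n // ltW.
  by rewrite mulr_gt0.
apply/polyP => k; rewrite coefD coefXM coef_deriv !coefZ.
have -> : (1 - 'X : {poly R[i]}) ^+ n = \sum_(i < n.+1) ((-1) ^+ i * 'C(n, i)%:R) *: 'X^i.
  rewrite exprBn; apply: eq_bigr => i _; rewrite expr1n mulr1 -mulr_natl -scaler_nat.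
  by rewrite -!mul_polyC !rmorphM !rmorphXn /= rmorphN rmorph1 rmorph_nat; ring.
have E : (\sum_(i < n.+1) ((-1) ^+ i * 'C(n, i)%:R : R[i]) *: 'X^i)`_k = (-1) ^+ k * 'C(n, k)%:R.
  by rewrite -(poly_def n.+1 (fun i => (-1) ^+ i * 'C(n, i)%:R)) coef_poly; case: ltnP => // kn; rewrite bin_small // mulr0.
rewrite E.
have P k' : (pn alpha n)`_k' = (-1) ^+ k' * 'C(n, k')%:R * (b / (b + k'%:R)).
  rewrite /pn /hyp2F1_poly coef_poly; case: ltnP => [kn|kn]; last by rewrite bin_small // mulr0 mul0r.
  rewrite -/b -(rising_ratio k' b0).
  have -> : alpha * n%:R + 2 = b + 1 by rewrite /b; ring.
  have r0 : rising (b + 1) k' != 0.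
    by rewrite /rising; apply/prodf_neq0 => i _; rewrite -addrA [1 + _]addrC natr1.
  rewrite rising_opp // natrM; field.
  by rewrite r0 pnatr_eq0 -lt0n fact_gt0.
have K : b + k%:R != 0 by exact: b0.
case: k E K => [|k] E K /=.
  by rewrite add0r P addr0 divff ?mulr1 //; move: K; rewrite addr0.
rewrite !P -[X in X + _]mulr_natl; exact: ode_coefficient.
Qed.

End Hypergeometric.

(** * Growth of the deviation along trajectories *)

Section Growth.
Context {R : realType} (eta zeta : R).
Implicit Types (x y : R -> R) (s : R) (z : R[i]) (n : nat).

Let alpha : R[i] := eta +i* zeta.
Let num z : R[i] := alpha - (alpha + 1) * z.

Lemma sqn_num (a b : R) : sqn (num (a +i* b)) = nsq eta zeta a b.
Proof. by rewrite /num /alpha /sqn /nsq /numRe /numIm /=; ring. Qed.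

Lemma conjc_mul z : z^* * z = (sqn z)%:C.
Proof. by case: z => a b; apply/eqP; rewrite eq_complex /sqn /=; apply/andP; split; apply/eqP; ring. Qed.

Lemma fieldE (a b : R) : fieldRe eta zeta a b +i* fieldIm eta zeta a b =
  - ((num (a +i* b))^* * (a +i* b) * (1 - (a +i* b))).
Proof.
apply/eqP; rewrite eq_complex /num /alpha /fieldRe /fieldIm /numRe /numIm /=.
by apply/andP; split; apply/eqP; ring.
Qed.

Lemma trajectory_cder x y s : trajectory eta zeta x y -> 0 <= s ->
  cder (fun u => x u +i* y u) s (- ((num (x s +i* y s))^* * (x s +i* y s) * (1 - (x s +i* y s)))).
Proof. by move=> T s0; rewrite -fieldE; have [dx dy] := T s s0; split. Qed.

(* The amplitude p_n(x) / (1 - x)^n is alpha (1 - x) / N(x) to leading order in n;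
   this is the deviation from it, multiplied by N(x). *)
Definition deviation n z : R[i] := num z * ((pn alpha n).[z] * (1 - z)^-1 ^+ n) - alpha * (1 - z).

(** What remains of the derivative once the growth term of order n is split off; n enters it only
    through p_n / (1 - x)^n. *)
Definition deviation_rest n z : R[i] :=
  (num z)^* * (1 - z) * (alpha * ((pn alpha n).[z] * (1 - z)^-1 ^+ n) - alpha + z).

(** For Y = p_n / (1 - x)^n the terms of order n in the derivative are n conj N ((alpha (1 - x) - x)
    Y - alpha (1 - x)). Since alpha (1 - x) - x = N, this is n conj N times the deviation. *)
Lemma deviation_derive n x y s : 0 < eta -> trajectory eta zeta x y -> 0 <= s ->
  1 - (x s +i* y s) != 0 ->
  cder (fun u => deviation n (x u +i* y u)) s
    ((n%:R * nsq eta zeta (x s) (y s))%:C * deviation n (x s +i* y s) + deviation_rest n (x s +i* y s)).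
Proof.
move=> e0 T s0 v0; have G := trajectory_cder T s0.
pose g u := x u +i* y u; rewrite -/(g s) in v0 G *.
set m := (num (g s))^* in G.
set g' := - _ in G.
have dv : cder (fun u => 1 - g u) s (- g') by apply: (cder_eq (cderB (cderC 1 s) G)); rewrite sub0r.
have dV : cder (fun u => (1 - g u)^-1) s (- m * g s * (1 - g s)^-1).
  by apply: (cder_eq (cderV v0 dv)); rewrite /g'; field; exact: v0.
have dW := cder_exp n dV; have dP := cder_horner (pn alpha n) G.
have dN : cder (fun u => num (g u)) s (- (alpha + 1) * g').
  by apply: (cder_eq (cderB (cderC alpha s) (cderM (cderC (alpha + 1) s) G))); ring.
have D := cderB (cderM dN (cderM dP dW)) (cderM (cderC alpha s) dv).
apply: (cder_eq D).
have ODE := congr1 (fun p => p.[g s]) (pn_ode zeta n e0).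
rewrite /= hornerD hornerM hornerX !hornerZ horner_exp hornerD hornerN hornerX hornerC -/alpha in ODE.
have UW : (1 - g s) ^+ n * (1 - g s)^-1 ^+ n = 1 by rewrite -exprMn divff // expr1n.
have mN : m * num (g s) = (nsq eta zeta (x s) (y s))%:C by rewrite conjc_mul sqn_num.
have En : (n%:R * nsq eta zeta (x s) (y s))%:C = n%:R * (m * num (g s)) :> R[i].
  by rewrite mN rmorphM /= rmorph_nat.
rewrite En /deviation /deviation_rest -/m.
clear mN En D dN dW dP dV dv G.
move: ODE UW; rewrite /g'.
set P := (pn alpha n).[g s]; set A := (_^`()).[g s]; set U := (1 - g s) ^+ n; set W := (1 - g s)^-1 ^+ n.
set v := g s; set N := num v; set k := n%:R.
have NE : N = alpha - (alpha + 1) * v by [].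
clearbody N P A U W v m.
move=> ODE UW.
have A1 : A * - (m * v * (1 - v)) = - (m * (1 - v)) * ((alpha * k + 1) * (U - P)).
  transitivity (- (m * (1 - v)) * (v * A)); first by ring.
  congr (_ * _); rewrite mulrBr -ODE; ring.
rewrite A1.
transitivity (- (alpha + 1) * - (m * v * (1 - v)) * (P * W) +
  N * (- (m * (1 - v)) * (alpha * k + 1) * (U * W) + (m * (1 - v)) * (alpha * k + 1) * P * W - P * (k * (m * v)) * W) -
  alpha * (m * v * (1 - v))); first by ring.
by rewrite UW NE; ring.
Qed.

(** The factor conj N gives Y = p_n / (1 - x)^n the modulus of N Y, which is the deviation plus
    alpha (1 - x). So nothing is divided by N, and K depends only on alpha and r. *)
Lemma deviation_rest_bound (r : R) : exists K : R, forall n (a b : R),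
  a * a + b * b <= r * r -> num (a +i* b) != 0 ->
  sqn (deviation_rest n (a +i* b)) <= K * (sqn (deviation n (a +i* b)) + 1).
Proof.
(* Bounds on the ball: v for |1 - z|^2, Nb for |N|^2, Gb for |z - alpha|^2. *)
pose A := sqn alpha; pose v := 2 + 2 * (r * r); pose Nb := 2 * A + 2 * (sqn (alpha + 1) * (r * r)).
pose Gb := 2 * (r * r) + 2 * A.
exists (v * (4 * A) + v * (4 * (A * A * v) + 2 * (Nb * Gb))) => n a b ab N0.
set z := a +i* b in N0 *.
have zr : sqn z <= r * r by [].
have A0 : 0 <= A := sqn_ge0 _.
have rr : 0 <= r * r by rewrite -expr2 sqr_ge0.
have vb : sqn (1 - z) <= v.
  by apply: le_trans (sqnB _ _) _; rewrite /v /sqn /= mul0r addr0 !mulr1 lerD2l ler_wpM2l.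
have NB : sqn (num z) <= Nb.
  apply: le_trans (sqnB _ _) _; rewrite lerD2l ler_wpM2l // sqnM ler_wpM2l ?sqn_ge0 //.
have GB : sqn (z - alpha) <= Gb.
  by apply: le_trans (sqnB _ _) _; rewrite lerD2r ler_wpM2l.
set Y := (pn alpha n).[z] * (1 - z)^-1 ^+ n.
have devE : num z * Y = deviation n z + alpha * (1 - z) by rewrite /deviation -/Y subrK.
have F0 := sqn_ge0 (deviation n z); set F := sqn (deviation n z) in F0 *.
have NY : sqn (num z * Y) <= 2 * F + 2 * (A * v).
  rewrite devE; apply: le_trans (sqnD _ _) _; rewrite lerD2l ler_wpM2l // sqnM ler_wpM2l //.
have Bb : sqn ((num z)^* * (alpha * Y - alpha + z)) <= 2 * (A * (2 * F + 2 * (A * v))) + 2 * (Nb * Gb).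
  have -> : (num z)^* * (alpha * Y - alpha + z) = alpha * ((num z)^* * Y) + (num z)^* * (z - alpha) by ring.
  apply: le_trans (sqnD _ _) _; rewrite sqnM [sqn (_^* * Y)]sqnM [sqn (_^* * (z - _))]sqnM sqnJ -sqnM.
  apply: lerD; rewrite ler_wpM2l //; first by rewrite ler_wpM2l.
  by rewrite ler_pM ?sqn_ge0.
have -> : deviation_rest n z = (1 - z) * ((num z)^* * (alpha * Y - alpha + z)).
  by rewrite /deviation_rest -/Y; ring.
rewrite sqnM; apply: (@le_trans _ _ (v * (2 * (A * (2 * F + 2 * (A * v))) + 2 * (Nb * Gb)))).
  by rewrite ler_pM ?sqn_ge0.
have v0 : 0 <= v by apply: le_trans vb; exact: sqn_ge0.
have N0' : 0 <= Nb by apply: le_trans NB; exact: sqn_ge0.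
have G0' : 0 <= Gb by apply: le_trans GB; exact: sqn_ge0.
have k1 : 0 <= v * (4 * A) by rewrite !mulr_ge0.
have k2 : 0 <= v * (4 * (A * A * v) + 2 * (Nb * Gb)) by rewrite mulr_ge0 // addr_ge0 // !mulr_ge0.
have k3 : 0 <= v * (4 * (A * A * v) + 2 * (Nb * Gb)) * F by rewrite mulr_ge0.
by move: k1 k3; lra.
Qed.

(** For the deviation e, the derivative of |e|^2 is 2 n |N|^2 |e|^2 + 2 Re (conj e rest). Bounding
    the last term below by - |e|^2 - |rest|^2 leaves l |e|^2 - K, to which Gronwall applies. *)
Lemma deviation_growth (r d K : R) n x y : 0 < eta -> trajectory eta zeta x y ->
  (forall n (a b : R), a * a + b * b <= r * r -> num (a +i* b) != 0 ->
     sqn (deviation_rest n (a +i* b)) <= K * (sqn (deviation n (a +i* b)) + 1)) ->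
  (forall s, 0 <= s -> x s * x s + y s * y s <= r * r) ->
  (forall s, 0 <= s -> 0 < (1 - x s) * (1 - x s) + y s * y s) ->
  0 < d -> (forall s, 0 <= s -> d <= nsq eta zeta (x s) (y s)) ->
  0 < 2 * n%:R * d - 1 - K ->
  let l := 2 * n%:R * d - 1 - K in
  forall s, 0 <= s ->
   (sqn (deviation n (x 0 +i* y 0)) - K / l) * expR (l * s) + K / l <= sqn (deviation n (x s +i* y s)).
Proof.
move=> e0 T HK B P1 d0 Nd l0 l s s0.
pose e u := deviation n (x u +i* y u).
pose F u := sqn (e u).
have v0 (u : R) : 0 <= u -> 1 - (x u +i* y u) != 0.
  by move=> /P1; rewrite -sqn_gt0 /sqn /= sub0r mulrNN.
have N0 (u : R) : 0 <= u -> num (x u +i* y u) != 0.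
  by move=> u0; rewrite -sqn_gt0 sqn_num; exact: lt_le_trans (Nd u u0).
pose e' u := (n%:R * nsq eta zeta (x u) (y u))%:C * e u + deviation_rest n (x u +i* y u).
have ed (u : R) : 0 <= u -> cder e u (e' u) by move=> u0; exact: deviation_derive (v0 u u0).
pose dF u := 2 * (complex.Re (e u) * complex.Re (e' u) + complex.Im (e u) * complex.Im (e' u)).
have Fd (u : R) : 0 <= u -> is_derive u 1 F (dF u).
  by move=> u0; have [d1 d2] := ed u u0; rewrite /F /sqn; der_eq; rewrite /dF; ring.
have low (u : R) : 0 <= u -> l * F u - l * (K / l) <= dF u.
  move=> u0; have RB := HK n _ _ (B u u0) (N0 u u0); have Nu := Nd u u0.
  rewrite [l * (K / l)]mulrC divfK ?lt0r_neq0 //.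
  rewrite -/(e u) -/(F u) in RB; move: RB; rewrite /dF /e' /F.
  set rest := deviation_rest _ _; move: Nu; set N := nsq _ _ _ _; move=> Nu.
  case: (e u) rest => [a b] [c f]; rewrite /sqn /= => RB.
  have n0 : (0 : R) <= n%:R by rewrite ler0n.
  have q0 : 0 <= a * a + b * b by rewrite addr_ge0 // -expr2 sqr_ge0.
  have q1 : 0 <= (a + c) * (a + c) by rewrite -expr2 sqr_ge0.
  have q2 : 0 <= (b + f) * (b + f) by rewrite -expr2 sqr_ge0.
  have q3 : 2 * n%:R * d * (a * a + b * b) <= 2 * n%:R * N * (a * a + b * b).
    by rewrite ler_wpM2r // ler_wpM2l // mulr_ge0.
  rewrite /l; move: RB q1 q2 q3; move: (n%:R : R) => k; lra.
by have := gronwall_lower Fd low s0.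
Qed.

Lemma deviation_bounded n : exists M : R, forall z, sqn z <= 1 / 4 -> sqn (deviation n z) <= M.
Proof.
have [M PM] := horner_bounded (pn alpha n).
pose A := sqn alpha; pose Nb := 2 * A + 2 * sqn (alpha + 1).
exists (2 * (Nb * (M * 16 ^+ n)) + 2 * (A * 4)) => z z4.
have z1 : sqn z <= 1 by apply: le_trans z4 _; lra.
have v4 : sqn (1 - z) <= 4.
  by apply: le_trans (sqnB _ _) _; rewrite {1}/sqn /= mul0r addr0 mulr1; lra.
have v16 : 1 / 16 <= sqn (1 - z).
  have : sqn (1 : R[i]) <= 2 * sqn (1 - z) + 2 * sqn z.
    by rewrite -[X in sqn X <= _](subrK z); exact: sqnD.
  by rewrite {1}/sqn /= mul0r addr0 mulr1; lra.
have vV : sqn (1 - z)^-1 <= 16.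
  have v0 : 1 - z != 0 by rewrite -sqn_gt0; lra.
  have : sqn (1 - z) * sqn (1 - z)^-1 = 1 by rewrite -sqnM divff // /sqn /= mul0r addr0 mulr1.
  have := sqn_ge0 (1 - z)^-1; move: v16; move: (sqn _) (sqn _) => p q; nra.
have Vn k : sqn ((1 - z)^-1 ^+ k) <= 16 ^+ k.
  elim: k => [|k IH]; first by rewrite !expr0 /sqn /= mul0r addr0 mulr1.
  by rewrite !exprS sqnM ler_pM ?sqn_ge0.
have NB : sqn (num z) <= Nb.
  by apply: le_trans (sqnB _ _) _; rewrite lerD2l ler_wpM2l // sqnM ler_piMr ?sqn_ge0.
apply: le_trans (sqnB _ _) _; apply: lerD; rewrite ler_wpM2l // !sqnM.
  by rewrite ler_pM ?mulr_ge0 ?sqn_ge0 // ler_pM ?sqn_ge0 ?PM.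
by rewrite ler_wpM2l ?sqn_ge0.
Qed.

(** At a zero of p_n the deviation is - alpha (1 - x), of squared modulus at least |alpha|^2 c. Once
    this exceeds K / l the deviation grows without bound, against [deviation_bounded] near 0. The
    threshold depends only on eta, zeta, r, d and c, hence serves all trajectories with these
    bounds. *)
Lemma no_zero_on_trajectory (r d c : R) : 0 < eta -> 0 < d -> 0 < c ->
  exists n0 : nat, forall n x y (S : R), (n0 <= n)%N -> trajectory eta zeta x y ->
  (forall s, 0 <= s -> x s * x s + y s * y s <= r * r) ->
  (forall s, 0 <= s -> 0 < (1 - x s) * (1 - x s) + y s * y s) ->
  (forall s, 0 <= s -> d <= nsq eta zeta (x s) (y s)) ->
  0 <= S -> (forall s, S <= s -> x s * x s + y s * y s <= 1 / 4) ->
  c <= (1 - x 0) * (1 - x 0) + y 0 * y 0 ->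
  (pn alpha n).[x 0 +i* y 0] != 0.
Proof.
move=> e0 d0 c0; have [K0 HK0] := deviation_rest_bound r.
pose K := `|K0| + 1; have K1 : 0 < K by rewrite ltr_wpDl.
have HK n (a b : R) : a * a + b * b <= r * r -> num (a +i* b) != 0 ->
     sqn (deviation_rest n (a +i* b)) <= K * (sqn (deviation n (a +i* b)) + 1).
  move=> h1 h2; apply: le_trans (HK0 n a b h1 h2) _.
  have F1 : 0 <= sqn (deviation n (a +i* b)) + 1 by rewrite ltW // ltr_wpDl ?sqn_ge0.
  by rewrite ler_wpM2r // /K; have := ler_norm K0; lra.
pose A := sqn alpha.
have A0 : 0 < A.
  by rewrite /A /sqn /= ltr_pwDl ?mulr_gt0 // -expr2 sqr_ge0.
(* Chosen so that 2 n d > l0 gives l > K / (A c) + 1, and hence K / l < A c. *)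
pose l0 := K / (A * c) + 1 + 1 + K.
have Ac : 0 < A * c by rewrite mulr_gt0.
have l00 : 0 < l0.
  rewrite /l0; have : 0 < K / (A * c) by rewrite divr_gt0.
  by move: K1; lra.
exists (Num.bound (l0 / (2 * d))) => n x y S nn T B P1 Nd S0 small cc.
have nl : l0 < 2 * n%:R * d.
  have d2 : 0 < 2 * d by rewrite mulr_gt0.
  have : l0 / (2 * d) < n%:R.
    apply: lt_le_trans (archi_boundP _) _; first by rewrite divr_ge0 ?ltW.
    by rewrite ler_nat.
  by rewrite ltr_pdivrMr // [2 * _ * d]mulrAC [2 * d * _]mulrC.
pose l := 2 * n%:R * d - 1 - K.
have ll : K / (A * c) + 1 < l by rewrite /l; move: nl; rewrite /l0; lra.
have Kc : 0 < K / (A * c) by rewrite divr_gt0.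
have lp : 0 < l by move: ll Kc; lra.
apply/negP => /eqP Pz.
have F0 : A * c <= sqn (deviation n (x 0 +i* y 0)).
  rewrite /deviation Pz mul0r mulr0 sub0r -mulNr sqnM.
  have -> : sqn (- alpha) = A by rewrite /A /sqn /= !mulrNN.
  by rewrite ler_wpM2l ?(ltW A0) // /sqn /= sub0r mulrNN.
have Kl : K / l < A * c.
  rewrite ltr_pdivrMr // mulrC -ltr_pdivrMr //; move: ll; lra.
pose E := sqn (deviation n (x 0 +i* y 0)) - K / l.
have E0 : 0 < E by rewrite subr_gt0; exact: lt_le_trans F0.
have [M HM] := deviation_bounded n.
have grow s : 0 <= s -> S <= s -> E * (l * s) <= M.
  move=> s0 Ss; have := deviation_growth e0 T HK B P1 d0 Nd lp s0; rewrite -/l -/E => H.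
  have H1 : sqn (deviation n (x s +i* y s)) <= M by apply: HM; exact: small.
  apply: le_trans H1; apply: le_trans H.
  have Kl0 : 0 <= K / l by rewrite divr_ge0 // ltW.
  apply: (@le_trans _ _ (E * expR (l * s))); last by rewrite lerDl.
  rewrite ler_wpM2l ?(ltW E0) // (le_trans _ (expR_ge1Dx _)) // lerDr //.
have El : 0 < E * l by rewrite mulr_gt0.
(* A time past S at which already the linear lower bound E l s of the exponential exceeds M. *)
pose s := S + `|M| / (E * l) + 1.
have Ml : 0 <= `|M| / (E * l) by rewrite divr_ge0 // ltW.
have s0 : 0 <= s by rewrite /s; move: S0 Ml; lra.
have Ss : S <= s by rewrite /s; move: Ml; lra.
have := grow s s0 Ss.
have -> : E * (l * s) = E * l * S + `|M| + E * l by rewrite /s; field; rewrite !lt0r_neq0.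
have := ler_norm M; have : 0 <= E * l * S by rewrite mulr_ge0 // ltW.
by move: El; lra.
Qed.

End Growth.

(** * Uniformity over the starting points close to z *)

Section NotLimit.
Context {R : realType}.
Implicit Types (eta zeta a b p q r s S : R) (x y : R -> R).

Lemma saddle_in_ball eta zeta r : 0 < eta -> 1 <= r ->
  saddleRe eta zeta * saddleRe eta zeta + saddleIm eta zeta * saddleIm eta zeta <= r * r.
Proof.
move=> e0 r1; have D0 := den_gt0 zeta e0.
have -> : saddleRe eta zeta * saddleRe eta zeta + saddleIm eta zeta * saddleIm eta zeta =
  (eta * eta + zeta * zeta) / ((eta + 1) * (eta + 1) + zeta * zeta).
  by rewrite /saddleRe /saddleIm; field; rewrite lt0r_neq0.
apply: (@le_trans _ _ 1); first by rewrite ler_pdivrMr // mul1r lerD2r; nra.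
nra.
Qed.

Lemma field_saddle eta zeta : 0 < eta ->
  fieldRe eta zeta (saddleRe eta zeta) (saddleIm eta zeta) = 0 /\
  fieldIm eta zeta (saddleRe eta zeta) (saddleIm eta zeta) = 0.
Proof. by move=> e0; rewrite /fieldRe /fieldIm numRe_saddle // numIm_saddle // !mul0r addr0 subrr oppr0. Qed.

Lemma field_one eta zeta : fieldRe eta zeta 1 0 = 0 /\ fieldIm eta zeta 1 0 = 0.
Proof. by rewrite /fieldRe /fieldIm; split; ring. Qed.

Lemma field_zero eta zeta : fieldRe eta zeta 0 0 = 0 /\ fieldIm eta zeta 0 0 = 0.
Proof. by rewrite /fieldRe /fieldIm; split; ring. Qed.

(** [radial] is Re ((1 - conj x) N), so Cauchy-Schwarz bounds it by |1 - x| |N|. In the disc of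
    radius k/2 it is at least eta/2, while |1 - x| is at most 2. *)
Lemma radial_nsq eta zeta a b k : 0 < eta -> k * (2 * eta + 1) = eta -> a * a + b * b <= k * k / 4 ->
  eta * eta / 16 <= nsq eta zeta a b.
Proof.
move=> e0 kE ab.
have k0 : 0 < k by rewrite -(pmulr_lgt0 (x := 2 * eta + 1)) ?kE //; lra.
have k1 : k < 1 by rewrite -(ltr_pM2r (x := 2 * eta + 1)) ?kE; lra.
have bb : 0 <= b * b by rewrite -expr2 sqr_ge0.
have aa : 0 <= a * a by rewrite -expr2 sqr_ge0.
have a_le : a <= k / 2 by nra.
have T : eta / 2 <= radial eta a b.
  have H1 : (2 * eta + 1) * a <= (2 * eta + 1) * (k / 2) by rewrite ler_pM2l //; lra.
  have H2 : (2 * eta + 1) * (k / 2) = eta / 2 by rewrite -[in RHS]kE; field.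
  have H3 : 0 <= (eta + 1) * (a * a + b * b) by rewrite mulr_ge0 //; lra.
  by rewrite /radial; lra.
have CS : radial eta a b * radial eta a b <= ((1 - a) * (1 - a) + b * b) * nsq eta zeta a b.
  have -> : radial eta a b = (1 - a) * numRe eta zeta a b - b * numIm eta zeta a b.
    by rewrite /radial /numRe /numIm; ring.
  rewrite /nsq; set u := numRe _ _ _ _; set v := numIm _ _ _ _.
  have : 0 <= ((1 - a) * v + b * u) * ((1 - a) * v + b * u) by rewrite -expr2 sqr_ge0.
  lra.
have N0 : 0 <= nsq eta zeta a b by rewrite /nsq addr_ge0 // -expr2 sqr_ge0.
have v4 : (1 - a) * (1 - a) + b * b <= 4.
  have : - a <= 1 by nra.
  by nra.
have TT : eta / 2 * (eta / 2) <= radial eta a b * radial eta a b by rewrite ler_pM //; lra.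
have : ((1 - a) * (1 - a) + b * b) * nsq eta zeta a b <= 4 * nsq eta zeta a b by rewrite ler_wpM2r.
lra.
Qed.

(** k is the abscissa at which eta - (2 eta + 1) a vanishes. Thus [radial] is nonnegative in the
    disc of radius k, and the ring between k/2 and k serves as collar in [barrier_down]. *)
Lemma trap_at_zero eta zeta k x y S : 0 < eta -> k * (2 * eta + 1) = eta -> trajectory eta zeta x y ->
  0 <= S -> x S * x S + y S * y S <= k * k / 4 ->
  forall s, S <= s -> x s * x s + y s * y s <= k * k / 4.
Proof.
move=> e0 kE T S0 hS s Ss.
have k0 : 0 < k by rewrite -(pmulr_lgt0 (x := 2 * eta + 1)) ?kE //; lra.
have kk : 0 < k * k by rewrite mulr_gt0.
pose h u := x u * x u + y u * y u.
have hd (u : R) : 0 <= u -> is_derive u 1 h (- 2 * h u * radial eta (x u) (y u)).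
  move=> u0; have [dx dy] := T u u0; rewrite /h; der_eq; exact: radial_derivative.
have sh (u : R) : is_derive u 1 (fun v => S + v) 1 by der_eq; rewrite add0r.
have hd' (u : R) : 0 <= u -> is_derive u 1 (fun v => h (S + v)) (- 2 * h (S + u) * radial eta (x (S + u)) (y (S + u))).
  move=> u0; have H := @der_comp _ (fun v => S + v) h u _ _ (sh u) (hd (S + u) (addr_ge0 S0 u0)).
  by apply: (is_derive_eq H); rewrite mulr1.
have := @barrier_down _ (fun v => h (S + v)) _ (k * k / 4) (k * k) _ hd' _ _ (s - S).
rewrite /= addr0 [S + (s - S)]addrC subrK; apply => //; first by lra.
- move=> u u0 /andP[h1 h2].
  have hp : 0 <= h (S + u) by rewrite /h addr_ge0 // -expr2 sqr_ge0.
  have a_le : x (S + u) <= k.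
    have : 0 <= y (S + u) * y (S + u) by rewrite -expr2 sqr_ge0.
    by move: h2; rewrite /h; nra.
  have T0 : 0 <= radial eta (x (S + u)) (y (S + u)).
    have H1 : (2 * eta + 1) * x (S + u) <= (2 * eta + 1) * k by rewrite ler_pM2l //; lra.
    have H3 : 0 <= (eta + 1) * h (S + u) by rewrite mulr_ge0 //; lra.
    by rewrite /radial -/(h (S + u)); lra.
  have := mulr_ge0 hp T0; lra.
by rewrite subr_ge0.
Qed.

(** Up to time S a nearby trajectory is compared with that of (p, q) and with the saddle by
    Gronwall; from S on it is trapped near 0, where [radial_nsq] keeps N away from 0. This yields
    one lower bound d of |N|^2 for all nearby starting points. *)
Lemma no_zeros_nearby eta zeta p q r k x y S : 0 < eta -> k * (2 * eta + 1) = eta ->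
  0 < nsq eta zeta p q -> 0 < (1 - p) * (1 - p) + q * q ->
  1 <= r -> 2 * (p * p + q * q) + 2 <= r * r ->
  trajectory eta zeta x y -> x 0 = p -> y 0 = q ->
  (forall s, 0 <= s -> x s * x s + y s * y s <= r * r) ->
  0 <= S -> x S * x S + y S * y S < k * k / 16 ->
  exists (n0 : nat) (e : R), 0 < e /\ forall n a b, (n0 <= n)%N ->
    (a - p) * (a - p) + (b - q) * (b - q) < e -> (pn (eta +i* zeta) n).[a +i* b] != 0.
Proof.
move=> e0 kE N0 P0 r1 rb T x0 y0 B S0 hS.
have k0 : 0 < k by rewrite -(pmulr_lgt0 (x := 2 * eta + 1)) ?kE //; lra.
have k1 : k < 1 by rewrite -(ltr_pM2r (x := 2 * eta + 1)) ?kE; lra.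
have kk : 0 < k * k by rewrite mulr_gt0.
have r0 : 0 <= r by lra.
have [L HL] := trajectory_gronwall eta zeta r0.
(* Up to time S squared distances shrink at most by the factor ex and grow at most by its
   inverse. *)
pose ex := expR (- `|L| * S); have ex0 : 0 < ex by exact: expR_gt0.
pose d := Num.min (nsq eta zeta p q / 4 * ex) (eta * eta / 16).
have d0 : 0 < d by rewrite lt_min mulr_gt0 // ?divr_gt0 // mulr_gt0.
pose c := ((1 - p) * (1 - p) + q * q) / 4.
have c0 : 0 < c by rewrite divr_gt0.
have D0 := den_gt0 zeta e0; set D := _ + zeta * zeta in D0.
have [n0 Hn0] := @no_zero_on_trajectory _ eta zeta r d c e0 d0 c0.
(* In turn: the start lies in the ball of radius r; it keeps away from 1; it keeps away from the
   saddle; at time S it is within k/4 of the reference trajectory, itself within k/4 of 0. *)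
pose e := Num.min (Num.min 1 c) (Num.min (nsq eta zeta p q / (4 * D)) (k * k / 16 * ex)).
exists n0, e; split.
  by rewrite !lt_min ltr01 c0 !divr_gt0 ?mulr_gt0 ?divr_gt0 ?mulr_gt0.
move=> n a b nn; rewrite !lt_min => /andP[/andP[h1 h2] /andP[h3 h4]].
have ab : a * a + b * b <= r * r.
  have : 0 <= (a - 2 * p) * (a - 2 * p) by rewrite -expr2 sqr_ge0.
  have : 0 <= (b - 2 * q) * (b - 2 * q) by rewrite -expr2 sqr_ge0.
  by move: rb h1; clear; lra.
have [x' [y' [x0' y0' _ T' B']]] := @trajectory_exists _ eta zeta r a b e0 r1 ab.
have eSL s : 0 <= s <= S -> ex <= expR (- L * s).
  move=> /andP[s0 sS]; rewrite ler_expR !mulNr lerN2.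
  apply: le_trans (ler_norm _) _; rewrite normrM [`|s|]ger0_norm // ler_wpM2l //.
have exS : expR (L * S) * ex <= 1.
  rewrite -expRD -expR0 ler_expR mulNr subr_le0 ler_wpM2r // ler_norm //.
have sad := saddle_in_ball zeta e0 r1.
have [fs1 fs2] := field_saddle zeta e0.
have Tsad := trajectory_cst fs1 fs2.
rewrite -x0' -y0'; apply: (Hn0 n x' y' S) => //.
- have [f1 f2] := field_one eta zeta.
  have r10 : 1 * 1 + 0 * 0 <= r * r by nra.
  have start : 0 < (x' 0 - 1) * (x' 0 - 1) + (y' 0 - 0) * (y' 0 - 0).
    have : 0 <= (1 - p - 2 * (a - p)) * (1 - p - 2 * (a - p)) by rewrite -expr2 sqr_ge0.
    have : 0 <= (q - 2 * (q - b)) * (q - 2 * (q - b)) by rewrite -expr2 sqr_ge0.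
    by rewrite x0' y0'; move: h2 c0; rewrite /c; clear; lra.
  move=> s s0; have := trajectory_avoid r0 T' B' f1 f2 r10 start s0.
  by congr (_ < _); ring.
- move=> s s0; have [sS|Ss] := leP s S.
    have [H _] := HL _ _ _ _ T' Tsad B' (fun _ _ => sad) s s0.
    rewrite nsqE // -/D ge_min; apply/orP; left.
    have Ns : nsq eta zeta p q / (4 * D) <= (a - saddleRe eta zeta) * (a - saddleRe eta zeta) + (b - saddleIm eta zeta) * (b - saddleIm eta zeta).
      have E := @nsqE _ eta zeta p q e0; rewrite -/D in E.
      have -> : nsq eta zeta p q / (4 * D) = ((p - saddleRe eta zeta) * (p - saddleRe eta zeta) + (q - saddleIm eta zeta) * (q - saddleIm eta zeta)) / 4.
        by rewrite E; field; rewrite lt0r_neq0.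
      have h3' : (a - p) * (a - p) + (b - q) * (b - q) < ((p - saddleRe eta zeta) * (p - saddleRe eta zeta) + (q - saddleIm eta zeta) * (q - saddleIm eta zeta)) / 4.
        apply: lt_le_trans h3 _; rewrite E le_eqVlt; apply/orP; left; apply/eqP; field.
        by rewrite lt0r_neq0.
      move: h3'; move: (saddleRe eta zeta) (saddleIm eta zeta) => u v.
      have : 0 <= (p - u - 2 * (p - a)) * (p - u - 2 * (p - a)) by rewrite -expr2 sqr_ge0.
      have : 0 <= (q - v - 2 * (q - b)) * (q - v - 2 * (q - b)) by rewrite -expr2 sqr_ge0.
      by clear; lra.
    rewrite x0' y0' in H.
    set W := (a - _) * _ + _ in H Ns.
    have W0 : 0 < W by apply: lt_le_trans Ns; rewrite divr_gt0 // mulr_gt0.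
    have sS' : 0 <= s <= S by rewrite s0.
    have H5 : W * ex <= W * expR (- L * s) by rewrite ler_pM2l // eSL.
    apply: (@le_trans _ _ (D * (W * ex))); last by rewrite ler_pM2l // (le_trans H5).
    rewrite mulrA ler_wpM2r ?(ltW ex0) //.
    have : D * (nsq eta zeta p q / (4 * D)) <= D * W by rewrite ler_pM2l.
    by rewrite [X in X <= _](_ : _ = nsq eta zeta p q / 4) //; field; rewrite lt0r_neq0.
  rewrite ge_min; apply/orP; right; apply: (radial_nsq zeta e0 kE).
  apply: (trap_at_zero e0 kE T' S0 _ (ltW Ss)).
  have [_ H] := HL _ _ _ _ T' T B' B S S0; rewrite x0' y0' x0 y0 in H.
  have H6 : (x' S - x S) * (x' S - x S) + (y' S - y S) * (y' S - y S) <= k * k / 16.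
    apply: le_trans H _; apply: (@le_trans _ _ (k * k / 16 * ex * expR (L * S))).
      by rewrite ler_wpM2r ?expR_ge0 // ltW.
    by rewrite -mulrA ler_piMr ?divr_ge0 ?(ltW kk) // mulrC.
  have : 0 <= (x' S - 2 * x S) * (x' S - 2 * x S) by rewrite -expr2 sqr_ge0.
  have : 0 <= (y' S - 2 * y S) * (y' S - 2 * y S) by rewrite -expr2 sqr_ge0.
  by move: H6 hS; clear; lra.
- move=> s Ss; apply: (@le_trans _ _ (k * k / 4)); last by nra.
  apply: (trap_at_zero e0 kE T' S0 _ Ss).
  have [_ H] := HL _ _ _ _ T' T B' B S S0; rewrite x0' y0' x0 y0 in H.
  have H6 : (x' S - x S) * (x' S - x S) + (y' S - y S) * (y' S - y S) <= k * k / 16.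
    apply: le_trans H _; apply: (@le_trans _ _ (k * k / 16 * ex * expR (L * S))).
      by rewrite ler_wpM2r ?expR_ge0 // ltW.
    by rewrite -mulrA ler_piMr ?divr_ge0 ?(ltW kk) // mulrC.
  have : 0 <= (x' S - 2 * x S) * (x' S - 2 * x S) by rewrite -expr2 sqr_ge0.
  have : 0 <= (y' S - 2 * y S) * (y' S - 2 * y S) by rewrite -expr2 sqr_ge0.
  by move: H6 hS; clear; lra.
rewrite x0' y0'.
have : 0 <= (1 - p - 2 * (a - p)) * (1 - p - 2 * (a - p)) by rewrite -expr2 sqr_ge0.
have : 0 <= (q - 2 * (q - b)) * (q - 2 * (q - b)) by rewrite -expr2 sqr_ge0.
by move: h2; rewrite /c; clear; lra.
Qed.

End NotLimit.

(** * Continuity and connectedness in the complex plane *)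

Section ComplexTopology.
Context {R : realType}.
Implicit Types (z w t : R[i]) (s : R) (f g : R -> R).

Lemma normc_lt z (e : R[i]) : 0 < e -> (`|z| < e) = (sqn z < complex.Re e * complex.Re e).
Proof.
case: e => e e'; rewrite ltcE /= => /andP[/eqP -> e0]; rewrite normc_def ltcE /= eqxx /=.
have -> : complex.Re z ^+ 2 + complex.Im z ^+ 2 = sqn z by rewrite /sqn !expr2.
by rewrite -(ltr_pXn2r (n := 2)) ?nnegrE ?sqrtr_ge0 ?(ltW e0) // sqr_sqrtr ?sqn_ge0 // expr2.
Qed.

Lemma cvg_complex_sqn (u : nat -> R[i]) z (e : R) : u @ \oo --> z -> 0 < e ->
  exists N : nat, forall n, (N <= n)%N -> sqn (u n - z) < e.
Proof.
move=> /cvgrPdist_lt uz e0; pose d := Num.sqrt e.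
have d0 : 0 < d%:C by rewrite ltcR sqrtr_gt0.
have [N _ HN] := uz _ d0; exists N => n /HN; rewrite /= normc_lt //=.
rewrite -expr2 sqr_sqrtr ?(ltW e0) //; congr (_ < _).
by rewrite -opprB /sqn !raddfN /= !mulrNN.
Qed.

Lemma sqn_near (F : set_system R) {FF : Filter F} (u : R -> R[i]) z :
  (forall e : R, 0 < e -> \forall t \near F, sqn (z - u t) < e) -> u @ F --> z.
Proof.
move=> H; apply/cvgrPdist_lt => e e0.
have e0' : 0 < complex.Re e by move: e0; case: e => a b; rewrite ltcE /= => /andP[].
have := H _ (mulr_gt0 e0' e0'); apply: filterS => t.
by rewrite normc_lt.
Qed.

Lemma complex_path_continuous f g : continuous f -> continuous g ->
  continuous (fun s => f s +i* g s : R[i]).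
Proof.
move=> fc gc s; apply: sqn_near => e e0.
have d0 : 0 < Num.sqrt (e / 2) by rewrite sqrtr_gt0 divr_gt0.
have dd : Num.sqrt (e / 2) * Num.sqrt (e / 2) = e / 2 by rewrite -expr2 sqr_sqrtr // divr_ge0 // ltW.
have /cvgrPdist_lt /(_ _ d0) Hf := fc s; have /cvgrPdist_lt /(_ _ d0) Hg := gc s.
near=> t.
have : `|f s - f t| < Num.sqrt (e / 2) by near: t.
have : `|g s - g t| < Num.sqrt (e / 2) by near: t.
rewrite /sqn /= !ltr_norml => /andP[g1 g2] /andP[f1 f2].
have -> : e = e / 2 + e / 2 by field.
by rewrite -dd ltrD //; nra.
Unshelve. all: by end_near. Qed.

Lemma within_complex_path f g (a b : R) : {within `[a, b], continuous f} -> {within `[a, b], continuous g} ->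
  {within `[a, b], continuous (fun s => f s +i* g s : R[i])}.
Proof.
move=> /subspace_continuousP fc /subspace_continuousP gc; apply/subspace_continuousP => s sab.
apply: sqn_near => e e0.
have d0 : 0 < Num.sqrt (e / 2) by rewrite sqrtr_gt0 divr_gt0.
have dd : Num.sqrt (e / 2) * Num.sqrt (e / 2) = e / 2 by rewrite -expr2 sqr_sqrtr // divr_ge0 // ltW.
have /cvgrPdist_lt /(_ _ d0) Hf := fc s sab; have /cvgrPdist_lt /(_ _ d0) Hg := gc s sab.
move: Hf Hg; apply: filterS2 => t.
move=> Hf Hg.
have /andP[f1 f2] : - Num.sqrt (e / 2) < f s - f t < Num.sqrt (e / 2) by rewrite -ltr_norml; exact: Hf.
have /andP[g1 g2] : - Num.sqrt (e / 2) < g s - g t < Num.sqrt (e / 2) by rewrite -ltr_norml; exact: Hg.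
change (sqn ((f s +i* g s) - (f t +i* g t) : R[i]) < e); rewrite /sqn /=.
have -> : e = e / 2 + e / 2 by field.
by rewrite -dd ltrD //; nra.
Qed.

Lemma within_linear_part (G : R -> R[i]) (c d : R) (a b : R) :
  {within `[a, b], continuous G} ->
  {within `[a, b], continuous (fun s => c * complex.Re (G s) + d * complex.Im (G s))}.
Proof.
move=> /subspace_continuousP Gc; apply/subspace_continuousP => s sab; apply/cvgrPdist_lt => e e0.
pose k := `|c| + `|d| + 1; have k0 : 0 < k by rewrite ltr_wpDl // addr_ge0.
have d0 : 0 < (e / k)%:C by rewrite ltcR divr_gt0.
have /cvgrPdist_lt /(_ _ d0) := Gc s sab; apply: filterS => t; rewrite normc_lt //= => H.
change (`|c * complex.Re (G s) + d * complex.Im (G s) - (c * complex.Re (G t) + d * complex.Im (G t))| < e).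
have : sqn (G s - G t) < e / k * (e / k) by exact: H.
case: (G s) (G t) {H} => [p q] [p' q']; rewrite /sqn /= => H.
have -> : c * p + d * q - (c * p' + d * q') = c * (p - p') + d * (q - q') by ring.
have small (u v : R) : u * u + v * v < e / k * (e / k) -> `|u| < e / k.
  have ek : 0 < e / k by rewrite divr_gt0.
  move=> uv; have vv : 0 <= v * v by rewrite -expr2 sqr_ge0.
  by rewrite ltr_norml; apply/andP; split; nra.
have h1 := small _ _ H; have h2 : `|q - q'| < e / k by apply: (small _ (p - p')); rewrite addrC.
apply: le_lt_trans (ler_normD _ _) _; rewrite !normrM.
have ek : 0 < e / k by rewrite divr_gt0.
have -> : e = (`|c| + `|d| + 1) * (e / k) by rewrite -/k mulrC divfK // lt0r_neq0.
have : `|c| * `|p - p'| <= `|c| * (e / k) by rewrite ler_wpM2l // ltW.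
have : `|d| * `|q - q'| <= `|d| * (e / k) by rewrite ler_wpM2l // ltW.
by rewrite !mulrDl mul1r; lra.
Qed.

Lemma component_of_path (A : set R[i]) f g (S : R) : 0 <= S -> continuous f -> continuous g ->
  (forall s, 0 <= s <= S -> A (f s +i* g s)) ->
  connected_component A (f 0 +i* g 0) (f S +i* g S).
Proof.
move=> S0 fc gc H.
have C : connected ((fun s => f s +i* g s : R[i]) @` `[0, S]).
  apply: connected_continuous_connected; first exact: segment_connected.
  by apply: continuous_subspaceT; exact: complex_path_continuous.
apply: (connected_component_max (B := (fun s => f s +i* g s : R[i]) @` `[0, S])) => //.
- by exists 0 => //=; rewrite in_itv /= lexx.
- by move=> w [s]; rewrite /= in_itv /= => Hs <-; exact: H.
by exists S => //=; rewrite in_itv /= lexx andbT.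
Qed.

End ComplexTopology.

(** * Translation between the t-plane and the x-plane *)

Section Bridge.
Context {R : realType}.
Implicit Types (eta zeta s : R) (z w t : R[i]).

Lemma complexE z : z = complex.Re z +i* complex.Im z.
Proof. by case: z. Qed.

Lemma saddleE eta zeta z : 0 < eta -> z != 0 ->
  z * saddle (eta +i* zeta) z = saddleRe eta zeta +i* saddleIm eta zeta.
Proof.
move=> e0 z0; have D0 := den_gt0 zeta e0; set alpha := eta +i* zeta.
have a1 : alpha + 1 != 0.
  by rewrite -sqn_gt0 /sqn /= addr0.
have -> : z * saddle alpha z = alpha / (alpha + 1) by rewrite /saddle; field; rewrite z0 a1.
apply: (mulIf a1); rewrite divfK //.
apply/eqP; rewrite eq_complex /saddleRe /saddleIm /=; apply/andP; split; apply/eqP; field.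
  by rewrite lt0r_neq0.
by rewrite lt0r_neq0.
Qed.

(** z times the gradient in t is the velocity of x = z t. Writing 1 / conj (x (1 - x)) as x (1 - x)
    / |x (1 - x)|^2 shows it as a positive multiple of the reversed field. *)
Lemma dphi_conj eta zeta z t : z != 0 -> t != 0 -> 1 - z * t != 0 ->
  z * (dphi (eta +i* zeta) z t)^* = (sqn z / (sqn (z * t) * sqn (1 - z * t)))%:C *
    - (fieldRe eta zeta (complex.Re (z * t)) (complex.Im (z * t)) +i*
       fieldIm eta zeta (complex.Re (z * t)) (complex.Im (z * t))).
Proof.
move=> z0 t0 v0; set alpha := eta +i* zeta.
rewrite fieldE opprK -complexE -/alpha /dphi.
set N := alpha - (alpha + 1) * z * t.
have -> : alpha - (alpha + 1) * (z * t) = N by rewrite /N mulrA.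
set v := 1 - z * t in v0 *.
have cz : z^* != 0 by rewrite conjc_eq0.
have ct : t^* != 0 by rewrite conjc_eq0.
have cv : v^* != 0 by rewrite conjc_eq0.
have -> : (sqn z / (sqn (z * t) * sqn v))%:C = (z^* * z) / (z^* * z * (t^* * t) * (v^* * v)) :> R[i].
  by rewrite !conjc_mul -!rmorphM -fmorph_div sqnM.
have -> : (N / (t * v))^* = N^* / (t^* * v^*) by rewrite (fmorph_div (@conjc R)) (rmorphM (@conjc R)).
by field; rewrite z0 t0 v0 cz ct cv.
Qed.

Lemma dphi_eq0 alpha z t : t != 0 -> 1 - z * t != 0 ->
  (dphi alpha z t == 0) = (alpha - (alpha + 1) * (z * t) == 0).
Proof. by move=> t0 v0; rewrite /dphi mulf_eq0 invr_eq0 mulf_eq0 (negbTE t0) (negbTE v0) !orbF mulrA. Qed.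

Lemma ascent_curvesP eta zeta z t : 0 < eta -> z != 0 ->
  ascent_curves (eta +i* zeta) z t <->
  ascent_from_saddle eta zeta (complex.Re (z * t)) (complex.Im (z * t)).
Proof.
move=> e0 z0; set alpha := eta +i* zeta; split.
  move=> [g [gc ga] [g0 [s s01 gs]]].
  exists (fun s => complex.Re (z * g s)), (fun s => complex.Im (z * g s)); split.
  - split.
    + have H := @within_linear_part _ g (complex.Re z) (- complex.Im z) 0 1 gc.
      suff -> : (fun u => complex.Re (z * g u)) = (fun u => complex.Re z * complex.Re (g u) + - complex.Im z * complex.Im (g u)) by [].
      by apply/funext => u; rewrite ReM mulNr.
    + have H := @within_linear_part _ g (complex.Im z) (complex.Re z) 0 1 gc.
      suff -> : (fun u => complex.Im (z * g u)) = (fun u => complex.Im z * complex.Re (g u) + complex.Re z * complex.Im (g u)) by [].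
      by apply/funext => u; rewrite ImM addrC.
    move=> u u01; have [gu vu du [c c0 [d1 d2]]] := ga u u01.
    set x := z * g u; have x0 : x != 0 by rewrite mulf_neq0.
    have nE := sqn_num eta zeta (complex.Re x) (complex.Im x); rewrite -complexE in nE.
    split.
    + by rewrite -nE sqn_gt0 /x -(dphi_eq0 alpha gu vu).
    + by have := x0; rewrite -sqn_gt0.
    + by have := vu; rewrite -/x -sqn_gt0 /sqn /= !raddfD !raddfN /= sub0r mulrNN.
    pose k := sqn z / (sqn x * sqn (1 - x)).
    have k0 : 0 < k by rewrite divr_gt0 ?mulr_gt0 // sqn_gt0.
    exists (c * k); first by rewrite mulr_gt0.
    have C : cder g u (c%:C * (dphi alpha z (g u))^*) by split.
    have D := cderM (cderC z u) C.
    have E : 0 * g u + z * (c%:C * (dphi alpha z (g u))^*) = (c * k)%:C *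
      - (fieldRe eta zeta (complex.Re x) (complex.Im x) +i* fieldIm eta zeta (complex.Re x) (complex.Im x)).
      rewrite mul0r add0r mulrCA dphi_conj // -/x -/k mulrA -rmorphM //.
    rewrite E in D; have [D1 D2] := D; split.
      by apply: (is_derive_eq D1); rewrite ReM /= mul0r subr0 mulrN mulNr.
    by apply: (is_derive_eq D2); rewrite ImM /= mul0r addr0 mulrN mulNr.
  - by rewrite g0 saddleE.
  - by rewrite g0 saddleE.
  by exists s => //; rewrite gs.
move=> [X [Y [[Xc Yc A] X0 Y0 [s s01 [Xs Ys]]]]].
pose g u := (X u +i* Y u) * z^-1.
have zg u : z * g u = X u +i* Y u by rewrite /g mulrC divfK.
have gC : {within `[0, 1], continuous g}.
  have XY := within_complex_path Xc Yc.
  have H1 := @within_linear_part _ _ (complex.Re z^-1) (- complex.Im z^-1) 0 1 XY.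
  have H2 := @within_linear_part _ _ (complex.Im z^-1) (complex.Re z^-1) 0 1 XY.
  have H := within_complex_path H1 H2.
  suff -> : g = (fun u => (complex.Re z^-1 * X u + - complex.Im z^-1 * Y u) +i* (complex.Im z^-1 * X u + complex.Re z^-1 * Y u)) by [].
  by apply/funext => u; rewrite [LHS]complexE /g ReM ImM /=; congr (_ +i* _); ring.
exists g; last first.
  split; first by apply: (mulfI z0); rewrite zg X0 Y0 saddleE.
  by exists s => //; apply: (mulfI z0); rewrite zg Xs Ys -complexE.
split => // u u01; have [nu hu vu [c c0 [d1 d2]]] := A u u01.
have x0 : z * g u != 0 by rewrite zg -sqn_gt0.
have g0 : g u != 0 by move: x0; rewrite mulf_eq0 negb_or => /andP[].
have v0 : 1 - z * g u != 0 by rewrite zg -sqn_gt0 /sqn /= sub0r mulrNN.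
have D0 : dphi alpha z (g u) != 0.
  by rewrite dphi_eq0 // zg; have := nu; rewrite -sqn_num sqn_gt0.
split => //.
pose k := sqn z / (sqn (z * g u) * sqn (1 - z * g u)).
have k0 : 0 < k by rewrite divr_gt0 ?mulr_gt0 // sqn_gt0.
exists (c / k); first by rewrite divr_gt0.
have C : cder (fun u => X u +i* Y u) u (c%:C * - (fieldRe eta zeta (X u) (Y u) +i* fieldIm eta zeta (X u) (Y u))).
  split; [apply: (is_derive_eq d1); rewrite ReM /= mul0r subr0 | apply: (is_derive_eq d2); rewrite ImM /= mul0r addr0]; ring.
have D := cderM C (cderC z^-1 u); rewrite mulr0 addr0 in D.
have E : (c / k)%:C * (dphi alpha z (g u))^* =
   c%:C * - (fieldRe eta zeta (X u) (Y u) +i* fieldIm eta zeta (X u) (Y u)) * z^-1.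
  apply: (mulfI z0); rewrite mulrCA dphi_conj // -/k zg /=.
  rewrite mulrA -rmorphM /= divfK ?lt0r_neq0 //.
  by rewrite [in RHS]mulrC divfK.
by rewrite /= E; exact: D.
Qed.

End Bridge.

Theorem mainTheorem2 (R : realType) (eta zeta : R)
  (eta_gt0 : 0 < eta) (zeta_neq0 : zeta != 0)
  (z : R[i]) (zE : ~ exceptional_set (eta +i* zeta) z) :
  ~ exists u : nat -> R[i],
      (forall n : nat, (0 < n)%N -> (pn (eta +i* zeta) n).[u n] = 0) /\
      u @ \oo --> z.
Proof.
move=> [u [u0 uz]]; set alpha := eta +i* zeta in zE u0.
pose p := complex.Re z; pose q := complex.Im z.
pose k := eta / (2 * eta + 1).
have kE : k * (2 * eta + 1) = eta by rewrite /k divfK // lt0r_neq0 //; lra.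
(* As r >= 2, its square is at least 2 |z|^2 + 2, which leaves room in the ball for starting points
   near z. *)
pose r := 2 * (p * p + q * q) + 2.
have pq : 0 <= p * p + q * q by rewrite addr_ge0 // -expr2 sqr_ge0.
have r1 : 1 <= r by rewrite /r; lra.
have rb : 2 * (p * p + q * q) + 2 <= r * r by rewrite -/r; nra.
have pqr : p * p + q * q <= r * r by lra.
have [x [y [x0 y0 [xc yc] T B]]] := @trajectory_exists _ eta zeta r p q eta_gt0 r1 pqr.
have final S : 0 < nsq eta zeta p q -> 0 < (1 - p) * (1 - p) + q * q ->
    0 <= S -> x S * x S + y S * y S < k * k / 16 -> False.
  move=> N0 P0 S0 hS.
  have [n0 [e [e0 H]]] := no_zeros_nearby eta_gt0 kE N0 P0 r1 rb T x0 y0 B S0 hS.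
  have [N HN] := cvg_complex_sqn uz e0.
  pose n := (n0 + N).+1.
  have := H n (complex.Re (u n)) (complex.Im (u n)); rewrite -complexE u0 // eqxx.
  have nn0 : (n0 <= n)%N by rewrite /n leqW // leq_addr.
  have nN : (N <= n)%N by rewrite /n leqW // leq_addl.
  by have := HN n nN; rewrite /sqn !raddfB /= => d1 /(_ nn0 d1).
have k0 : 0 < k by rewrite divr_gt0 //; lra.
have k16 : 0 < k * k / 16 by rewrite divr_gt0 // mulr_gt0.
(* 0 is outside the exceptional set by definition; its trajectory is at 0 from the start, so S = 0
   serves. *)
have [z0|z0] := eqVneq z 0.
  have [p0 q0] : p = 0 /\ q = 0 by rewrite /p /q z0.
  apply: (final 0) => //.
  - rewrite p0 q0 /nsq /numRe /numIm !mulr0 addr0 !subr0.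
    by rewrite ltr_pwDl ?mulr_gt0 // -expr2 sqr_ge0.
  - by rewrite p0 q0; lra.
  by rewrite x0 y0 p0 q0 !mul0r addr0.
have zR : ~ region alpha z z^-1 1 by move=> ?; apply: zE.
have CP t := @ascent_curvesP _ eta zeta z t eta_gt0 z0.
have noasc : ~ ascent_from_saddle eta zeta p q.
  move=> H; apply: zR; left; apply/CP; by rewrite mulr1.
have nocomp : ~ connected_component (~` ascent_curves alpha z) z^-1 1 by move=> ?; apply: zR; right.
have pathc (f g : R -> R) S : 0 <= S -> continuous f -> continuous g ->
    (forall s, 0 <= s <= S -> ~ ascent_from_saddle eta zeta (f s) (g s)) ->
    connected_component (~` ascent_curves alpha z) (z^-1 * (f 0 +i* g 0)) (z^-1 * (f S +i* g S)).
  move=> S0 fc gc H.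
  pose i1 := complex.Re z^-1; pose i2 := complex.Im z^-1.
  have mE s : z^-1 * (f s +i* g s) = (i1 * f s - i2 * g s) +i* (i1 * g s + i2 * f s).
    by rewrite [LHS]complexE ReM ImM.
  rewrite !mE; apply: (@component_of_path _ _ (fun s => i1 * f s - i2 * g s) (fun s => i1 * g s + i2 * f s)) => //.
  - by move=> s; apply: cvgB; apply: cvgM; [exact: cvg_cst | exact: fc | exact: cvg_cst | exact: gc].
  - by move=> s; apply: cvgD; apply: cvgM; [exact: cvg_cst | exact: gc | exact: cvg_cst | exact: fc].
  move=> s s01 /CP; rewrite -mE mulrA mulfV // mul1r /=; exact: H.
(* In the variable x = z t the base point z^-1 becomes 1, whence segments issued from 1. *)
have seg (a b : R) : (forall s, 0 <= s <= 1 -> ~ ascent_from_saddle eta zeta (1 - s * (1 - a)) (s * b)) ->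
    connected_component (~` ascent_curves alpha z) z^-1 (z^-1 * (a +i* b)).
  move=> H; have := pathc (fun s => 1 - s * (1 - a)) (fun s => s * b) 1 ler01 _ _ H.
  have -> : (1 - 0 * (1 - a)) +i* (0 * b) = 1 :> R[i] by rewrite !mul0r subr0.
  have -> : (1 - 1 * (1 - a)) +i* (1 * b) = a +i* b by congr (_ +i* _); ring.
  rewrite mulr1; apply.
    by move=> s; apply: cvgB; [exact: cvg_cst | apply: cvgM; [exact: cvg_id | exact: cvg_cst]].
  by move=> s; apply: cvgM; [exact: cvg_id | exact: cvg_cst].
have zzE : z^-1 * (p +i* q) = 1 by rewrite -complexE mulVf.
(* If z were 1, then z^-1 = 1 would lie in its own component, being off the ascent curves. *)
have P0 : 0 < (1 - p) * (1 - p) + q * q.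
  have -> : (1 - p) * (1 - p) + q * q = sqn (1 - z) by rewrite /sqn !raddfB /= sub0r mulrNN.
  rewrite sqn_gt0 subr_eq0 eq_sym; apply/eqP => z1; apply: nocomp.
  have -> : z^-1 = 1 by rewrite z1 invr1.
  by apply: connected_component_refl => /CP; rewrite mulr1.
(* If z were the saddle in the x-plane, any ascent curve at all would start at z, against [noasc];
   without ascent curves the segment from 1 to z is free, and 1 lies in the component of z^-1. *)
have N0 : 0 < nsq eta zeta p q.
  rewrite lt0r /nsq addr_ge0 -?expr2 ?sqr_ge0 // andbT; apply/eqP => nz; apply: nocomp; rewrite -zzE.
  apply: seg => s _ [X [Y [As X0 Y0 _]]]; apply: noasc; exists X, Y; split => //.
  exists 0; rewrite ?lexx ?ler01 // X0 Y0.
  have := @nsqE _ eta zeta p q eta_gt0; rewrite /nsq -!expr2 nz => /esym/eqP.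
  rewrite mulf_eq0 (gt_eqF (den_gt0 zeta eta_gt0)) /= paddr_eq0 ?sqr_ge0 // !sqrf_eq0 !subr_eq0.
  by move=> /andP[/eqP <- /eqP <-].
have r0 : 0 <= r by lra.
have Z0 : 0 < p * p + q * q by have := z0; rewrite -sqn_gt0.
have reg s : 0 <= s -> regular eta zeta (x s) (y s).
  move=> s0; split.
  - have [f1 f2] := field_saddle zeta eta_gt0.
    rewrite nsqE // mulr_gt0 ?den_gt0 //.
    apply: (trajectory_avoid r0 T B f1 f2 (saddle_in_ball zeta eta_gt0 r1)) => //.
    by move: N0; rewrite nsqE // pmulr_rgt0 ?den_gt0 // x0 y0.
  - have [f1 f2] := field_zero eta zeta.
    have := trajectory_avoid r0 T B f1 f2 _ _ s0; rewrite x0 y0 !subr0; apply => //.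
    by rewrite !mul0r addr0 -expr2 sqr_ge0.
  have [f1 f2] := field_one eta zeta.
  have := trajectory_avoid r0 T B f1 f2 _ _ s0; rewrite x0 y0 !subr0.
  have -> : (p - 1) * (p - 1) = (1 - p) * (1 - p) by ring.
  have -> : (x s - 1) * (x s - 1) = (1 - x s) * (1 - x s) by ring.
  by apply => //; nra.
pose d1 := (2 * (eta + 2 + `|zeta|))^-1.
have kd : 0 < 2 * (eta + 2 + `|zeta|) by have := normr_ge0 zeta; lra.
have d1E : d1 * (2 * (eta + 2 + `|zeta|)) = 1 by rewrite mulVf // lt0r_neq0.
have d10 : 0 < d1 * d1 by rewrite mulr_gt0 // invr_gt0.
have noasc' : ~ ascent_from_saddle eta zeta (x 0) (y 0) by rewrite x0 y0.
have [[S S0 hS]|[S S0 [hS avoid]]] := descent_alternative eta_gt0 zeta_neq0 r0 k16 d10 T xc yc B reg noasc'.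
  exact: final hS.
(* From x = 1 a segment inside the disc that ascent curves avoid reaches the trajectory at time S;
   the trajectory then leads back to z, which is t = 1. *)
apply: nocomp; rewrite -zzE -x0 -y0.
apply: (connected_component_trans (y := z^-1 * (x S +i* y S))).
  apply: seg => s /andP[s0 s1]; apply: (ascent_avoids_disc eta_gt0 d1E).
  apply: le_lt_trans hS.
  have -> : (1 - (1 - s * (1 - x S))) * (1 - (1 - s * (1 - x S))) + s * y S * (s * y S) =
    s * s * ((1 - x S) * (1 - x S) + y S * y S) by ring.
  rewrite ler_piMl ?addr_ge0 -?expr2 ?sqr_ge0 //.
  by rewrite expr2 mulr_ile1.
apply: connected_component_sym; apply: pathc => // s /andP[s0 _]; exact: avoid.
Qed.
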